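(* Let $\alpha\in(0,1]$, $n\in\mathbb{N}$, $\rho_0\in\mathbb{R}$, and let $f:\mathbb{R}_{>0}\times\mathbb{C}^n\to\mathbb{C}^n$ be continuous with $|f(t,y_1)-f(t,y_2)|\leq c|y_1-y_2|$ for some $c\geq0$ and all $y_1,y_2\in\mathbb{C}^n$, $t>0$, and with $(t\mapsto f(t,0))\in L^2_{\rho_0}(\mathbb{R}_{>0};\mathbb{C}^n)$. Define $\tilde f(t,y):=f(t,y)$ for $t>0$ and $\tilde f(t,y):=0$ for $t\leq0$. Let $y_0\in\mathbb{C}^n$. Then there is $\rho_1>0$ such that for all $\rho\geq\rho_1$ there exists a unique $y\in L^2_\rho(\mathbb{R};\mathbb{C}^n)$ with $y-y_0\chi_{\mathbb{R}_{>0}}\in H^\alpha_\rho(\mathbb{R};\mathbb{C}^n)$ satisfying \[\partial^\alpha_{0,\rho}(y-y_0\chi_{\mathbb{R}_{>0}})=\tilde f(\cdot,y(\cdot)).\] Moreover, $\operatorname{spt}y\subseteq\mathbb{R}_{\geq0}$.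
   Context: $\chi_{\mathbb{R}_{>0}}$ is the indicator function of $(0,\infty)$. For $\rho\in\mathbb{R}$, $L^2_\rho(\mathbb{R};\mathbb{C}^n)$ is the space of measurable $g$ with $\int|g(t)|^2e^{-2\rho t}dt<\infty$ (similarly on $\mathbb{R}_{>0}$); $\mathcal{L}_\rho g(\xi)=(2\pi)^{-1/2}\int e^{-(i\xi+\rho)t}g(t)\,dt$ (extended to a unitary map $L^2_\rho(\mathbb{R};\mathbb{C}^n)\to L^2(\mathbb{R};\mathbb{C}^n)$). For $\rho>0$, $\gamma\geq0$: $H^\gamma_\rho(\mathbb{R};\mathbb{C}^n):=\{u\in L^2_\rho:(\xi\mapsto(i\xi+\rho)^\gamma\mathcal{L}_\rho u(\xi))\in L^2\}$ (principal branch) with norm $\|(i\xi+\rho)^\gamma\mathcal{L}_\rho u\|_{L^2}$, and $\partial^\gamma_{0,\rho}u:=\mathcal{L}_\rho^{*}\big((i\xi+\rho)^\gamma\mathcal{L}_\rho u\big)$. Support is the usual (essential) support of an $L^2_\rho$ function. *)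

(* Defs.v *)
From HB Require Import structures.
From mathcomp Require Import all_boot all_order all_algebra.
From mathcomp Require Import all_classical all_reals all_analysis.
From mathcomp.real_closed Require Import complex.
Set Implicit Arguments. Unset Strict Implicit. Unset Printing Implicit Defensive.
Import Order.TTheory GRing.Theory Num.Theory.
Import numFieldNormedType.Exports.
Local Open Scope classical_set_scope.
Local Open Scope ring_scope.

Section FL.
Variable R : realType.
Local Notation C := (complex R).
Local Notation mu := (@lebesgue_measure R).

Definition cvnorm2 (n : nat) (v : 'I_n -> C) : R :=
  \sum_(i < n) (complex.Re (v i) ^+ 2 + complex.Im (v i) ^+ 2).
Definition cvnorm (n : nat) (v : 'I_n -> C) : R := Num.sqrt (cvnorm2 v).

Definition cvsub (n : nat) (v w : 'I_n -> C) : 'I_n -> C := fun i => v i - w i.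
Definition cvzero (n : nat) : 'I_n -> C := fun _ => 0.

Definition cmeasurable (n : nat) (D : set R) (u : R -> 'I_n -> C) : Prop :=
  forall i, measurable_fun D (fun t => complex.Re (u t i)) /\
            measurable_fun D (fun t => complex.Im (u t i)).

Definition L2rho_on (rho : R) (n : nat) (D : set R) (u : R -> 'I_n -> C) : Prop :=
  cmeasurable D u /\
  (\int[mu]_(t in D) ((cvnorm2 (u t) * expR (- (2 * rho * t)))%:E) < +oo)%E.

Definition L2rho (rho : R) (n : nat) (u : R -> 'I_n -> C) : Prop :=
  L2rho_on rho setT u.

Definition cint (D : set R) (g : R -> C) : C :=
  Complex (Rintegral mu D (fun t => complex.Re (g t)))
          (Rintegral mu D (fun t => complex.Im (g t))).

(* e^{-(i xi + rho) t} *)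
Definition cexpFL (rho xi t : R) : C :=
  Complex (expR (- (rho * t)) * cos (xi * t)) (- (expR (- (rho * t)) * sin (xi * t))).

Definition FLtrunc (rho : R) (n : nat) (u : R -> 'I_n -> C) (r xi : R) : 'I_n -> C :=
  fun i => (Complex (Num.sqrt (2 * pi))^-1 0) * cint `[- r, r] (fun t => cexpFL rho xi t * u t i).

(* g = L_rho u, the unitary extension of the Fourier-Laplace transform to
   L^2_rho: u in L^2_rho, g in L^2, and g is the L^2-limit of the truncated
   transforms (Plancherel). *)
Definition is_FL (rho : R) (n : nat) (u : R -> 'I_n -> C) (g : R -> 'I_n -> C) : Prop :=
  L2rho rho u /\ L2rho 0 g /\
  ((\int[mu]_xi ((cvnorm2 (cvsub (FLtrunc rho u r xi) (g xi)))%:E))%E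
     @[r --> +oo] --> 0%E).

(* principal branch of (i xi + rho)^gam for rho > 0:
   |i xi + rho|^gam * e^{i gam arg(i xi + rho)}, arg = atan (xi / rho) *)
Definition powFL (rho gam xi : R) : C :=
  let m := (xi ^+ 2 + rho ^+ 2) `^ (gam / 2) in
  let a := gam * atan (xi / rho) in
  Complex (m * cos a) (m * sin a).

Definition Hrho (rho gam : R) (n : nat) (u : R -> 'I_n -> C) : Prop :=
  exists g, is_FL rho u g /\ L2rho 0 (fun xi i => powFL rho gam xi * g xi i).

(* partial^gam_{0,rho} u = v, i.e. v = L_rho^* ((i xi + rho)^gam L_rho u),
   equivalently (L_rho unitary) L_rho v = (i xi + rho)^gam L_rho u *)
Definition frac_deriv_eq (rho gam : R) (n : nat) (u v : R -> 'I_n -> C) : Prop :=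
  exists g, is_FL rho u g /\ is_FL rho v (fun xi i => powFL rho gam xi * g xi i).

Definition y0chi (n : nat) (y0 : 'I_n -> C) : R -> 'I_n -> C :=
  fun t => if 0 < t then y0 else @cvzero n.

Definition ftilde (n : nat) (f : R -> ('I_n -> C) -> ('I_n -> C)) (t : R) (y : 'I_n -> C)
  : 'I_n -> C := if 0 < t then f t y else @cvzero n.

Definition is_solution (rho alpha : R) (n : nat) (f : R -> ('I_n -> C) -> ('I_n -> C))
  (y0 : 'I_n -> C) (y : R -> 'I_n -> C) : Prop :=
  L2rho rho y /\
  Hrho rho alpha (fun t => cvsub (y t) (y0chi y0 t)) /\
  frac_deriv_eq rho alpha (fun t => cvsub (y t) (y0chi y0 t)) (fun t => ftilde f t (y t)).

End FL.

(* Main.v *)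
(** Weighting by [e^(- rho t)] turns [L_rho] into the Fourier transform. Let [k] be the
    kernel [e^(- rho t) t^(alpha - 1) / Gamma(alpha)] on [t > 0]. Differentiating its
    transform along the scaling [(rho, xi) -> l (rho, xi)], under which it is homogeneous of
    degree [- alpha], gives Euler relations from which the transform is seen to be
    [(i xi + rho)^(- alpha)]. Hence, as soon as the transform is injective on [L^2] and takes
    convolution by [k] to multiplication, the weighted equation is equivalent to the
    fixed point equation [y = y0 chi + k * F(y)].

    The [L^2] transform is not taken from Plancherel's theorem: a bound of the transform by
    a constant times the [L^2] norm and injectivity suffice. Both come from pairing with the
    kernel [(1 - cos (d xi)) / xi^2], whose transform is a multiple of a hat function
    supported in [[- d, d]]: for the bound one lets [d -> 0] after Young's inequality for the
    convolution by the hat, and for injectivity one applies Lebesgue differentiation to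
    averages against the hats. Riesz-Fischer then provides the limits of the truncated
    transforms.

    Finally the integral of [k] is [rho^(- alpha)], so by Young's inequality the fixed point
    map has Lipschitz constant [c rho^(- alpha)], which is small for large [rho]. As [k]
    vanishes on [t <= 0], so does [k * F(y)]. *)
Require Import Defs.
From HB Require Import structures.
From mathcomp Require Import all_boot all_order all_algebra.
From mathcomp Require Import all_classical all_reals all_analysis.
From mathcomp.real_closed Require Import complex.
From mathcomp Require Import measurable_realfun.
From mathcomp Require Import ring lra zify.
Set Implicit Arguments. Unset Strict Implicit. Unset Printing Implicit Defensive.
Import Order.TTheory GRing.Theory Num.Theory.
Import numFieldNormedType.Exports.
Local Open Scope classical_set_scope.
Local Open Scope ring_scope.

(** * Square-integrable functions *)

(** Only real integrals are taken, so a transform is carried as the pair [cosT], [sinT], and complex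
    vectors enter through [wre] and [wim]. The price is that the transform of a complex function
    mixes the cosine part of one component with the sine part of the other; parity in [xi] undoes
    this.

    The transform is a limit over truncations, and truncation does not commute with convolution.
    Multiplication by the symbol is therefore exact only for truncated functions, and the commutator
    has to be shown to vanish in norm.

    All norms are squared. This explains the numbers: the factor [1 / 16] in squared norm is a
    Lipschitz constant [1 / 4], obtained by making [rho] to the power [alpha] at least [4 * c], and
    the rate [16 ^+ k] leaves room for a weight [4 ^+ k] in the Riesz-Fischer argument.

    Limits in norm give a fixed point only up to a null set. Convolution ignores null sets, so one
    more application of the fixed point map yields a function that solves the integrated equation at
    every point; its support can then be read off pointwise. *)

Section L2_toolkit.
Context {R : realType}.
Local Notation mu := (@lebesgue_measure R).
Implicit Types f g h : R -> R.

Lemma ae_imp (P Q : R -> Prop) : (forall x, P x -> Q x) ->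
  {ae mu, forall x, P x} -> {ae mu, forall x, Q x}.
Proof.
by move=> PQ [N [mN N0 sN]]; exists N; split=> // x nQ; apply: sN => /PQ.
Qed.

Lemma ae_imp2 (P Q S : R -> Prop) : (forall x, P x -> Q x -> S x) ->
  {ae mu, forall x, P x} -> {ae mu, forall x, Q x} -> {ae mu, forall x, S x}.
Proof.
move=> PQS [M [mM M0 sM]] [N [mN N0 sN]]; exists (M `|` N); split.
- exact: measurableU.
- by rewrite (null_set_setU (mu := mu)).
move=> x nS; have [Mx|nM] := pselect (M x); [by left|right].
apply: sN => Qx; apply: nM; apply: sM => Px; exact: nS (PQS _ Px Qx).
Qed.

(** Norms stay squared and extended-valued: no roots are taken, and finiteness is a separate clause
    of [L2]. The triangle inequality then costs a factor 2. *)
Definition sqint f : \bar R := (\int[mu]_x ((f x) ^+ 2)%:E)%E.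
Definition L2 f : Prop := measurable_fun setT f /\ (sqint f < +oo)%E.
Definition L1 f : Prop := mu.-integrable setT (EFin \o f).

Lemma sqint_ge0 f : (0 <= sqint f)%E.
Proof. by apply: integral_ge0 => x _; rewrite lee_fin sqr_ge0. Qed.

Lemma L1_measurable f : L1 f -> measurable_fun setT f.
Proof. by move=> /integrableP[/measurable_EFinP]. Qed.

Lemma measurable_sqr f : measurable_fun setT f ->
  measurable_fun setT (fun x => ((f x) ^+ 2)%:E).
Proof. by move=> mf; apply/measurable_EFinP; exact: measurable_funX. Qed.

Lemma le_ge0_integral (h k : R -> R) : measurable_fun setT h -> measurable_fun setT k ->
  (forall x, 0 <= h x) -> (forall x, h x <= k x) ->
  (\int[mu]_x (h x)%:E <= \int[mu]_x (k x)%:E)%E.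
Proof.
move=> mh mk h0 hk; apply: ge0_le_integral => //.
- by move=> x _; rewrite lee_fin.
- exact/measurable_EFinP.
- exact/measurable_EFinP.
- by move=> x _; rewrite lee_fin.
Qed.

Lemma sqintZ c f : measurable_fun setT f ->
  sqint (fun x => c * f x) = ((c ^+ 2)%:E * sqint f)%E.
Proof.
move=> mf; rewrite /sqint; under eq_integral do rewrite exprMn EFinM.
rewrite ge0_integralZl_EFin//; first by move=> x _; rewrite lee_fin sqr_ge0.
- exact: measurable_sqr.
- exact: sqr_ge0.
Qed.

Lemma sqint_le2D f g h : measurable_fun setT f -> measurable_fun setT g ->
  measurable_fun setT h -> (forall x, `|h x| <= `|f x| + `|g x|) ->
  (sqint h <= 2%:E * sqint f + 2%:E * sqint g)%E.
Proof.
move=> mf mg mh hfg.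
rewrite -!ge0_integralZl_EFin//; last 4 first.
- by move=> x _; rewrite lee_fin sqr_ge0.
- exact: measurable_sqr.
- by move=> x _; rewrite lee_fin sqr_ge0.
- exact: measurable_sqr.
rewrite -ge0_integralD//; last 4 first.
- by move=> x _; rewrite -EFinM lee_fin mulr_ge0// sqr_ge0.
- by apply: measurable_funeM; exact: measurable_sqr.
- by move=> x _; rewrite -EFinM lee_fin mulr_ge0// sqr_ge0.
- by apply: measurable_funeM; exact: measurable_sqr.
apply: ge0_le_integral => //.
- by move=> x _; rewrite lee_fin sqr_ge0.
- exact: measurable_sqr.
- by apply: emeasurable_funD; apply: measurable_funeM; exact: measurable_sqr.
move=> x _; rewrite -!EFinM -EFinD lee_fin -(real_normK (num_real (h x))).
rewrite -(real_normK (num_real (f x))) -(real_normK (num_real (g x))).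
apply: (@le_trans _ _ ((`|f x| + `|g x|) ^+ 2)).
  by rewrite lerXn2r ?nnegrE ?addr_ge0.
by have := sqr_ge0 (`|f x| - `|g x|); lra.
Qed.

Lemma sqintD f g : measurable_fun setT f -> measurable_fun setT g ->
  (sqint (fun x => f x + g x)%R <= 2%:E * sqint f + 2%:E * sqint g)%E.
Proof.
move=> mf mg; apply: sqint_le2D => //; first exact: measurable_funD.
by move=> x; exact: ler_normD.
Qed.

Lemma sqintB f g : measurable_fun setT f -> measurable_fun setT g ->
  (sqint (fun x => f x - g x)%R <= 2%:E * sqint f + 2%:E * sqint g)%E.
Proof.
move=> mf mg; apply: sqint_le2D => //; first exact: measurable_funB.
by move=> x; exact: ler_normB.
Qed.

Lemma sqint_le f g : measurable_fun setT f -> measurable_fun setT g ->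
  (forall x, `|f x| <= `|g x|) -> (sqint f <= sqint g)%E.
Proof.
move=> mf mg fg; apply: le_ge0_integral.
- exact: measurable_funX.
- exact: measurable_funX.
- by move=> x; exact: sqr_ge0.
move=> x; rewrite -(real_normK (num_real (f x))) -(real_normK (num_real (g x))).
by rewrite lerXn2r ?nnegrE.
Qed.

Lemma mule2_lty (x y : \bar R) : (0 <= x)%E -> (0 <= y)%E -> (x < +oo)%E -> (y < +oo)%E ->
  (2%:E * x + 2%:E * y < +oo)%E.
Proof.
move=> x0 y0 xoo yoo; apply: lte_add_pinfty; apply: lte_mul_pinfty => //.
Qed.

Lemma L2D f g : L2 f -> L2 g -> L2 (fun x => f x + g x).
Proof.
move=> [mf f2] [mg g2]; split; first exact: measurable_funD.
by apply: le_lt_trans (sqintD mf mg) _; apply: mule2_lty => //; exact: sqint_ge0.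
Qed.

Lemma L2B f g : L2 f -> L2 g -> L2 (fun x => f x - g x).
Proof.
move=> [mf f2] [mg g2]; split; first exact: measurable_funB.
by apply: le_lt_trans (sqintB mf mg) _; apply: mule2_lty => //; exact: sqint_ge0.
Qed.

Lemma L2Z c f : L2 f -> L2 (fun x => c * f x).
Proof.
move=> [mf f2]; split; first exact: measurable_funM.
by rewrite sqintZ// lte_mul_pinfty// ?lee_fin ?sqr_ge0.
Qed.

Lemma L2_le f g : measurable_fun setT f -> L2 g -> (forall x, `|f x| <= `|g x|) -> L2 f.
Proof.
by move=> mf [mg g2] fg; split=> //; apply: le_lt_trans g2; exact: sqint_le.
Qed.

Lemma sqint_ae_eq0 f : measurable_fun setT f -> sqint f = 0%E ->
  {ae mu, forall x, f x = 0}.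
Proof.
move=> mf f0.
have /(ae_eq_integral_abs mu measurableT) : (\int[mu]_x `|((f x) ^+ 2)%:E| = 0)%E.
  rewrite -f0; apply: eq_integral => x _.
  by rewrite gee0_abs// lee_fin sqr_ge0.
move=> /(_ (measurable_sqr mf)); apply: ae_imp => x /(_ I) /= [] /eqP.
by rewrite sqrf_eq0 => /eqP.
Qed.

Lemma L1_le f g : measurable_fun setT f -> L1 g -> (forall x, `|f x| <= g x) -> L1 f.
Proof.
move=> mf ig fg; apply: (le_integrable measurableT _ _ ig).
- exact/measurable_EFinP.
- by move=> x _ /=; rewrite lee_fin (le_trans (fg x))// ler_norm.
Qed.

Lemma L2_sqr_L1 f : L2 f -> L1 (fun x => f x ^+ 2).
Proof.
move=> [mf f2]; apply/integrableP; split; first exact: measurable_sqr.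
apply: le_lt_trans f2; rewrite le_eqVlt; apply/orP; left; apply/eqP.
by apply: eq_integral => x _ /=; rewrite ger0_norm// sqr_ge0.
Qed.

Lemma L1D f g : L1 f -> L1 g -> L1 (fun x => f x + g x).
Proof.
by move=> f1 g1; rewrite /L1 /comp; under eq_fun do rewrite EFinD; exact: integrableD.
Qed.

Lemma L1B f g : L1 f -> L1 g -> L1 (fun x => f x - g x).
Proof.
by move=> f1 g1; rewrite /L1 /comp; under eq_fun do rewrite EFinB; exact: integrableB.
Qed.

Lemma L1Z c f : L1 f -> L1 (fun x => c * f x).
Proof.
by move=> f1; rewrite /L1 /comp; under eq_fun do rewrite EFinM; exact: integrableZl.
Qed.

Lemma L2_mul f g : L2 f -> L2 g -> L1 (fun x => f x * g x).
Proof.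
move=> f2 g2; apply: (@L1_le _ (fun x => f x ^+ 2 + g x ^+ 2)).
- by apply: measurable_funM; [case: f2|case: g2].
- by apply: L1D; exact: L2_sqr_L1.
move=> x; rewrite normrM -(real_normK (num_real (f x))) -(real_normK (num_real (g x))).
by have := sqr_ge0 (`|f x| - `|g x|); have := sqr_ge0 (`|f x| + `|g x|); lra.
Qed.

Lemma L1_bounded_mul f g M : measurable_fun setT f -> L1 g -> (forall x, `|f x| <= M) ->
  L1 (fun x => f x * g x).
Proof.
move=> mf g1 fM; apply: (@L1_le _ (fun x => M * `|g x|)).
- by apply: measurable_funM => //; exact: L1_measurable.
- by apply: L1Z; exact: integrable_norm.
by move=> x; rewrite normrM ler_wpM2r.
Qed.

Lemma L1_int_lty f : L1 f -> (\int[mu]_x `|f x|%:E < +oo)%E.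
Proof. by move=> /integrableP[_]. Qed.

Lemma sqint_fin f : L2 f -> sqint f \is a fin_num.
Proof. by move=> [_ f2]; rewrite ge0_fin_numE// sqint_ge0. Qed.

Lemma eq_sqint f g : f =1 g -> sqint f = sqint g.
Proof. by move=> fg; apply: eq_integral => x _; rewrite fg. Qed.

Lemma sqint_aeeq f g : measurable_fun setT f -> measurable_fun setT g ->
  {ae mu, forall x, f x = g x} -> sqint f = sqint g.
Proof.
move=> mf mg fg; apply: ge0_ae_eq_integral => //.
- exact: measurable_sqr.
- exact: measurable_sqr.
- by move=> x _; rewrite lee_fin sqr_ge0.
- by move=> x _; rewrite lee_fin sqr_ge0.
by move: fg; apply: ae_imp => x ->.
Qed.

End L2_toolkit.

(** * Lebesgue measure: affine substitutions and iterated integrals *)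

Section affine_change_of_variables.
Context {R : realType}.
Local Notation mu := (@lebesgue_measure R).
Implicit Types (f : R -> R) (a b : R).

Let aff a b : measurableTypeR R -> measurableTypeR R := fun x => a * x + b.

Let measurable_aff a b : measurable_fun setT (aff a b).
Proof. by apply: measurable_funD => //; exact: measurable_funM. Qed.

(** Uniqueness of Lebesgue measure: [|a|] times the image measure has the right value on intervals
    []x, y]]. A negative [a] exchanges the open and the closed end of the preimage, hence the two
    cases. *)
Lemma lebesgue_measure_affine a b (A : set R) : a != 0 -> measurable A ->
  mu A = (`|a|%:E * mu ((fun x => a * x + b)%R @^-1` A))%E.
Proof.
move=> a0 mA.
pose k := NngNum (normr_ge0 a).
pose nu : {measure set (measurableTypeR R) -> \bar R} :=
  mscale k (measure_function_pushforward__canonical__measure_function_Measure mu (measurable_aff a b)).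
rewrite (@lebesgue_measure_unique _ nu) => //= _ [[x y]] _ <-.
rewrite /nu/= /mscale/= /pushforward.
have [x_lt_y|y_le_x] := ltP x y; last first.
  by rewrite set_itv_ge ?bnd_simp -?leNgt// preimage_set0 !measure0 mule0.
case: (ltgtP a 0) => [an|ap|/eqP]; last by rewrite (negbTE a0).
- have -> : aff a b @^-1` `]x, y] = `[(y - b) / a, (x - b) / a[%classic.
    apply/seteqP; split => z /=; rewrite /aff !in_itv/= ler_ndivrMr// ltr_ndivlMr//.
      by move=> /andP[? ?]; apply/andP; split; lra.
    by move=> /andP[? ?]; apply/andP; split; lra.
  rewrite !lebesgue_measure_itv/= !lte_fin x_lt_y ltr_ndivrMr// mulfVK//.
  rewrite ltrD2r x_lt_y -EFinB -EFinB -EFinM ltr0_norm//; congr (_%:E).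
  by field.
- have -> : aff a b @^-1` `]x, y] = `](x - b) / a, (y - b) / a]%classic.
    apply/seteqP; split => z /=; rewrite /aff !in_itv/= ler_pdivlMr// ltr_pdivrMr//.
      by move=> /andP[? ?]; apply/andP; split; lra.
    by move=> /andP[? ?]; apply/andP; split; lra.
  rewrite !lebesgue_measure_itv/= !lte_fin x_lt_y ltr_pdivrMr// mulfVK//.
  rewrite ltrD2r x_lt_y -EFinB -EFinB -EFinM gtr0_norm//; congr (_%:E).
  by field.
Qed.

Lemma ge0_integral_affine a b (f : R -> \bar R) : a != 0 ->
  measurable_fun setT f -> (forall x, 0 <= f x)%E ->
  (\int[mu]_x f x = `|a|%:E * \int[mu]_x f (a * x + b)%R)%E.
Proof.
move=> a0 mf f0; pose k := NngNum (normr_ge0 a).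
have <- := @ge0_integral_pushforward _ _ _ _ _ _ (measurable_aff a b) mu setT f
  measurableT mf (fun y _ => f0 y).
pose nu : {measure set (measurableTypeR R) -> \bar R} :=
  measure_function_pushforward__canonical__measure_function_Measure mu (measurable_aff a b).
rewrite -[RHS](ge0_integral_mscale nu measurableT k mf (fun x _ => f0 x)).
by apply: eq_measure_integral => //= A mA _; exact: lebesgue_measure_affine.
Qed.

Lemma L1_affine f a b : a != 0 -> L1 f -> L1 (fun x => f (a * x + b)).
Proof.
move=> a0 /integrableP[mf f1]; apply/integrableP; split.
  exact: (measurableT_comp mf (measurable_aff a b)).
move: f1; rewrite (@ge0_integral_affine a b)//; last exact: measurableT_comp.
set I := integral _ _ _ => f1.
have -> : I = ((`|a|^-1)%:E * (`|a|%:E * I))%E.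
  by rewrite muleA -EFinM mulVf ?mul1e// normr_eq0.
by rewrite lte_mul_pinfty// ?lee_fin ?invr_ge0//.
Qed.

Lemma Rintegral_affine f a b : a != 0 -> L1 f ->
  \int[mu]_x f x = `|a| * \int[mu]_x f (a * x + b).
Proof.
move=> a0 f1; have f1' := L1_affine b a0 f1.
have mf := measurable_int _ f1; have mf' := measurable_int _ f1'.
rewrite /Rintegral integralE [in RHS]integralE.
rewrite (@ge0_integral_affine a b (fun x => (fun x => (f x)%:E)^\+ x)%E)//; last first.
  exact: measurable_funepos.
rewrite (@ge0_integral_affine a b (fun x => (fun x => (f x)%:E)^\- x)%E)//; last first.
  exact: measurable_funeneg.
have Ep : ((EFin \o (fun x => f (a * x + b)%R))^\+)%E = (fun x => ((EFin \o f)^\+ (a * x + b)%R)%E).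
  by apply/funext => x; rewrite !funeposE.
have En : ((EFin \o (fun x => f (a * x + b)%R))^\-)%E = (fun x => ((EFin \o f)^\- (a * x + b)%R)%E).
  by apply/funext => x; rewrite !funenegE.
have p1 := integrable_pos_fin_num measurableT f1'.
have n1 := integrable_neg_fin_num measurableT f1'.
rewrite Ep in p1; rewrite En in n1; rewrite Ep En.
by rewrite -muleBr// ?fineM// ?fin_num_adde_defr// fin_numB p1 n1.
Qed.

End affine_change_of_variables.

(** * Fubini and Tonelli for real-valued integrals *)

Section iterated_integrals.
Context {R : realType}.
Local Notation mu := (@lebesgue_measure R).
Local Notation RR := (measurableTypeR R).
Implicit Types F : RR * RR -> R.

Definition L1prod F : Prop := (mu \x mu)%E.-integrable setT (EFin \o F).

(** No integrability is involved: the inner integral is the difference of those of the positive and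
    negative parts, each measurable by Tonelli, and [fine] preserves measurability. *)
Lemma measurable_Rint_section F : measurable_fun setT F ->
  measurable_fun setT (fun x => \int[mu]_y F (x, y)).
Proof.
move=> mF; have mEF : measurable_fun setT (EFin \o F) by exact/measurable_EFinP.
apply: measurableT_comp => //.
have -> : (fun x => \int[mu]_y (F (x, y))%:E)%E =
    (fun x => \int[mu]_y ((EFin \o F)^\+ (x, y)) - \int[mu]_y ((EFin \o F)^\- (x, y)))%E.
  apply/funext => x; rewrite [LHS]integralE; congr (_ - _)%E.
    by apply: eq_integral => y _; rewrite !funeposE.
  by apply: eq_integral => y _; rewrite !funenegE.
apply: emeasurable_funB.
  exact: (measurable_fun_fubini_tonelli_F _ (measurable_funepos mEF)).
exact: (measurable_fun_fubini_tonelli_F _ (measurable_funeneg mEF)).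
Qed.

Lemma measurable_fun_swap F : measurable_fun setT F ->
  measurable_fun setT (fun z => F (z.2, z.1)).
Proof.
move=> mF; have ms : measurable_fun setT (fun z : RR * RR => (z.2, z.1)).
  by apply: measurable_fun_pair; [exact: measurable_snd|exact: measurable_fst].
exact: (measurableT_comp mF ms).
Qed.

Lemma L1prodP F : measurable_fun setT F ->
  (\int[mu]_x \int[mu]_y `|F (x, y)|%:E < +oo)%E -> L1prod F.
Proof. by move=> mF FF; apply/integrable12ltyP => //; exact/measurable_EFinP. Qed.

(** Under a product bound the iterated integral of the absolute value factors. The exchanges of
    integrals against [fejer] are justified this way. *)
Lemma L1prod_le_tensor F (g h : R -> R) : measurable_fun setT F -> L1 g -> L1 h ->
  (forall x y, `|F (x, y)| <= `|g x| * `|h y|) -> L1prod F.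
Proof.
move=> mF g1 h1 Fgh; apply: L1prodP => //.
have mg := L1_measurable g1; have mh := L1_measurable h1.
apply: (@le_lt_trans _ _ (\int[mu]_x ((\int[mu]_y `|h y|%:E) * `|g x|%:E))%E).
  apply: ge0_le_integral => //.
  - by move=> x _; apply: integral_ge0 => y _; rewrite lee_fin.
  - apply: (@measurable_fun_fubini_tonelli_F _ _ _ _ _ mu (fun z => `|F z|%:E)).
      by apply/measurable_EFinP; exact: measurableT_comp.
    by move=> z; rewrite lee_fin.
  - by apply: measurable_funeM; apply/measurable_EFinP; exact: measurableT_comp.
  - move=> x _; rewrite muleC -ge0_integralZl_EFin//; last first.
      by apply/measurable_EFinP; exact: measurableT_comp.
    under [leRHS]eq_integral do rewrite -EFinM.
    apply: le_ge0_integral => //.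
    + apply: measurableT_comp => //.
      exact: (measurable_fun_pair2 _ mF).
    + by apply: measurable_funM => //; exact: measurableT_comp.
have hoo := L1_int_lty h1; have goo := L1_int_lty g1.
rewrite ge0_integralZl//; last 2 first.
- by apply/measurable_EFinP; exact: measurableT_comp.
- by apply: integral_ge0 => x _; rewrite lee_fin.
rewrite lte_mul_pinfty//.
- by apply: integral_ge0 => x _; rewrite lee_fin.
- rewrite ge0_fin_numE//; by apply: integral_ge0 => x _; rewrite lee_fin.
Qed.

Section fubini.
Variable F : RR * RR -> R.
Hypothesis F1 : L1prod F.

Let mF : measurable_fun setT F.
Proof. by move/integrableP : F1 => [/measurable_EFinP]. Qed.

Lemma L1prod_section1 : {ae mu, forall x, L1 (fun y => F (x, y))}.
Proof. exact: (ae_integrable1 F1). Qed.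

Lemma L1prod_section2 : {ae mu, forall y, L1 (fun x => F (x, y))}.
Proof. exact: (ae_integrable2 F1). Qed.

(** [Rintegral] takes a default value on sections that are not integrable, so the real and the
    extended inner integral agree only almost everywhere. *)
Let ae_fine1 : ae_eq mu setT (fun x => (\int[mu]_y F (x, y))%:E)
  (fun x => \int[mu]_y (F (x, y))%:E)%E.
Proof.
have [N [mN N0 sN]] := L1prod_section1; exists N; split=> // x /= nx; apply: sN.
apply: contra_not nx => Fx _.
by rewrite fineK//; exact: integrable_fin_num.
Qed.

Let ae_fine2 : ae_eq mu setT (fun y => (\int[mu]_x F (x, y))%:E)
  (fun y => \int[mu]_x (F (x, y))%:E)%E.
Proof.
have [N [mN N0 sN]] := L1prod_section2; exists N; split=> // x /= nx; apply: sN.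
apply: contra_not nx => Fx _.
by rewrite fineK//; exact: integrable_fin_num.
Qed.

Lemma L1_Rint_section : L1 (fun x => \int[mu]_y F (x, y)).
Proof.
have m1 := measurable_Rint_section mF.
apply/integrableP; split; first exact/measurable_EFinP.
have /integrableP[mG] := integrable_fubini_F F1.
apply: le_lt_trans; rewrite le_eqVlt; apply/orP; left; apply/eqP.
apply: ae_eq_integral => //.
- by apply: measurableT_comp => //; exact/measurable_EFinP.
- exact: measurableT_comp.
by have := ae_eq_comp (fun u : \bar R => `|u|%E) ae_fine1.
Qed.

Lemma Rfubini : \int[mu]_x (\int[mu]_y F (x, y)) = \int[mu]_y (\int[mu]_x F (x, y)).
Proof.
rewrite {1 3}/Rintegral; congr fine.
have m1 := measurable_Rint_section mF.
have m2 := measurable_Rint_section (measurable_fun_swap mF).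
transitivity (\int[mu]_x \int[mu]_y (F (x, y))%:E)%E.
  apply: ae_eq_integral => //; first exact/measurable_EFinP.
  exact: (measurable_fubini_F F1).
transitivity (\int[mu]_y \int[mu]_x (F (x, y))%:E)%E; last first.
  apply/esym/ae_eq_integral => //; first exact/measurable_EFinP.
  exact: (measurable_fubini_G F1).
exact: (Fubini F1).
Qed.
End fubini.

End iterated_integrals.

(** * Convolution *)

Section convolution.
Context {R : realType}.
Local Notation mu := (@lebesgue_measure R).
Local Notation RR := (measurableTypeR R).
Implicit Types V W e : R -> R.

(** For real [V] the unnormalised Fourier transform is [cosT V - i sinT V]. *)
Definition cosT V (xi : R) : R := \int[mu]_t (cos (xi * t) * V t).
Definition sinT V (xi : R) : R := \int[mu]_t (sin (xi * t) * V t).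

Lemma measurable_cosM (xi : R) : measurable_fun setT (fun t => cos (xi * t)).
Proof.
apply: (measurableT_comp (continuous_measurable_fun (@continuous_cos R))).
exact: measurable_funM.
Qed.

Lemma measurable_sinM (xi : R) : measurable_fun setT (fun t => sin (xi * t)).
Proof.
apply: (measurableT_comp (continuous_measurable_fun (@continuous_sin R))).
exact: measurable_funM.
Qed.

Lemma L1_cosM (xi : R) V : L1 V -> L1 (fun t => cos (xi * t) * V t).
Proof.
move=> V1; apply: (@L1_bounded_mul _ _ _ 1) => //; first exact: measurable_cosM.
by move=> x; rewrite ler_norml cos_geN1 cos_le1.
Qed.

Lemma L1_sinM (xi : R) V : L1 V -> L1 (fun t => sin (xi * t) * V t).
Proof.
move=> V1; apply: (@L1_bounded_mul _ _ _ 1) => //; first exact: measurable_sinM.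
by move=> x; rewrite ler_norml sin_geN1 sin_le1.
Qed.

Lemma Rintegral_aeeq V W : measurable_fun setT V -> measurable_fun setT W ->
  {ae mu, forall x, V x = W x} -> \int[mu]_x V x = \int[mu]_x W x.
Proof.
move=> mV mW VW; congr fine; apply: ae_eq_integral => //.
- exact/measurable_EFinP.
- exact/measurable_EFinP.
by move: VW; apply: ae_imp => x ->.
Qed.

(** Cauchy-Schwarz for the weight [k]: expand the nonnegative integral of [k * (V - X / m) ^+ 2],
    where [X / m] is the weighted mean of [V]. *)
Lemma Rintegral_sqr_le (k V : R -> R) : (forall x, 0 <= k x) -> L1 k ->
  L1 (fun x => k x * V x) -> L1 (fun x => k x * V x ^+ 2) -> 0 < \int[mu]_x k x ->
  (\int[mu]_x (k x * V x)) ^+ 2 <= \int[mu]_x k x * \int[mu]_x (k x * V x ^+ 2).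
Proof.
move=> k0 k1 kV1 kV2 m0; set m := (\int[mu]_x k x) in m0 *.
set X := \int[mu]_x (k x * V x); set Y := \int[mu]_x _.
have : 0 <= \int[mu]_x (k x * (V x - X / m) ^+ 2).
  by apply: Rintegral_ge0 => x _; rewrite mulr_ge0// sqr_ge0.
under eq_Rintegral => x _.
  have -> : k x * (V x - X / m) ^+ 2 =
    k x * V x ^+ 2 - 2 * (X / m) * (k x * V x) + (X / m) ^+ 2 * k x by ring.
  over.
rewrite RintegralD//; last 2 first.
- by apply: L1B => //; exact: L1Z.
- exact: L1Z.
rewrite RintegralB//; last exact: L1Z.
rewrite !RintegralZl// -/X -/Y -/m.
have -> : Y - 2 * (X / m) * X + (X / m) ^+ 2 * m = (m * Y - X ^+ 2) / m.
  by field; rewrite gt_eqF.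
by rewrite pmulr_lge0 ?invr_gt0// subr_ge0.
Qed.

Variable k : R -> R.
Hypothesis k0 : forall x, 0 <= k x.
Hypothesis k1 : L1 k.
Hypothesis m0 : 0 < \int[mu]_x k x.

(** Where the integrand is not integrable this is a default value. Linearity is therefore an almost
    everywhere statement ([convB]), while changing [V] on a null set changes nothing at any point
    ([conv_aeeq]). *)
Definition conv V (t : R) : R := \int[mu]_s (k (t - s) * V s).

Let mk : measurable_fun setT k. Proof. exact: L1_measurable. Qed.

Let mk2 : measurable_fun setT (fun z : RR * RR => k (z.1 - z.2)).
Proof.
apply: measurableT_comp => //.
by apply: measurable_funB; [exact: measurable_fst|exact: measurable_snd].
Qed.

Let mkV V : measurable_fun setT V ->
  measurable_fun setT (fun z : RR * RR => k (z.1 - z.2) * V z.2).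
Proof.
by move=> mV; apply: measurable_funM => //; apply: measurableT_comp => //; exact: measurable_snd.
Qed.

Lemma measurable_conv V : measurable_fun setT V -> measurable_fun setT (conv V).
Proof. by move=> mV; exact: (measurable_Rint_section (mkV mV)). Qed.

Let kfl t : L1 (fun s => k (t - s)).
Proof.
have := @L1_affine _ k (-1) t; rewrite oppr_eq0 oner_eq0 => /(_ isT k1).
by apply: eq_integrable => // x _ /=; rewrite mulN1r addrC.
Qed.

Let intkfl t : \int[mu]_s k (t - s) = \int[mu]_x k x.
Proof.
rewrite (@Rintegral_affine _ k (-1) t)// ?oppr_eq0 ?oner_eq0// normrN1 mul1r.
by apply: eq_Rintegral => s _; rewrite mulN1r addrC.
Qed.

Let intk_fin : (\int[mu]_x (k x)%:E = (\int[mu]_x k x)%:E)%E.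
Proof. by rewrite fineK//; exact: integrable_fin_num. Qed.

Let tonelli (w : R -> R) : measurable_fun setT w -> (forall s, 0 <= w s) ->
  (\int[mu]_t \int[mu]_s (k (t - s) * w s)%:E =
   (\int[mu]_x k x)%:E * \int[mu]_s (w s)%:E)%E.
Proof.
move=> mw w0.
rewrite (@fubini_tonelli _ _ _ _ _ mu mu (fun z => (k (z.1 - z.2) * w z.2)%:E)); last 2 first.
- by apply/measurable_EFinP; exact: mkV.
- by move=> z; rewrite lee_fin mulr_ge0.
rewrite -ge0_integralZl_EFin//; last 3 first.
- by move=> x _; rewrite lee_fin.
- exact/measurable_EFinP.
- exact: ltW.
apply: eq_integral => s _ /=.
under eq_integral do rewrite mulrC EFinM.
rewrite ge0_integralZl_EFin//; last 2 first.
- by move=> x _; rewrite lee_fin.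
- by apply/measurable_EFinP; apply: measurableT_comp => //; exact: measurable_funB.
rewrite muleC; congr (_ * _)%E; rewrite -intk_fin.
rewrite [RHS](@ge0_integral_affine _ 1 (- s))//; last exact/measurable_EFinP.
by rewrite normr1 mul1e; apply: eq_integral => x _; rewrite mul1r.
Qed.

Lemma L1_conv_kernel V : L1 V -> L1prod (fun z => k (z.1 - z.2) * V z.2).
Proof.
move=> V1; have mV := L1_measurable V1.
apply: L1prodP; first exact: mkV.
rewrite [ltLHS](_ : _ = \int[mu]_t \int[mu]_s (k (t - s) * `|V s|)%:E)%E; last first.
  apply: eq_integral => t _; apply: eq_integral => s _ /=.
  by rewrite normrM (ger0_norm (k0 _)).
rewrite tonelli//; last exact: measurableT_comp.
by rewrite lte_mul_pinfty ?lee_fin ?ltW//; exact: L1_int_lty.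
Qed.

(** Tonelli for [V ^+ 2] gives the second integrability; the first follows from [|V| <= 1 + V ^+ 2],
    as [k] itself is integrable. *)
Lemma ae_L1_conv_sqr V : L2 V -> {ae mu, forall t,
  L1 (fun s => k (t - s) * V s) /\ L1 (fun s => k (t - s) * V s ^+ 2)}.
Proof.
move=> V2; have mV := V2.1.
have := L1prod_section1 (L1_conv_kernel (L2_sqr_L1 V2)).
apply: ae_imp => t /= V2t; split=> //.
apply: (@L1_le _ _ (fun s => k (t - s) + k (t - s) * V s ^+ 2)).
- exact: (measurable_fun_pair2 t (mkV mV)).
- exact: L1D.
move=> s; rewrite normrM (ger0_norm (k0 _)).
have -> : k (t - s) + k (t - s) * V s ^+ 2 = k (t - s) * (1 + V s ^+ 2) by ring.
apply: ler_wpM2l => //; rewrite -(real_normK (num_real (V s))).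
by have := sqr_ge0 (`|V s| - 1); have := sqr_ge0 (`|V s|); lra.
Qed.

(** Young's inequality: Cauchy-Schwarz for the weight [k (t - s)] costs one factor of the mass, and
    integrating over [t] by [tonelli] costs the other. *)
Lemma sqint_conv V : L2 V ->
  (sqint (conv V) <= ((\int[mu]_x k x) ^+ 2)%:E * sqint V)%E.
Proof.
move=> V2; have mV := V2.1; have V21 := L2_sqr_L1 V2.
rewrite expr2 EFinM -muleA -tonelli//; last 2 first.
- exact: measurable_funX.
- by move=> s; exact: sqr_ge0.
rewrite -ge0_integralZl_EFin//; last 3 first.
- by move=> t _; apply: integral_ge0 => s _; rewrite lee_fin mulr_ge0// sqr_ge0.
- apply: (@measurable_fun_fubini_tonelli_F _ _ _ _ _ mu
    (fun z : RR * RR => (k (z.1 - z.2) * (V z.2) ^+ 2)%:E)).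
    apply/measurable_EFinP; apply: (mkV (V := fun s => V s ^+ 2)).
    exact: measurable_funX.
  by move=> z; rewrite lee_fin mulr_ge0// sqr_ge0.
- exact: ltW.
apply: ae_ge0_le_integral => //.
- by move=> t _; rewrite lee_fin sqr_ge0.
- by apply: measurable_sqr; exact: measurable_conv.
- move=> t _; apply: mule_ge0; first by rewrite lee_fin ltW.
  by apply: integral_ge0 => s _; rewrite lee_fin mulr_ge0// sqr_ge0.
- apply: measurable_funeM; apply: (@measurable_fun_fubini_tonelli_F _ _ _ _ _ mu
    (fun z : RR * RR => (k (z.1 - z.2) * (V z.2) ^+ 2)%:E)).
    apply/measurable_EFinP; apply: (mkV (V := fun s => V s ^+ 2)).
    exact: measurable_funX.
  by move=> z; rewrite lee_fin mulr_ge0// sqr_ge0.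
have [N [mN N0 sN]] := ae_L1_conv_sqr V2; exists N; split=> // t /= nt; apply: sN.
apply: contra_not nt => -[kV kV2] _.
have <- : (\int[mu]_s (k (t - s) * V s ^+ 2))%:E =
    (\int[mu]_s (k (t - s) * V s ^+ 2)%:E)%E by rewrite fineK//; exact: integrable_fin_num.
rewrite -EFinM lee_fin -(intkfl t).
by apply: Rintegral_sqr_le => //; rewrite intkfl.
Qed.

Lemma L2_conv V : L2 V -> L2 (conv V).
Proof.
move=> V2; split; first by apply: measurable_conv; case: V2.
apply: le_lt_trans (sqint_conv V2) _.
by rewrite lte_mul_pinfty// ?lee_fin ?sqr_ge0//; case: V2.
Qed.

Lemma convB V W : L2 V -> L2 W ->
  {ae mu, forall t, conv (fun s => V s - W s) t = conv V t - conv W t}.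
Proof.
move=> V2 W2; move: (ae_L1_conv_sqr V2) (ae_L1_conv_sqr W2).
apply: ae_imp2 => t [kV _] [kW _].
rewrite -RintegralB//; apply: eq_Rintegral => s _.
by rewrite mulrBr.
Qed.

Lemma conv_aeeq V W : measurable_fun setT V -> measurable_fun setT W ->
  {ae mu, forall t, V t = W t} -> conv V = conv W.
Proof.
move=> mV mW VW; apply/funext => t; apply: Rintegral_aeeq.
- exact: (measurable_fun_pair2 t (mkV mV)).
- exact: (measurable_fun_pair2 t (mkV mW)).
by move: VW; apply: ae_imp => s ->.
Qed.

Lemma L1_conv V : L1 V -> L1 (conv V).
Proof. by move=> V1; exact: (L1_Rint_section (L1_conv_kernel V1)). Qed.

(** Exchanging the integrals and substituting [t = x + s] leaves an inner integral over [x] in which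
    addition formulas can separate [x] from [s]. *)
Lemma Rintegral_conv e V M : measurable_fun setT e -> (forall x, `|e x| <= M) -> L1 V ->
  \int[mu]_t (e t * conv V t) = \int[mu]_s ((\int[mu]_x (e (x + s) * k x)) * V s).
Proof.
move=> me eM V1; have mV := L1_measurable V1.
have F1 : L1prod (fun z : RR * RR => e z.1 * (k (z.1 - z.2) * V z.2)).
  have := integrableZl measurableT M (integrable_abse (L1_conv_kernel V1)).
  apply: le_integrable => //.
  - apply/measurable_EFinP; apply: measurable_funM; last exact: mkV.
    by apply: measurableT_comp => //; exact: measurable_fst.
  - move=> z _ /=; rewrite lee_fin normrM [leRHS]normrM normr_id ler_wpM2r//.
    by rewrite (le_trans (eM _))// ler_norm.
have kV := L1prod_section1 (L1_conv_kernel V1).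
transitivity (\int[mu]_t \int[mu]_s (e t * (k (t - s) * V s))).
  apply: Rintegral_aeeq.
  - by apply: measurable_funM => //; exact: measurable_conv.
  - by apply: L1_measurable; exact: (L1_Rint_section F1).
  by move: kV; apply: ae_imp => t kVt; rewrite RintegralZl.
rewrite (Rfubini F1) /=; apply: eq_Rintegral => s _.
have ek : L1 (fun x => e x * k (x - s)).
  apply: (@L1_bounded_mul _ _ _ M) => //.
  have := @L1_affine _ k 1 (- s); rewrite oner_eq0 => /(_ isT k1).
  by under eq_fun do rewrite mul1r.
under eq_Rintegral do rewrite mulrA.
rewrite RintegralZr//; congr (_ * _).
rewrite (@Rintegral_affine _ _ 1 s)// ?oner_eq0// normr1 mul1r.
by apply: eq_Rintegral => x _; rewrite mul1r addrK.
Qed.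

(** Real part of the product [(cosT k - i sinT k) (cosT V - i sinT V)]; [sinT_conv] is minus its
    imaginary part. *)
Lemma cosT_conv V xi : L1 V ->
  cosT (conv V) xi = cosT k xi * cosT V xi - sinT k xi * sinT V xi.
Proof.
move=> V1; have mV := L1_measurable V1.
rewrite /cosT (@Rintegral_conv _ _ 1)//; last 2 first.
- exact: measurable_cosM.
- by move=> x; rewrite ler_norml cos_geN1 cos_le1.
have ck := L1_cosM xi k1; have sk := L1_sinM xi k1.
rewrite -/(sinT k xi) -!RintegralZl//; last 2 first.
- exact: L1_sinM.
- exact: L1_cosM.
rewrite -RintegralB//; last 2 first.
- by apply: L1Z; exact: L1_cosM.
- by apply: L1Z; exact: L1_sinM.
apply: eq_Rintegral => s _.
rewrite !mulrA -mulrBl; congr (_ * _).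
rewrite /sinT -!RintegralZr// -RintegralB//; last 2 first.
- by under eq_fun do rewrite mulrC; exact: L1Z.
- by under eq_fun do rewrite mulrC; exact: L1Z.
by apply: eq_Rintegral => x _; rewrite mulrDr cosD; ring.
Qed.

Lemma sinT_conv V xi : L1 V ->
  sinT (conv V) xi = cosT k xi * sinT V xi + sinT k xi * cosT V xi.
Proof.
move=> V1; have mV := L1_measurable V1.
rewrite {1}/sinT (@Rintegral_conv _ _ 1)//; last 2 first.
- exact: measurable_sinM.
- by move=> x; rewrite ler_norml sin_geN1 sin_le1.
have ck := L1_cosM xi k1; have sk := L1_sinM xi k1.
rewrite -!RintegralZl//; last 2 first.
- exact: L1_cosM.
- exact: L1_sinM.
rewrite -RintegralD//; last 2 first.
- by apply: L1Z; exact: L1_sinM.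
- by apply: L1Z; exact: L1_cosM.
apply: eq_Rintegral => s _.
rewrite !mulrA -mulrDl; congr (_ * _).
rewrite /cosT /sinT -!RintegralZr// -RintegralD//; last 2 first.
- by under eq_fun do rewrite mulrC; exact: L1Z.
- by under eq_fun do rewrite mulrC; exact: L1Z.
by apply: eq_Rintegral => x _; rewrite mulrDr sinD; ring.
Qed.

End convolution.

(** * The hat function and Bessel's inequality *)

Section hat_kernel.
Context {R : realType}.
Local Notation mu := (@lebesgue_measure R).
Local Notation RR := (measurableTypeR R).

(** The mean value theorem for [sin], extended by oddness. Keeping the intermediate point [c] serves
    both the upper and the lower bound of [1 - cos]. *)
Lemma sin_eq_mul_cos (v : R) : exists2 c, `|c| <= `|v| & sin v = v * cos c.
Proof.
have pos (w : R) : 0 <= w -> exists2 c, `|c| <= w & sin w = w * cos c.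
  move=> w0; have cs : {within `[0, w], continuous (@sin R)}.
    by apply: continuous_subspaceT => x; exact: continuous_sin.
  have [c] := MVT_segment w0 (fun x _ => is_derive_sin x) cs.
  rewrite in_itv/= => /andP[c0 cw] sE; exists c; first by rewrite ger0_norm.
  by move: sE; rewrite sin0 !subr0 mulrC.
have [v0|v0] := leP 0 v.
  by have [c ? ?] := pos v v0; exists c => //; rewrite (ger0_norm v0).
have [|c cv sE] := pos (- v); first by rewrite oppr_ge0 ltW.
exists c; first by rewrite (ltr0_norm v0).
by move: sE; rewrite sinN mulNr => /oppr_inj.
Qed.

Lemma oneBcosE (u : R) : 1 - cos u = 2 * sin (u / 2) ^+ 2.
Proof.
have -> : cos u = cos (u / 2 + u / 2) by congr cos; field.
by rewrite cosD -!expr2 cos2sin2; ring.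
Qed.

Lemma oneBcos_le (u : R) : 1 - cos u <= u ^+ 2 / 2.
Proof.
rewrite oneBcosE; have [c _ ->] := sin_eq_mul_cos (u / 2).
rewrite exprMn; have := cos2Dsin2 c; have := sqr_ge0 (sin c); have := sqr_ge0 u.
move=> u0 s0 cs; have : cos c ^+ 2 <= 1 by lra.
rewrite exprMn => c1; have := ler_wpM2l u0 c1; lra.
Qed.

Lemma oneBcos_ge (u : R) : `|u| <= 1 -> cos 1 ^+ 2 / 2 * u ^+ 2 <= 1 - cos u.
Proof.
move=> u1; rewrite oneBcosE; have [c cu ->] := sin_eq_mul_cos (u / 2).
have c1 : `|c| <= 1.
  by apply: le_trans cu _; rewrite normrM (@ger0_norm _ 2^-1) ?invr_ge0//; lra.
have p1 : (1 : R) < pi by have := @pi_ge2 R; lra.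
have cc : cos 1 <= cos c.
  rewrite -(cos_norm c) leNgt ltr_cos ?in_itv/=; first by rewrite -leNgt.
  - by rewrite ler01 ltW.
  - by rewrite normr_ge0/= (le_trans c1)// ltW.
have c10 := @cos1_gt0 R.
have : cos 1 ^+ 2 <= cos c ^+ 2.
  have c0 := le_trans (ltW c10) cc.
  by rewrite lerXn2r ?nnegrE// ltW.
move=> /(ler_wpM2l (sqr_ge0 u)); rewrite exprMn [(u / 2) ^+ 2]exprMn; lra.
Qed.

(** At [xi = 0] division by zero gives [0] instead of the limit [d ^+ 2 / 2]. Lower bounds therefore
    fail at that one point. *)
Definition fejer (d xi : R) : R := (1 - cos (d * xi)) / xi ^+ 2.

Lemma fejer_ge0 d xi : 0 <= fejer d xi.
Proof. by rewrite divr_ge0 ?sqr_ge0// subr_ge0 cos_le1. Qed.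

Lemma measurable_fejer d : measurable_fun setT (fejer d).
Proof.
apply: measurable_funM.
  by apply: measurable_funB => //; exact: measurable_cosM.
have -> : (fun x : R => (x ^+ 2)^-1) = (@powR R)^~ (-1) \o (fun x : R => x ^+ 2).
  by apply/funext => x /=; rewrite powR_inv1 ?sqr_ge0.
apply: measurableT_comp; first exact: measurable_powR.
exact: measurable_funX.
Qed.

Lemma L1_oneDsqrV : L1 (fun x : R => (1 + x ^+ 2)^-1).
Proof.
have c : continuous (fun x : R => (1 + x ^+ 2)^-1) := @continuous_oneDsqrV R.
apply/integrableP; split.
  by apply/measurable_EFinP; exact: continuous_measurable_fun.
have p (x : R) : 0 <= (1 + x ^+ 2)^-1 by rewrite invr_ge0 addr_ge0// sqr_ge0.
under eq_integral => x _ do rewrite /= ger0_norm//.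
rewrite ge0_symfun_integralT//; last by move=> x /=; rewrite sqrrN.
by rewrite -set_itvcy integral0y_oneDsqr -EFinM ltry.
Qed.

(** Multiplied by [1 + xi ^+ 2], the kernel splits into itself, at most [1 / 2], and [1 - cos xi],
    at most [2]. *)
Lemma fejer1_le xi : fejer 1 xi <= 3 * (1 + xi ^+ 2)^-1.
Proof.
have x0 : 0 < 1 + xi ^+ 2 by rewrite ltr_wpDr ?sqr_ge0.
rewrite ler_pdivlMr// /fejer mul1r.
have [->|xn] := eqVneq xi 0; first by rewrite expr0n invr0 mulr0 mul0r.
have xi2 : 0 < xi ^+ 2 by rewrite exprn_even_gt0.
rewrite mulrDr mulr1 mulfVK ?gt_eqF//.
have : (1 - cos xi) / xi ^+ 2 <= 2^-1.
  by rewrite ler_pdivrMr// mulrC oneBcos_le.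
by have := cos_geN1 xi; lra.
Qed.

Lemma L1_fejer1 : L1 (fejer 1).
Proof.
apply: (L1_le (measurable_fejer 1) (L1Z 3 L1_oneDsqrV)) => x.
by rewrite ger0_norm ?fejer_ge0// fejer1_le.
Qed.

(** The integral of [(1 - cos x) / x ^+ 2] over the line, that is [pi]. *)
Definition fejer_mass : R := \int[mu]_x fejer 1 x.

Lemma fejer_scale d xi : d != 0 -> fejer d xi = d ^+ 2 * fejer 1 (d * xi + 0).
Proof.
move=> d0; rewrite /fejer mul1r addr0 exprMn.
by rewrite [RHS]mulrCA; congr (_ * _); rewrite [(d ^+ 2 * _)^-1]invfM [RHS]mulrA mulfV ?mul1r// sqrf_eq0.
Qed.

Lemma L1_fejer d : L1 (fejer d).
Proof.
have [->|d0] := eqVneq d 0.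
  have -> : fejer 0 = fun x => 0 * fejer 1 x.
    by apply/funext => x; rewrite /fejer !mul0r cos0 subrr mul0r.
  exact: L1Z L1_fejer1.
rewrite (_ : fejer d = fun xi => d ^+ 2 * fejer 1 (d * xi + 0)); last first.
  by apply/funext => x; exact: fejer_scale.
by apply: L1Z; exact: L1_affine L1_fejer1.
Qed.

Lemma int_fejer d : \int[mu]_x fejer d x = `|d| * fejer_mass.
Proof.
have [->|d0] := eqVneq d 0.
  rewrite normr0 mul0r -[RHS](mul0r (\int[mu]_x fejer 1 x)) -RintegralZl//; last exact: L1_fejer1.
  by apply: eq_Rintegral => x _; rewrite /fejer !mul0r cos0 subrr mul0r.
rewrite /fejer_mass (Rintegral_affine 0 d0 L1_fejer1).
under eq_Rintegral do rewrite fejer_scale//.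
rewrite RintegralZl//; last exact: L1_affine L1_fejer1.
by rewrite mulrA -expr2 real_normK ?num_real.
Qed.

Lemma fejer_mass_gt0 : 0 < fejer_mass.
Proof.
have m01 : mu `]0%R, 1%R]%classic = 1%E by rewrite lebesgue_measure_itv/= lte_fin ltr01 oppr0 adde0.
have i01 : L1 (\1_`]0%R, 1%R]%classic : R -> R).
  exact: (integrable_indic_itv 0 1 false false).
have c0 : 0 < cos 1 ^+ 2 / 2 :> R by rewrite divr_gt0// exprn_gt0// cos1_gt0.
apply: (@lt_le_trans _ _ (\int[mu]_x (cos 1 ^+ 2 / 2 * \1_`]0%R, 1%R]%classic x))).
  rewrite RintegralZl// mulr_gt0//.
  rewrite /Rintegral integral_indic// setIT.
  by rewrite [X in fine X]m01.
apply: le_Rintegral => //.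
- exact: L1Z.
- exact: L1_fejer1.
move=> x _; rewrite indicE; have [x01|_] := boolP (x \in _); last by rewrite mulr0 fejer_ge0.
rewrite mulr1 /fejer mul1r.
move: x01; rewrite inE/= in_itv/= => /andP[x0 x1].
by rewrite ler_pdivlMr ?exprn_gt0// oneBcos_ge// ger0_norm// ltW.
Qed.

(* The Fourier transform of [fejer d] is [fejer_mass] times [hat d]. *)
Definition hat (d x : R) : R := (`|x + d| + `|x - d|) / 2 - `|x|.

(** Product-to-sum formula: the left side is half a second difference, with step [d], of [fejer] in
    its parameter. After integration it becomes the same difference of the absolute value, which is
    [hat d x]. *)
Lemma fejer_cos d x xi : fejer d xi * cos (x * xi) =
  (fejer (x + d) xi + fejer (x - d) xi) / 2 - fejer x xi.
Proof.
rewrite /fejer [(x - d) * xi]mulrBl cosB [(x + d) * xi]mulrDl cosD.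
by set y := (xi ^+ 2)^-1; field.
Qed.

Lemma L1_fejer_cos d x : L1 (fun xi => fejer d xi * cos (x * xi)).
Proof. by under eq_fun do rewrite mulrC; exact: L1_cosM (L1_fejer d). Qed.

Lemma int_fejer_cos d x : \int[mu]_xi (fejer d xi * cos (x * xi)) = fejer_mass * hat d x.
Proof.
under eq_Rintegral do rewrite fejer_cos mulrDl.
have L y c : L1 (fun xi => fejer y xi * c).
  by under eq_fun do rewrite mulrC; exact: L1Z (L1_fejer y).
rewrite RintegralB//; [|exact: L1D|exact: L1_fejer].
rewrite RintegralD//; [|exact: L|exact: L].
have Lf y := L1_fejer y.
rewrite !RintegralZr//; [|exact: Lf|exact: Lf].
by rewrite !int_fejer /hat; ring.
Qed.

Lemma hat_ge0 d x : 0 <= hat d x.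
Proof.
rewrite /hat; have := ler_normD (x + d) (x - d).
have -> : x + d + (x - d) = 2 * x by ring.
by rewrite normrM (@ger0_norm _ 2)//; lra.
Qed.

Lemma hat_le d x : 0 <= d -> hat d x <= d.
Proof.
move=> d0; rewrite /hat; have := ler_normD x d; have := ler_normB x d.
by rewrite (ger0_norm d0); lra.
Qed.

Lemma hat_out d x : 0 <= d -> d <= `|x| -> hat d x = 0.
Proof.
move=> d0; rewrite /hat; have [x0|x0] := leP 0 x => dx.
  rewrite (ger0_norm x0) in dx *; rewrite (@ger0_norm _ (x + d)) ?(@ger0_norm _ (x - d)); lra.
rewrite (ltr0_norm x0) in dx *; rewrite (@ler0_norm _ (x + d)) ?(@ler0_norm _ (x - d)); lra.
Qed.

Lemma measurable_hat d : measurable_fun setT (hat d).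
Proof.
have mn (c : R) : measurable_fun setT (fun x : R => `|x + c|).
  apply: (measurableT_comp (@normr_measurable R setT)).
  exact: (measurable_funD (@measurable_id _ _ _)).
apply: measurable_funB; last exact: normr_measurable.
by apply: measurable_funM => //; exact: measurable_funD.
Qed.

Lemma hat_le_indic d x : 0 <= d -> hat d x <= d * \1_`[- d, d]%classic x.
Proof.
move=> d0; rewrite indicE; have [_|] := boolP (x \in _); first by rewrite mulr1 hat_le.
move=> /negP xd; rewrite mulr0 hat_out//.
rewrite leNgt; apply/negP => xd'; apply: xd.
by rewrite inE/= in_itv/= -ler_norml ltW.
Qed.

Lemma L1_hat d : 0 <= d -> L1 (hat d).
Proof.
move=> d0.
have i1 := L1Z d (integrable_indic_itv (- d) d true false).
apply: (L1_le (measurable_hat d) i1) => x.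
by rewrite ger0_norm ?hat_ge0 ?hat_le_indic.
Qed.

(** The area of the triangle of height 1 over [[- 1, 1]], that is 1. *)
Definition hat_mass : R := \int[mu]_x hat 1 x.

Lemma int_hat d : 0 < d -> \int[mu]_x hat d x = d ^+ 2 * hat_mass.
Proof.
move=> d0; rewrite (@Rintegral_affine _ _ d 0)// ?gt_eqF//; last exact: L1_hat (ltW d0).
rewrite expr2 -mulrA gtr0_norm//; congr (_ * _).
rewrite /hat_mass -RintegralZl//; last exact: L1_hat.
apply: eq_Rintegral => x _; rewrite /hat addr0.
have -> : d * x + d = d * (x + 1) by ring.
have -> : d * x - d = d * (x - 1) by ring.
by rewrite !normrM (gtr0_norm d0); ring.
Qed.

Lemma hat_mass_gt0 : 0 < hat_mass.
Proof.
have m01 : mu `[- 2^-1, 2^-1]%classic = 1%E.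
  rewrite lebesgue_measure_itv/= lte_fin ifT; last lra.
  by rewrite opprK; congr EFin; lra.
have i01 : L1 (\1_`[- 2^-1, 2^-1]%classic : R -> R).
  exact: (integrable_indic_itv (- 2^-1) 2^-1 true false).
apply: (@lt_le_trans _ _ (\int[mu]_x (2^-1 * \1_`[- 2^-1, 2^-1]%classic x))).
  rewrite RintegralZl// mulr_gt0//.
  rewrite /Rintegral integral_indic// setIT.
  by rewrite [X in fine X]m01.
apply: le_Rintegral => //.
- exact: L1Z.
- exact: L1_hat.
move=> x _; rewrite indicE; have [x01|_] := boolP (x \in _); last by rewrite mulr0 hat_ge0.
move: x01; rewrite inE/= in_itv/= -ler_norml => x1; rewrite mulr1 /hat.
have -> : `|x + 1| = 1 + x by rewrite ger0_norm; move: x1; rewrite ler_norml; lra.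
have -> : `|x - 1| = 1 - x by rewrite ler0_norm; move: x1; rewrite ler_norml; lra.
lra.
Qed.

End hat_kernel.

(** * Pairing the transform with the kernel, and Bessel's inequality *)

Section bessel.
Context {R : realType}.
Local Notation mu := (@lebesgue_measure R).
Local Notation RR := (measurableTypeR R).
Implicit Types a : R -> R.

Let mcos2 : measurable_fun setT (fun z : RR * RR => cos (z.1 * z.2)).
Proof.
apply: (measurableT_comp (continuous_measurable_fun (@continuous_cos R))).
by apply: measurable_funM; [exact: measurable_fst|exact: measurable_snd].
Qed.

Let msin2 : measurable_fun setT (fun z : RR * RR => sin (z.1 * z.2)).
Proof.
apply: (measurableT_comp (continuous_measurable_fun (@continuous_sin R))).
by apply: measurable_funM; [exact: measurable_fst|exact: measurable_snd].
Qed.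

Let msnd a : measurable_fun setT a -> measurable_fun setT (fun z : RR * RR => a z.2).
Proof. by move=> ma; apply: measurableT_comp => //; exact: measurable_snd. Qed.

Let mfst a : measurable_fun setT a -> measurable_fun setT (fun z : RR * RR => a z.1).
Proof. by move=> ma; apply: measurableT_comp => //; exact: measurable_fst. Qed.

Lemma measurable_cosT a : measurable_fun setT a -> measurable_fun setT (cosT a).
Proof.
move=> ma; apply: (@measurable_Rint_section _ (fun z => cos (z.1 * z.2) * a z.2)).
by apply: measurable_funM => //; exact: msnd.
Qed.

Lemma measurable_sinT a : measurable_fun setT a -> measurable_fun setT (sinT a).
Proof.
move=> ma; apply: (@measurable_Rint_section _ (fun z => sin (z.1 * z.2) * a z.2)).
by apply: measurable_funM => //; exact: msnd.
Qed.

Lemma cosT_le a xi : L1 a -> `|cosT a xi| <= \int[mu]_t `|a t|.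
Proof.
move=> a1; apply: le_trans (le_normr_Rintegral measurableT (L1_cosM xi a1)) _.
apply: le_Rintegral => //.
- exact: integrable_norm (L1_cosM xi a1).
- exact: integrable_norm.
by move=> t _; rewrite normrM ler_piMl// cos_max.
Qed.

Lemma sinT_le a xi : L1 a -> `|sinT a xi| <= \int[mu]_t `|a t|.
Proof.
move=> a1; apply: le_trans (le_normr_Rintegral measurableT (L1_sinM xi a1)) _.
apply: le_Rintegral => //.
- exact: integrable_norm (L1_sinM xi a1).
- exact: integrable_norm.
by move=> t _; rewrite normrM ler_piMl// sin_max.
Qed.

(** Integrate [fejer d xi * cos ((t - s) * xi) * a s] in both orders: over [xi] first it gives
    [hat d (t - s)], over [s] first the addition formula for [cos] produces the transforms of
    [a]. *)
Lemma fejer_duality a d t : L1 a ->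
  \int[mu]_xi (fejer d xi * (cos (t * xi) * cosT a xi + sin (t * xi) * sinT a xi)) =
  fejer_mass * conv (hat d) a t.
Proof.
move=> a1; have ma := L1_measurable a1.
have F1 : L1prod (fun z : RR * RR => fejer d z.2 * cos ((t - z.1) * z.2) * a z.1).
  apply: (L1prod_le_tensor _ a1 (L1_fejer d)).
    apply: measurable_funM; last exact: mfst.
    apply: measurable_funM; first exact: msnd (measurable_fejer d).
    apply: (measurableT_comp (continuous_measurable_fun (@continuous_cos R))).
    apply: measurable_funM; last exact: measurable_snd.
    by apply: measurable_funB => //; exact: measurable_fst.
  by move=> s xi /=; rewrite normrM [leLHS]mulrC ler_wpM2l// normrM ler_piMr// cos_max.
have := Rfubini F1 => /=.
under eq_Rintegral => s _.
  rewrite RintegralZr//; last exact: L1_fejer_cos.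
  rewrite int_fejer_cos -mulrA.
  over.
rewrite RintegralZl//; last first.
  apply: (@L1_bounded_mul _ _ _ `|d|) => //.
    apply: measurableT_comp; first exact: measurable_hat.
    exact: measurable_funB.
  move=> s.
  have [d0|d0] := leP 0 d.
    by rewrite ger0_norm ?hat_ge0// (ger0_norm d0) hat_le.
  have -> : hat d (t - s) = hat (- d) (t - s) by rewrite /hat opprK (addrC `|_ - d|).
  by rewrite ger0_norm ?hat_ge0// (ltr0_norm d0) hat_le// oppr_ge0 ltW.
move=> ->; apply: eq_Rintegral => xi _.
under [RHS]eq_Rintegral => s _.
  have -> : fejer d xi * cos ((t - s) * xi) * a s =
     fejer d xi * (cos (t * xi) * (cos (xi * s) * a s) + sin (t * xi) * (sin (xi * s) * a s)).
    by rewrite mulrBl cosB (mulrC s); ring.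
  over.
have ca := L1_cosM xi a1; have sa := L1_sinM xi a1.
rewrite RintegralZl//; last by apply: L1D; exact: L1Z.
rewrite RintegralD//; [|exact: L1Z|exact: L1Z].
by rewrite !RintegralZl.
Qed.

(** [fejer_duality] multiplied by [a t] and integrated over [t]: a second exchange turns the outer
    cosine and sine into another copy of the transforms. *)
Lemma fejer_energy a d : 0 <= d -> L1 a ->
  \int[mu]_xi (fejer d xi * (cosT a xi ^+ 2 + sinT a xi ^+ 2)) =
  fejer_mass * \int[mu]_t (a t * conv (hat d) a t).
Proof.
move=> d0 a1; have ma := L1_measurable a1.
have mC := measurable_cosT ma; have mS := measurable_sinT ma.
set A := \int[mu]_t `|a t|.
have A0 : 0 <= A by apply: Rintegral_ge0.
pose h z : R := cos (z.1 * z.2) * cosT a z.2 + sin (z.1 * z.2) * sinT a z.2.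
have F1 : L1prod (fun z : RR * RR => a z.1 * (fejer d z.2 * h z)).
  apply: (L1prod_le_tensor _ a1 (L1Z (2 * A) (L1_fejer d))).
    apply: measurable_funM; first exact: mfst.
    apply: measurable_funM; first exact: msnd (measurable_fejer d).
    by apply: measurable_funD; apply: measurable_funM => //; exact: msnd.
  move=> t xi /=; rewrite normrM ler_wpM2l// normrM mulrC [leRHS]normrM ler_wpM2r//.
  rewrite (ger0_norm (mulr_ge0 _ A0))// mulr2n mulrDl mul1r.
  apply: le_trans (ler_normD _ _) _; apply: lerD; rewrite normrM.
    by rewrite -[leRHS]mul1r; apply: ler_pM => //; [exact: cos_max|exact: cosT_le].
  by rewrite -[leRHS]mul1r; apply: ler_pM => //; [exact: sin_max|exact: sinT_le].
have := Rfubini F1 => /=.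
have hi t : L1 (fun xi => fejer d xi * h (t, xi)).
  apply: (@L1_le _ _ (fun xi => 2 * A * fejer d xi)).
  - apply: measurable_funM; first exact: measurable_fejer.
    rewrite /h /=; apply: measurable_funD; apply: measurable_funM => //.
      exact: (measurable_cosM t).
    exact: (measurable_sinM t).
  - exact: L1Z (L1_fejer d).
  move=> xi /=; rewrite normrM mulrC (ger0_norm (fejer_ge0 _ _)) ler_wpM2r ?fejer_ge0//.
  rewrite mulr2n mulrDl mul1r.
  apply: le_trans (ler_normD _ _) _; apply: lerD; rewrite normrM.
    by rewrite -[leRHS]mul1r; apply: ler_pM => //; [exact: cos_max|exact: cosT_le].
  by rewrite -[leRHS]mul1r; apply: ler_pM => //; [exact: sin_max|exact: sinT_le].
under eq_Rintegral => t _.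
  rewrite RintegralZl//; last exact: hi.
  rewrite /h /= fejer_duality// mulrCA.
  over.
have ahat : L1 (fun t => a t * conv (hat d) a t).
  under eq_fun do rewrite mulrC.
  apply: (@L1_bounded_mul _ _ _ (d * A)) => //.
    by apply: measurable_conv => //; exact: L1_hat.
  move=> t; rewrite /A -RintegralZl//; last exact: integrable_norm.
  have L : L1 (fun s => hat d (t - s) * a s).
    apply: (@L1_bounded_mul _ _ _ d) => //.
      apply: measurableT_comp; first exact: measurable_hat.
      exact: measurable_funB.
    by move=> s; rewrite ger0_norm ?hat_ge0// hat_le.
  apply: le_trans (le_normr_Rintegral measurableT L) _.
  apply: le_Rintegral => //.
  - exact: integrable_norm.
  - by apply: L1Z; exact: integrable_norm.
  by move=> s _; rewrite normrM ger0_norm ?hat_ge0// ler_wpM2r ?hat_le.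
rewrite RintegralZl// => ->; apply: eq_Rintegral => xi _.
have ca := L1_cosM xi a1; have sa := L1_sinM xi a1.
under [RHS]eq_Rintegral => t _.
  have -> : a t * (fejer d xi * h (t, xi)) =
     fejer d xi * (cosT a xi * (cos (xi * t) * a t) + sinT a xi * (sin (xi * t) * a t)).
    by rewrite /h /= (mulrC t); ring.
  over.
rewrite RintegralZl//; last by apply: L1D; exact: L1Z.
rewrite RintegralD//; [|exact: L1Z|exact: L1Z].
by rewrite !RintegralZl.
Qed.

Lemma fejer_energy_le a d : 0 < d -> L1 a -> L2 a ->
  \int[mu]_xi (fejer d xi * (cosT a xi ^+ 2 + sinT a xi ^+ 2)) <=
  fejer_mass * (d ^+ 2 * hat_mass) * fine (sqint a).
Proof.
move=> d0 a1 a2; have d0' := ltW d0.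
rewrite fejer_energy// -mulrA ler_wpM2l//; first exact/ltW/fejer_mass_gt0.
have h1 := L1_hat d0'.
have m0 : 0 < \int[mu]_x hat d x.
  by rewrite int_hat// mulr_gt0 ?exprn_gt0// hat_mass_gt0.
have c2 := L2_conv (hat_ge0 d) h1 m0 a2.
have := sqint_conv (hat_ge0 d) h1 m0 a2.
rewrite -(fineK (sqint_fin c2)) -(fineK (sqint_fin a2)) -EFinM lee_fin.
rewrite -int_hat//; set m := \int[mu]_x _ in m0 * => hc.
(* The weights balance the two terms: [sqint (conv (hat d) a)] is at most [m ^+ 2 * sqint a], so
   each term contributes at most [m / 2 * sqint a]. *)
apply: (@le_trans _ _ (\int[mu]_t (m / 2 * a t ^+ 2 + (m * 2)^-1 * conv (hat d) a t ^+ 2))).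
  apply: le_Rintegral => //.
  - exact: L2_mul.
  - by apply: L1D; apply: L1Z; exact: L2_sqr_L1.
  move=> t _; set x := a t; set y := conv _ _ _.
  rewrite -subr_ge0.
  have -> : m / 2 * x ^+ 2 + (m * 2)^-1 * y ^+ 2 - x * y = (m * x - y) ^+ 2 / (m * 2).
    by field; rewrite gt_eqF.
  by rewrite divr_ge0 ?sqr_ge0// mulr_ge0// ltW.
have a2' := L2_sqr_L1 a2; have c2' := L2_sqr_L1 c2.
rewrite RintegralD//; [|exact: L1Z|exact: L1Z].
rewrite !RintegralZl//.
rewrite -/(fine (sqint _)) -[\int[mu]_t conv (hat d) a t ^+ 2]/(fine (sqint _)).
rewrite -[\int[mu]_t a t ^+ 2]/(fine (sqint a)).
set X := fine (sqint a) in hc *; set Y := fine _ in hc *.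
have : (m * 2)^-1 * Y <= (m * 2)^-1 * (m ^+ 2 * X).
  by rewrite ler_wpM2l// invr_ge0 mulr_ge0// ltW.
have -> : (m * 2)^-1 * (m ^+ 2 * X) = m / 2 * X by field; rewrite gt_eqF.
rewrite /=; have -> : m * X = m / 2 * X + m / 2 * X by field.
by move=> h; apply: lerD.
Qed.

(** The first factor inverts the lower bound [cos 1 ^+ 2 / 2] of [oneBcos_ge]; the second is the
    constant of [fejer_energy_le] without its power of [d]. *)
Definition bessel_const : R := 2 / cos 1 ^+ 2 * (fejer_mass * hat_mass).

Lemma bessel_const_ge0 : 0 <= bessel_const.
Proof.
rewrite mulr_ge0 ?divr_ge0 ?sqr_ge0// mulr_ge0// ltW//;
  [exact: fejer_mass_gt0|exact: hat_mass_gt0].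
Qed.

(** For nonzero [xi] with [|xi| <= 1 / d] the kernel is at least [cos 1 ^+ 2 / 2 * d ^+ 2], and
    [fejer_energy_le] carries the same power of [d]. The powers cancel, so the bound is uniform over
    the intervals [I n], and monotone convergence extends it to the line. *)
Lemma bessel a : L1 a -> L2 a ->
  (\int[mu]_xi (cosT a xi ^+ 2 + sinT a xi ^+ 2)%:E <= bessel_const%:E * sqint a)%E.
Proof.
move=> a1 a2; have ma := L1_measurable a1.
have mC := measurable_cosT ma; have mS := measurable_sinT ma.
pose E xi := cosT a xi ^+ 2 + sinT a xi ^+ 2.
have E0 xi : 0 <= E xi by rewrite addr_ge0 ?sqr_ge0.
have mE : measurable_fun setT E by apply: measurable_funD; exact: measurable_funX.
have EA xi : `|E xi| <= (\int[mu]_t `|a t|) ^+ 2 + (\int[mu]_t `|a t|) ^+ 2.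
  have A0 : 0 <= \int[mu]_t `|a t| by apply: Rintegral_ge0.
  rewrite ger0_norm// /E -(real_normK (num_real (cosT a xi))) -(real_normK (num_real (sinT a xi))).
  by apply: lerD; rewrite lerXn2r ?nnegrE//; [exact: cosT_le|exact: sinT_le].
pose I n : set RR := `[- n.+1%:R, n.+1%:R]%classic.
have mI n : measurable (I n) by exact: measurable_itv.
have key n : (\int[mu]_(xi in I n) (E xi)%:E <= bessel_const%:E * sqint a)%E.
  pose d : R := n.+1%:R^-1.
  have d0 : 0 < d by rewrite invr_gt0 ltr0n.
  have fE : L1 (fun xi => fejer d xi * E xi).
    by under eq_fun do rewrite mulrC; apply: (L1_bounded_mul mE (L1_fejer d) EA).
  have c0 : 0 < cos 1 ^+ 2 / 2 :> R by rewrite divr_gt0// exprn_gt0// cos1_gt0.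
  have cd0 : 0 < 2 / cos 1 ^+ 2 / d ^+ 2.
    by rewrite !divr_gt0 ?exprn_gt0// cos1_gt0.
  apply: (@le_trans _ _ (\int[mu]_(xi in I n)
      ((2 / cos 1 ^+ 2 / d ^+ 2) * (fejer d xi * E xi))%:E)%E).
    apply: ae_ge0_le_integral => //.
    - by move=> xi _; rewrite lee_fin.
    - by apply/measurable_EFinP; exact: measurable_funTS.
    - by move=> xi _; rewrite lee_fin mulr_ge0 ?(ltW cd0)// mulr_ge0 ?fejer_ge0.
    - apply/measurable_EFinP; apply: measurable_funTS.
      by apply: measurable_funM => //; exact: (L1_measurable fE).
    (* The exceptional point: [fejer d 0] is [0], whereas [E 0] may be positive. *)
    exists [set 0]; split => //; first exact: lebesgue_measure_set1.
    move=> xi /= nle; apply/eqP; apply: contra_notT nle => xi0 xin.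
    rewrite lee_fin mulrA ler_peMl//.
    have xi2 : 0 < xi ^+ 2 by rewrite exprn_even_gt0.
    have : cos 1 ^+ 2 / 2 * (d * xi) ^+ 2 <= 1 - cos (d * xi).
      apply: oneBcos_ge; rewrite normrM (gtr0_norm d0) mulrC /d ler_pdivrMr// mul1r.
      by move: xin; rewrite /I/= in_itv/= ler_norml.
    rewrite /fejer => h.
    rewrite -[leLHS](_ : 2 / cos 1 ^+ 2 / d ^+ 2 * (cos 1 ^+ 2 / 2 * (d * xi) ^+ 2 / xi ^+ 2) = 1).
      by rewrite ler_wpM2l ?(ltW cd0)// ler_wpM2r// invr_ge0 ltW.
    by field; rewrite xi0 (gt_eqF d0) gt_eqF// cos1_gt0.
  apply: (@le_trans _ _ (\int[mu]_xi
      ((2 / cos 1 ^+ 2 / d ^+ 2) * (fejer d xi * E xi))%:E)%E).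
    apply: ge0_subset_integral => //.
    - by apply/measurable_EFinP; apply: measurable_funM => //; exact: (L1_measurable fE).
    - by move=> xi _; rewrite lee_fin mulr_ge0 ?(ltW cd0)// mulr_ge0 ?fejer_ge0.
  rewrite -(fineK (sqint_fin a2)) -EFinM.
  rewrite -[leLHS]fineK; last by apply: integrable_fin_num => //; exact: L1Z.
  rewrite lee_fin [leLHS]RintegralZl//.
  have := fejer_energy_le d0 a1 a2; rewrite -/(E _).
  move=> /(ler_wpM2l (ltW cd0)) /le_trans; apply.
  rewrite le_eqVlt; apply/orP; left; apply/eqP; rewrite /bessel_const.
  by field; rewrite (gt_eqF d0) gt_eqF// cos1_gt0.
have -> : [set: R] = \bigcup_n I n.
  apply/seteqP; split => // x _; exists (Num.truncn `|x|) => //=.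
  by rewrite /I/= in_itv/= -ler_norml ltW// truncnS_gt.
have nd : {homo I : n m / (n <= m)%N >-> (n <= m)%O}.
  move=> n m nm; apply/subsetPset => x; rewrite /I/= !in_itv/= -!ler_norml => /le_trans; apply.
  by rewrite ler_nat.
have := @ge0_nondecreasing_set_cvg_integral _ _ _ I
  (fun xi => (E xi)%:E) mu nd.
move=> /(_ _ _ _)/cvge_to_le; apply => //.
- by move=> i; apply/measurable_EFinP; exact: measurable_funTS.
- by move=> n xi _; rewrite lee_fin.
- by apply: nearW => n; exact: key.
Qed.

End bessel.

(** * Injectivity of the transform *)

Section injectivity.
Context {R : realType}.
Local Notation mu := (@lebesgue_measure R).
Local Notation RR := (measurableTypeR R).
Implicit Types (a b : R -> R) (F G : R -> \bar R).

(** Convergence to [0] at [+oo] in epsilon form, equivalent to the filter form for nonnegative [F].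
    Values at small [r] may be infinite, and comparison, sums and multiples are immediate. *)
Definition vanish F : Prop :=
  forall e : R, 0 < e -> exists N : R, forall r, N <= r -> (F r <= e%:E)%E.

Lemma vanish_cvg F : (forall r, 0 <= F r)%E ->
  vanish F <-> F r @[r --> +oo] --> 0%E.
Proof.
move=> F0; split=> [vF|].
  apply/fine_cvgP; split.
    have [N NF] := vF 1 ltr01; near=> r; rewrite ge0_fin_numE//.
    apply: (@le_lt_trans _ _ 1%:E); last exact: ltry.
    by apply: NF; near: r; apply: nbhs_pinfty_ge; exact: num_real.
  apply/cvgrPdist_le => e e0; have [N NF] := vF e e0; near=> r.
  rewrite sub0r normrN ger0_norm ?fine_ge0//.
  have : (F r <= e%:E)%E by apply: NF; near: r; apply: nbhs_pinfty_ge; exact: num_real.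
  move=> Fe; rewrite -lee_fin fineK// ge0_fin_numE//.
  by apply: le_lt_trans Fe _; exact: ltry.
move=> /fine_cvgP[Ffin /cvgrPdist_le cF] e e0.
have [M1 [_ M1F]] := Ffin; have [M2 [_ M2F]] := cF e e0.
exists (Num.max M1 M2 + 1) => r Mr.
have r1 : M1 < r by apply: lt_le_trans Mr; rewrite ltr_pwDr// le_max lexx.
have r2 : M2 < r by apply: lt_le_trans Mr; rewrite ltr_pwDr// le_max lexx orbT.
rewrite -(fineK (M1F _ r1)) lee_fin.
by have := M2F _ r2; rewrite /= sub0r normrN; apply: le_trans; exact: ler_norm.
Unshelve. all: by end_near. Qed.

Lemma vanish_le F G : vanish F -> (forall r, G r <= F r)%E -> vanish G.
Proof.
move=> vF GF e e0; have [N NF] := vF e e0; exists N => r Nr.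
exact: le_trans (GF r) (NF r Nr).
Qed.

Lemma vanishD F G : vanish F -> vanish G -> vanish (fun r => F r + G r)%E.
Proof.
move=> vF vG e e0; have e2 : 0 < e / 2 by rewrite divr_gt0.
have [N NF] := vF _ e2; have [M MG] := vG _ e2.
exists (Num.max N M) => r; rewrite ge_max => /andP[Nr Mr].
by rewrite (splitr e) EFinD; apply: leeD; [exact: NF|exact: MG].
Qed.

Lemma vanishZ c F : 0 <= c -> vanish F -> vanish (fun r => c%:E * F r)%E.
Proof.
move=> c0 vF e e0; have c1 : 0 < c + 1 by rewrite ltr_wpDl.
have [N NF] := vF _ (divr_gt0 e0 c1).
exists N => r /NF Fe; apply: le_trans (lee_wpmul2l _ Fe) _; first by rewrite lee_fin.
rewrite -EFinM lee_fin mulrA ler_pdivrMr// mulrC ler_wpM2l// ?(ltW e0)//.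
by rewrite lerDl.
Qed.

Definition trunc r a : R -> R := a \_ `[- r, r].

Lemma truncE r a t : trunc r a t = if `|t| <= r then a t else 0.
Proof.
rewrite /trunc patchE; congr (if _ then _ else _).
apply/idP/idP; rewrite ler_norml; first by rewrite inE/= in_itv.
by move=> h; rewrite inE/= in_itv.
Qed.

Lemma measurable_trunc r a : measurable_fun setT a -> measurable_fun setT (trunc r a).
Proof.
by move=> ma; apply/(measurable_restrictT a); [exact: measurable_itv|exact: measurable_funTS].
Qed.

Lemma trunc_le r a t : `|trunc r a t| <= `|a t|.
Proof. by rewrite truncE; case: ifP => // _; rewrite normr0. Qed.

Lemma L2_trunc r a : L2 a -> L2 (trunc r a).
Proof.
by move=> a2; have [ma _] := a2; apply: L2_le a2 (trunc_le r a); exact: measurable_trunc.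
Qed.

(** The indicator plus [a ^+ 2] dominates the truncation. This gives [cosT] and [sinT] an integrable
    argument when [a] is merely square-integrable. *)
Lemma L2_trunc_L1 r a : L2 a -> L1 (trunc r a).
Proof.
move=> a2; have ma := a2.1.
have i1 : L1 (\1_`[- r, r]%classic : R -> R) := integrable_indic_itv (- r) r true false.
apply: (@L1_le _ _ (fun t => \1_`[- r, r]%classic t + a t ^+ 2)).
- exact: measurable_trunc.
- by apply: L1D => //; exact: L2_sqr_L1.
move=> t; rewrite /trunc patchE indicE; case: ifPn => _ /=.
  rewrite -(real_normK (num_real (a t))).
  by have := sqr_ge0 (`|a t| - 1); have := sqr_ge0 (`|a t|); lra.
by rewrite normr0 add0r sqr_ge0.
Qed.

Definition tail a r : \bar R := sqint (fun t => a t - trunc r a t)%R.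

Lemma L2_tail r a : L2 a -> L2 (fun t => a t - trunc r a t).
Proof. by move=> a2; apply: L2B => //; exact: L2_trunc. Qed.

Lemma tail_le r s a : measurable_fun setT a -> r <= s -> (tail a s <= tail a r)%E.
Proof.
move=> ma rs; have mt u := measurable_funB ma (measurable_trunc u ma).
apply: sqint_le => //; [exact: mt|exact: mt|] => t; rewrite !truncE.
case: ifP => ts; first by rewrite subrr normr0.
by rewrite ifF//; apply: contraFF ts => /le_trans; apply.
Qed.

(** Dominated convergence along the integers; monotonicity of the tail carries the limit over to
    real [r]. *)
Lemma vanish_tail a : L2 a -> vanish (tail a).
Proof.
move=> a2; have ma := a2.1.
have : (tail a n%:R @[n --> \oo] --> \int[mu]_x (cst 0%E x))%E.
  apply: (@dominated_cvg _ _ _ mu _ measurableT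
    (fun n t => ((a t - trunc n%:R a t) ^+ 2)%:E) _ (fun t => (a t ^+ 2)%:E)).
  - by move=> n; apply: measurable_sqr; apply: measurable_funB => //; exact: measurable_trunc.
  - move=> t _; apply: cvg_near_cst; exists (Num.truncn `|t|).+1 => // n /= tn.
    rewrite truncE ifT ?subrr ?expr0n//.
    by apply: le_trans (_ : (Num.truncn `|t|).+1%:R <= _); [exact/ltW/truncnS_gt|rewrite ler_nat].
  - by [].
  - exact: L2_sqr_L1.
  - move=> n t _; rewrite lee_fin ger0_norm ?sqr_ge0// truncE; case: ifP => _.
      by rewrite subrr expr0n sqr_ge0.
    by rewrite subr0.
rewrite integral_cst// mul0e => /fine_cvgP[[M1 _ M1F] /cvgrPdist_le cF] e e0.
have [M2 _ M2F] := cF e e0; exists (maxn M1 M2)%:R => r Mr.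
apply: le_trans (tail_le ma Mr) _.
rewrite -(fineK (M1F _ (leq_maxl _ _))) lee_fin.
by have := M2F _ (leq_maxr M1 M2); rewrite /= sub0r normrN; apply: le_trans; exact: ler_norm.
Qed.

Lemma fejer_le_sqr (d xi : R) : fejer d xi <= d ^+ 2 / 2.
Proof.
rewrite /fejer; have [->|xn] := eqVneq xi 0.
  by rewrite expr0n/= invr0 mulr0 divr_ge0 ?sqr_ge0.
rewrite ler_pdivrMr ?exprn_even_gt0//.
by have := oneBcos_le (d * xi); rewrite exprMn mulrAC.
Qed.

Lemma L2_fejer (d : R) : L2 (fejer d).
Proof.
split; first exact: measurable_fejer.
have := L1_int_lty (L1Z (d ^+ 2 / 2) (L1_fejer d)).
apply: le_lt_trans; apply: le_ge0_integral.
- by apply: measurable_funX; exact: measurable_fejer.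
- by apply: measurableT_comp => //; apply: measurable_funM => //; exact: measurable_fejer.
- by move=> x; exact: sqr_ge0.
move=> x; rewrite normrM !ger0_norm ?fejer_ge0 ?divr_ge0 ?sqr_ge0//.
by rewrite expr2 ler_wpM2r ?fejer_ge0// fejer_le_sqr.
Qed.

Lemma L2_cosT a : L1 a -> L2 a -> L2 (cosT a).
Proof.
move=> a1 a2; have ma := a2.1; split; first exact: measurable_cosT.
apply: le_lt_trans (_ : (bessel_const%:E * sqint a < +oo)%E).
  apply: le_trans (bessel a1 a2); apply: le_ge0_integral.
  - by apply: measurable_funX; exact: measurable_cosT.
  - by apply: measurable_funD; apply: measurable_funX; [exact: measurable_cosT|exact: measurable_sinT].
  - by move=> x; exact: sqr_ge0.
  - by move=> x; rewrite lerDl sqr_ge0.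
by rewrite lte_mul_pinfty// ?lee_fin ?bessel_const_ge0//; case: a2.
Qed.

Lemma L2_sinT a : L1 a -> L2 a -> L2 (sinT a).
Proof.
move=> a1 a2; have ma := a2.1; split; first exact: measurable_sinT.
apply: le_lt_trans (_ : (bessel_const%:E * sqint a < +oo)%E).
  apply: le_trans (bessel a1 a2); apply: le_ge0_integral.
  - by apply: measurable_funX; exact: measurable_sinT.
  - by apply: measurable_funD; apply: measurable_funX; [exact: measurable_cosT|exact: measurable_sinT].
  - by move=> x; exact: sqr_ge0.
  - by move=> x; rewrite lerDr sqr_ge0.
by rewrite lte_mul_pinfty// ?lee_fin ?bessel_const_ge0//; case: a2.
Qed.

(** [hat d] vanishes outside [[- d, d]], so the convolution at [x] only sees [[x - d, x + d]]. *)
Lemma conv_hat_trunc a d x r : 0 <= d -> `|x| + d <= r ->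
  conv (hat d) (trunc r a) x = conv (hat d) a x.
Proof.
move=> d0 xr; apply: eq_Rintegral => s _; rewrite truncE.
case: ifPn => // sr; rewrite mulr0 hat_out ?mul0r//.
rewrite -ltNge in sr; have := ler_normD (x - s) (- x).
have -> : x - s - x = - s by ring.
by rewrite !normrN; lra.
Qed.

Lemma L1_conv_hat_kernel a d x : 0 <= d -> L2 a -> L1 (fun s => hat d (x - s) * a s).
Proof.
move=> d0 a2; have ma := a2.1.
have h1 : L1 (fun s => hat d (x - s)).
  have := @L1_affine _ _ (-1) x _ (L1_hat d0); rewrite oppr_eq0 oner_eq0 => /(_ isT).
  by under eq_fun do rewrite mulN1r addrC.
apply: L2_mul => //; split; first exact: L1_measurable.
have := L1_int_lty (L1Z d h1).
apply: le_lt_trans; apply: le_ge0_integral.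
- by apply: measurable_funX; exact: L1_measurable.
- by apply: measurableT_comp => //; apply: L1_measurable; exact: L1Z.
- by move=> s; exact: sqr_ge0.
move=> s; rewrite normrM !ger0_norm ?hat_ge0// expr2 ler_wpM2r ?hat_ge0//.
exact: hat_le.
Qed.

(** [fejer_duality] and the inequality [f * y <= eta * f ^+ 2 + y ^+ 2 / eta]. The free [eta]
    replaces Cauchy-Schwarz: it is chosen small against the fixed norm of [fejer d], and then the
    transforms have to be small against [eta]. *)
Lemma fejer_test a d x (eta : R) : 0 < eta -> L1 a -> L2 a ->
  fejer_mass * `|conv (hat d) a x| <=
  2 * eta * fine (sqint (fejer d)) + (fine (sqint (cosT a)) + fine (sqint (sinT a))) / eta.
Proof.
move=> eta0 a1 a2; have fm0 := @fejer_mass_gt0 R.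
have C2 := L2_cosT a1 a2; have S2 := L2_sinT a1 a2.
have F2 := L2_fejer d.
rewrite -[X in X * `|_|](gtr0_norm fm0) -normrM -fejer_duality//.
have fx : L1 (fun xi => fejer d xi * (cos (x * xi) * cosT a xi + sin (x * xi) * sinT a xi)).
  apply: L2_mul => //; apply: L2D.
    apply: (L2_le _ C2); first by apply: measurable_funM; [exact: measurable_cosM|case: C2].
    by move=> xi; rewrite normrM ler_piMl// cos_max.
  apply: (L2_le _ S2); first by apply: measurable_funM; [exact: measurable_sinM|case: S2].
  by move=> xi; rewrite normrM ler_piMl// sin_max.
apply: le_trans (le_normr_Rintegral measurableT fx) _.
have F2' := L2_sqr_L1 F2; have C2' := L2_sqr_L1 C2; have S2' := L2_sqr_L1 S2.
have -> : 2 * eta * fine (sqint (fejer d)) + (fine (sqint (cosT a)) + fine (sqint (sinT a))) / eta =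
  \int[mu]_xi (2 * eta * fejer d xi ^+ 2 + eta^-1 * (cosT a xi ^+ 2 + sinT a xi ^+ 2)).
  rewrite RintegralD//; [|exact: L1Z|by apply: L1Z; exact: L1D].
  rewrite !RintegralZl//; last exact: L1D.
  by rewrite [X in _ = _ + _ * X]RintegralD// [X in _ = _ + X]mulrC.
apply: le_Rintegral => //.
- exact: integrable_norm.
- by apply: L1D; apply: L1Z => //; exact: L1D.
move=> xi _; rewrite normrM ger0_norm ?fejer_ge0//.
set f := fejer d xi; set C := cosT a xi; set S := sinT a xi.
have AM (y : R) : f * `|y| <= eta * f ^+ 2 + eta^-1 * y ^+ 2.
  rewrite -(real_normK (num_real y)); set z := `|y|.
  have -> : eta * f ^+ 2 + eta^-1 * z ^+ 2 = f * z + ((eta * f - z) ^+ 2 + eta * f * z) / eta.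
    by field; rewrite gt_eqF.
  rewrite lerDl divr_ge0 ?(ltW eta0)// addr_ge0 ?sqr_ge0//.
  apply: mulr_ge0; last exact: normr_ge0.
  by apply: mulr_ge0; [exact: ltW|exact: fejer_ge0].
apply: (@le_trans _ _ (f * (`|C| + `|S|))).
  apply: ler_wpM2l; first exact: fejer_ge0.
  apply: le_trans (ler_normD _ _) _; rewrite !normrM.
  apply: lerD; rewrite ler_piMl//; [exact: cos_max|exact: sin_max].
rewrite mulrDr; have := lerD (AM C) (AM S); set f2 := f ^+ 2.
set C' := C ^+ 2; set S' := S ^+ 2; set h := eta^-1; lra.
Qed.

Lemma conv_hat_eq0 a d x : 0 <= d -> L2 a ->
  vanish (fun r => sqint (cosT (trunc r a)) + sqint (sinT (trunc r a)))%E ->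
  conv (hat d) a x = 0.
Proof.
move=> d0 a2 va; have fm0 := @fejer_mass_gt0 R.
suff : fejer_mass * `|conv (hat d) a x| <= 0.
  by rewrite pmulr_rle0// normr_le0 => /eqP.
apply/ler_addgt0Pl => e e0; rewrite addr0.
set F2 := fine (sqint (fejer d)).
have F20 : 0 <= F2 by rewrite fine_ge0// sqint_ge0.
(* This makes [2 * eta * F2] at most [e / 2], the added 1 keeping the denominator positive. The
   other [e / 2] is available to the transforms, whence the tolerance [eta * (e / 2)]. *)
pose eta := e / (4 * (F2 + 1)).
have eta0 : 0 < eta by rewrite divr_gt0// mulr_gt0// ltr_wpDl.
have ee0 : 0 < eta * (e / 2) by rewrite mulr_gt0// divr_gt0.
have [N NF] := va _ ee0.
(* Large enough for the transforms to be small and for the convolution at [x] not to notice the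
   truncation. *)
pose r := Num.max N (`|x| + d).
have Nr : N <= r by rewrite le_max lexx.
have a1r := L2_trunc_L1 r a2; have a2r := L2_trunc r a2.
rewrite -(@conv_hat_trunc _ _ _ r)//; last by rewrite le_max lexx orbT.
apply: le_trans (fejer_test d x eta0 a1r a2r) _; rewrite -/F2.
have C2 := sqint_fin (L2_cosT a1r a2r); have S2 := sqint_fin (L2_sinT a1r a2r).
have := NF r Nr; rewrite -(fineK C2) -(fineK S2) -EFinD lee_fin.
set X := _ + _ => XN.
have : X / eta <= e / 2 by rewrite ler_pdivrMr// mulrC.
have : 2 * eta * F2 <= e / 2.
  have -> : 2 * eta * F2 = e / 2 * (F2 / (F2 + 1)).
    by rewrite /eta; field; rewrite gt_eqF// ltr_wpDl.
  rewrite ler_piMr ?divr_ge0 ?(ltW e0)//.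
  by rewrite ler_pdivrMr ?ltr_wpDl// mul1r lerDl.
lra.
Qed.

Lemma L2_locally_integrable a : L2 a -> locally_integrable setT a.
Proof.
move=> a2; have ma := a2.1; split=> //; first exact: openT.
move=> K _ cK; have mK := compact_measurable cK.
apply: (@le_lt_trans _ _ (\int[mu]_(t in K) (1 + (a t ^+ 2)%:E))%E).
  apply: ge0_le_integral => //.
  - by apply/measurable_EFinP; apply: measurableT_comp => //; exact: measurable_funTS.
  - by apply: emeasurable_funD => //; apply: measurable_funTS; exact: measurable_sqr.
  move=> t _; rewrite -EFinD lee_fin -(real_normK (num_real (a t))).
  by have := sqr_ge0 (`|a t| - 1); have := sqr_ge0 (`|a t|); lra.
rewrite ge0_integralD//; last 2 first.
- by move=> t _; rewrite lee_fin sqr_ge0.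
- by apply: measurable_funTS; exact: measurable_sqr.
rewrite integral_cst// mul1e lte_add_pinfty//; first exact: compact_finite_measure.
apply: le_lt_trans a2.2; apply: ge0_subset_integral => //; first exact: measurable_sqr.
by move=> t _; rewrite lee_fin sqr_ge0.
Qed.

(* At a Lebesgue point [x], [hat r (x - .)] being of height at most [r] and supported in
   the ball of radius [r] compares [a x] with the averages of [`|a - a x|]. *)
Lemma conv_hat_eq0_ae a : L2 a -> (forall d x, 0 < d -> conv (hat d) a x = 0) ->
  {ae mu, forall x, a x = 0}.
Proof.
move=> a2 ha; have ma := a2.1; have hm0 := @hat_mass_gt0 R.
have := lebesgue_differentiation (L2_locally_integrable a2).
apply: ae_imp => x ax.
(* The integral of the shifted hat is [r ^+ 2 * hat_mass]. Dividing by its height [r] and by the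
   length [2 * r] of the ball leaves [hat_mass / 2]. *)
have key r : 0 < r -> ((`|a x| * hat_mass / 2)%:E <= davg a x r)%E.
  move=> r0; pose w s := hat r (x - s).
  have w1 : L1 w.
    have := @L1_affine _ _ (-1) x _ (L1_hat (ltW r0)); rewrite oppr_eq0 oner_eq0 => /(_ isT).
    by under eq_fun do rewrite mulN1r addrC.
  have intw : \int[mu]_s w s = r ^+ 2 * hat_mass.
    rewrite -int_hat// [RHS](@Rintegral_affine _ _ (-1) x) ?oppr_eq0 ?oner_eq0//; last exact: L1_hat (ltW r0).
    by rewrite normrN1 mul1r; apply: eq_Rintegral => s _; rewrite mulN1r addrC.
  have aw1 : L1 (fun s => w s * a s) := L1_conv_hat_kernel x (ltW r0) a2.
  have h1 : L1 (fun s => w s * a s - a x * w s) by apply: L1B => //; exact: L1Z.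
  have E : `|a x| * (r ^+ 2 * hat_mass) <= \int[mu]_s `|w s * a s - a x * w s|.
    apply: le_trans (le_normr_Rintegral measurableT h1).
    rewrite RintegralB//; last exact: L1Z.
    rewrite RintegralZl// -/(conv (hat r) a x) ha// sub0r normrN normrM intw.
    by rewrite (@ger0_norm _ (_ * hat_mass))// mulr_ge0 ?sqr_ge0// ltW.
  have mB : measurable (ball x r) := measurable_ball x r.
  have mD : measurable_fun (ball x r) (fun s => `|a s - a x|).
    by apply: measurable_funTS; apply: measurableT_comp => //; exact: measurable_funB.
  have F : ((`|a x| * (r ^+ 2 * hat_mass))%:E <=
      r%:E * \int[mu]_(s in ball x r) `|a s - a x|%:E)%E.
    apply: (@le_trans _ _ (\int[mu]_s `|w s * a s - a x * w s|)%:E); first by rewrite lee_fin.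
    rewrite fineK; last by apply: integrable_fin_num => //; exact: integrable_norm.
    rewrite -ge0_integralZl_EFin//; last 2 first.
    - exact/measurable_EFinP.
    - exact: ltW.
    rewrite [leRHS]integral_mkcond; apply: ge0_le_integral => //.
    - by apply/measurable_EFinP; apply: measurableT_comp => //; exact: L1_measurable.
    - apply/(measurable_restrictT _ mB); apply/measurable_EFinP.
      exact: measurable_funM.
    move=> s _; rewrite patchE; case: ifPn => [_|/negP xs].
      have -> : w s * a s - a x * w s = w s * (a s - a x) by ring.
      by rewrite -EFinM lee_fin normrM ger0_norm ?hat_ge0// ler_wpM2r// hat_le// ltW.
    rewrite /w hat_out ?mul0r ?mulr0 ?subr0 ?normr0//; first exact: ltW.
    rewrite leNgt; apply/negP => xs'; apply: xs; rewrite inE.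
    by rewrite -ball_normE.
  have r2 : 0 < r *+ 2 by rewrite mulrn_wgt0.
  rewrite /davg /iavg lebesgue_measure_ball ?(ltW r0)// inver gt_eqF//.
  have -> : `|a x| * hat_mass / 2 = (r *+ 2)^-1 * (r^-1 * (`|a x| * (r ^+ 2 * hat_mass))).
    by field; rewrite gt_eqF.
  rewrite EFinM; apply: lee_wpmul2l; first by rewrite lee_fin invr_ge0 ltW.
  move: F; set I := integral _ _ _ => F.
  have -> : I = ((r^-1)%:E * (r%:E * I))%E by rewrite muleA -EFinM mulVf ?gt_eqF// mul1e.
  by rewrite EFinM; apply: lee_wpmul2l => //; rewrite lee_fin invr_ge0 ltW.
have : ((`|a x| * hat_mass / 2)%:E <= 0)%E.
  by apply: (cvge_to_ge ax); near=> r; apply: key; near: r; exact: nbhs_right_gt.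
rewrite lee_fin pmulr_lle0 ?invr_gt0// pmulr_lle0// normr_le0 => /eqP //.
Unshelve. all: by end_near. Qed.

Lemma transform_inj a : L2 a ->
  vanish (fun r => sqint (cosT (trunc r a)) + sqint (sinT (trunc r a)))%E ->
  {ae mu, forall x, a x = 0}.
Proof.
move=> a2 va; apply: conv_hat_eq0_ae => // d x d0.
by apply: conv_hat_eq0 => //; exact: ltW.
Qed.

End injectivity.

(** * The transform on L^2 *)

Section riesz_fischer.
Context {R : realType}.
Local Notation mu := (@lebesgue_measure R).
Local Notation RR := (measurableTypeR R).

(** The intervals around [x m] of radius [2 * s / 2 ^+ m], the rest of the geometric series, are
    nested; the supremum of their left ends lies in all of them. *)
Lemma cvg_of_geometric_increments (x : nat -> R) (s : R) :
  (forall k, `|x k.+1 - x k| <= s / 2 ^+ k) ->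
  exists l, forall m, `|l - x m| <= 2 * s / 2 ^+ m.
Proof.
move=> xs.
have s0 : 0 <= s by have := xs 0%N; rewrite expr0 divr1; apply: le_trans.
have half k : s / 2 ^+ k.+1 = s / 2 ^+ k / 2 by rewrite exprS invfM; ring.
have sk k : 0 <= s / 2 ^+ k by rewrite divr_ge0// exprn_ge0.
pose a m := x m - 2 * s / 2 ^+ m; pose b m := x m + 2 * s / 2 ^+ m.
have ab n m : a n <= b m.
  have and_ : {homo a : n m / (n <= m)%N >-> n <= m}.
    apply/nondecreasing_seqP => k; rewrite /a -!mulrA half.
    by have := xs k; rewrite ler_norml; set y := s / 2 ^+ k; lra.
  have bni : {homo b : n m / (n <= m)%N >-> m <= n}.
    apply/nonincreasing_seqP => k; rewrite /b -!mulrA half.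
    by have := xs k; rewrite ler_norml; set y := s / 2 ^+ k; lra.
  apply: (@le_trans _ _ (a (maxn n m))); first by apply: and_; exact: leq_maxl.
  apply: (@le_trans _ _ (b (maxn n m))); last by apply: bni; exact: leq_maxr.
  by rewrite /a /b -!mulrA; have := sk (maxn n m); set y := s / _; lra.
have supa : has_sup (range a).
  by split; [exists (a 0%N); exists 0%N|exists (b 0%N) => _ [n _ <-]].
exists (sup (range a)) => m; rewrite ler_norml; apply/andP; split.
  have : a m <= sup (range a) by apply: ub_le_sup; [exact: supa.2|exists m].
  by rewrite /a; lra.
have : sup (range a) <= b m by apply: ge_sup; [exact: supa.1|move=> _ [n _ <-]].
by rewrite /b; lra.
Qed.

Lemma sum_geom4_le n : \sum_(k < n) (4 ^+ k)^-1 <= 4 / 3 :> R.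
Proof.
suff : \sum_(k < n) (4 ^+ k)^-1 = 4 / 3 * (1 - (4 ^+ n)^-1) :> R.
  by move=> ->; rewrite ler_piMr// gerBl invr_ge0 exprn_ge0.
elim: n => [|n IH]; first by rewrite big_ord0 expr0 invr1 subrr mulr0.
rewrite big_ord_recr/= IH exprS invfM; by set y := (4 ^+ n)^-1; field.
Qed.

(** Weighted by [4 ^+ k], the squared increments still have a series [S] of integral at most
    [2 * A]. So [S] is finite almost everywhere, the increments are at most the root of [S] over
    [2 ^+ k], and the squared distance to the limit is at most [4 * S / 4 ^+ k], which integrates to
    the bound. *)
Lemma riesz_fischer (h : nat -> R -> R) (A : R) : (forall k, L2 (h k)) ->
  (forall k, (sqint (fun t => h k.+1 t - h k t)%R <= (A / 16 ^+ k)%:E)%E) ->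
  exists g, L2 g /\ forall k, (sqint (fun t => h k t - g t)%R <= (8 * A / 4 ^+ k)%:E)%E.
Proof.
move=> h2 hA; have mh k : measurable_fun setT (h k) := (h2 k).1.
have A0 : 0 <= A.
  by have := hA 0%N; rewrite expr0 divr1; move/(le_trans (sqint_ge0 _)); rewrite lee_fin.
pose d k t := h k.+1 t - h k t.
have md k : measurable_fun setT (d k) by exact: measurable_funB.
pose S t := (\sum_(0 <= k <oo) (4 ^+ k * d k t ^+ 2)%:E)%E.
have p4 k : 0 < 4 ^+ k :> R by rewrite exprn_gt0.
have E4 k : 4 ^+ k = (2 ^+ k) ^+ 2 :> R.
  by rewrite -exprM mulnC exprM; congr (_ ^+ _); rewrite expr2 -natrM.
have S0 k t : 0 <= 4 ^+ k * d k t ^+ 2 by rewrite mulr_ge0 ?sqr_ge0// ltW.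
have Sge0 t : (0 <= S t)%E by apply: nneseries_ge0 => n _ _; rewrite lee_fin.
have mS : measurable_fun setT S.
  apply: (@ge0_emeasurable_sum _ _ _ setT (fun k t => (4 ^+ k * d k t ^+ 2)%:E) predT).
    by move=> k t _ _; rewrite lee_fin.
  by move=> k _; apply/measurable_EFinP; apply: measurable_funM => //; exact: (measurable_funX 2 (md k)).
have intS : (\int[mu]_t S t <= (2 * A)%:E)%E.
  rewrite integral_nneseries//; last 2 first.
  - by move=> k; apply/measurable_EFinP; apply: measurable_funM => //; exact: (measurable_funX 2 (md k)).
  - by move=> k t _; rewrite lee_fin.
  apply: lime_le.
    by apply: is_cvg_nneseries => k _ _; apply: integral_ge0 => t _; rewrite lee_fin.
  apply: nearW => n; rewrite big_mkord.
  apply: (@le_trans _ _ (\sum_(k < n) (A * (4 ^+ k)^-1)%:E)%E).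
    apply: lee_sum => k _; under eq_integral do rewrite EFinM.
    rewrite ge0_integralZl_EFin//; last 2 first.
    - by move=> t _; rewrite lee_fin sqr_ge0.
    - exact: measurable_sqr.
    apply: le_trans (lee_wpmul2l _ (hA k)) _; first by rewrite lee_fin ltW.
    rewrite -EFinM lee_fin le_eqVlt; apply/orP; left; apply/eqP.
    have -> : 16 = 4 * 4 :> R by ring.
    by rewrite exprMn; field; rewrite gt_eqF.
  rewrite sumEFin lee_fin -mulr_sumr mulrC ler_wpM2r//.
  by apply: le_trans (sum_geom4_le n) _; lra.
pose G := [set t | (S t < +oo)%E].
have mG : measurable (G : set RR).
  by have := emeasurable_fun_infty_o measurableT mS +oo%E; rewrite setTI.
have aeG : {ae mu, forall t, G t}.
  have /integrable_ae : mu.-integrable setT S.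
    apply/integrableP; split => //.
    under eq_integral => t _ do rewrite gee0_abs//.
    by apply: le_lt_trans intS _; exact: ltry.
  by move=> /(_ measurableT); apply: ae_imp => t /(_ I); rewrite /G/= => /fin_numPlt/andP[].
(* Replacing the sequence by [0] off [G] makes the increments geometric at every point, so a limit
   can be chosen everywhere. *)
pose h' k := h k \_ G.
have mh' k : measurable_fun setT (h' k).
  by apply/(measurable_restrictT (h k)) => //; exact: measurable_funTS (mh k).
(* Finiteness of [S t] gives [`|d k t| <= Num.sqrt (S t) / 2 ^+ k]. *)
have lim_ t : exists l, forall m, `|l - h' m t| <= 2 * Num.sqrt (fine (S t)) / 2 ^+ m.
  apply: cvg_of_geometric_increments => k; rewrite /h' !patchE.
  case: ifPn => [|_]; last by rewrite subrr normr0 divr_ge0 ?sqrtr_ge0// exprn_ge0.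
  rewrite inE /G/= => tG.
  have Sfin : S t \is a fin_num by rewrite ge0_fin_numE.
  have : ((4 ^+ k * d k t ^+ 2)%:E <= S t)%E.
    apply: le_trans (nneseries_lim_ge k.+1 _); last by move=> n _ _; rewrite lee_fin.
    rewrite big_nat_recr//= leeDr// sume_ge0// => n _; rewrite lee_fin//.
  rewrite -(fineK Sfin) lee_fin => dS.
  rewrite ler_pdivlMr ?exprn_gt0// -/(d k t).
  have -> : `|d k t| * 2 ^+ k = Num.sqrt (4 ^+ k * d k t ^+ 2).
    have -> : 4 ^+ k * d k t ^+ 2 = (`|d k t| * 2 ^+ k) ^+ 2.
      by rewrite exprMn real_normK ?num_real// mulrC E4.
    by rewrite sqrtr_sqr (@ger0_norm _ (_ * _))// mulr_ge0// exprn_ge0.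
  by rewrite ler_wsqrtr.
have [g gP] := choice lim_.
have mg : measurable_fun setT g.
  apply/measurable_EFinP; apply: (emeasurable_fun_cvg (fun k t => (h' k t)%:E)).
    by move=> k; exact/measurable_EFinP.
  move=> t _; apply/cvg_EFin; first exact: nearW.
  rewrite /comp/=; apply/cvgrPdist_le => e e0.
  have : (2 * Num.sqrt (fine (S t)) * 2^-1 ^+ n @[n --> \oo] --> 2 * Num.sqrt (fine (S t)) * 0)%R.
    by apply: cvgMr; apply: cvg_expr; rewrite ger0_norm; lra.
  rewrite mulr0 => /cvgrPdist_le /(_ _ e0); apply: filterS => n.
  rewrite sub0r normrN => He; apply: le_trans (gP t n) _.
  by apply: le_trans He; rewrite exprVn ler_norm.
have gh k : (sqint (fun t => h k t - g t)%R <= (8 * A / 4 ^+ k)%:E)%E.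
  apply: (@le_trans _ _ (\int[mu]_t ((4 / 4 ^+ k)%:E * S t))%E).
    apply: ae_ge0_le_integral => //.
    - by move=> t _; rewrite lee_fin sqr_ge0.
    - by apply: measurable_sqr; exact: measurable_funB.
    - by move=> t _; apply: mule_ge0 => //; rewrite lee_fin divr_ge0// ltW.
    - exact: measurable_funeM.
    move: aeG; apply: ae_imp => t Gt _.
    have Sfin : S t \is a fin_num.
      by rewrite ge0_fin_numE.
    have := gP t k; rewrite /h' patchE mem_set// => H.
    rewrite -(fineK Sfin) -EFinM lee_fin -(real_normK (num_real (h k t - g t))) distrC.
    have s0 : 0 <= fine (S t) by rewrite fine_ge0.
    apply: (@le_trans _ _ ((2 * Num.sqrt (fine (S t)) / 2 ^+ k) ^+ 2)).
      by rewrite lerXn2r ?nnegrE//; exact: le_trans H.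
    rewrite !exprMn sqr_sqrtr// exprVn -E4 le_eqVlt; apply/orP; left; apply/eqP.
    by rewrite mulrAC; congr (_ / _ * _); rewrite expr2 -natrM.
  rewrite ge0_integralZl_EFin//.
  apply: le_trans (lee_wpmul2l _ intS) _; first by rewrite lee_fin divr_ge0// ltW.
  rewrite -EFinM lee_fin le_eqVlt; apply/orP; left; apply/eqP.
  by ring.
exists g; split=> //.
have L : L2 (fun t => h 0 t - g t).
  split; first exact: measurable_funB.
  by apply: le_lt_trans (gh 0%N) _; exact: ltry.
have := L2B (h2 0%N) L; congr L2; apply/funext => t; ring.
Qed.

End riesz_fischer.

(** * Cosine and sine transforms of square-integrable functions *)

Section transform.
Context {R : realType}.
Local Notation mu := (@lebesgue_measure R).
Local Notation K := (@bessel_const R).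
Implicit Types a b p q : R -> R.

Lemma cosTB a b xi : L1 a -> L1 b -> cosT (fun t => a t - b t) xi = cosT a xi - cosT b xi.
Proof.
move=> a1 b1; rewrite /cosT -RintegralB//; [|exact: L1_cosM|exact: L1_cosM].
by apply: eq_Rintegral => t _; rewrite mulrBr.
Qed.

Lemma sinTB a b xi : L1 a -> L1 b -> sinT (fun t => a t - b t) xi = sinT a xi - sinT b xi.
Proof.
move=> a1 b1; rewrite /sinT -RintegralB//; [|exact: L1_sinM|exact: L1_sinM].
by apply: eq_Rintegral => t _; rewrite mulrBr.
Qed.

Lemma bessel_cos a : L1 a -> L2 a -> (sqint (cosT a) <= K%:E * sqint a)%E.
Proof.
move=> a1 a2; have ma := a2.1; apply: le_trans (bessel a1 a2); apply: le_ge0_integral.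
- by apply: measurable_funX; exact: measurable_cosT.
- by apply: measurable_funD; apply: measurable_funX; [exact: measurable_cosT|exact: measurable_sinT].
- by move=> x; exact: sqr_ge0.
- by move=> x; rewrite lerDl sqr_ge0.
Qed.

Lemma bessel_sin a : L1 a -> L2 a -> (sqint (sinT a) <= K%:E * sqint a)%E.
Proof.
move=> a1 a2; have ma := a2.1; apply: le_trans (bessel a1 a2); apply: le_ge0_integral.
- by apply: measurable_funX; exact: measurable_sinT.
- by apply: measurable_funD; apply: measurable_funX; [exact: measurable_cosT|exact: measurable_sinT].
- by move=> x; exact: sqr_ge0.
- by move=> x; rewrite lerDr sqr_ge0.
Qed.

(* [cosT a] and [sinT a] are junk unless [a] is integrable: on L^2 the transforms are
   limits over truncations. *)
Definition is_transform a p q : Prop :=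
  [/\ L2 a, L2 p, L2 q &
      vanish (fun r => sqint (fun xi => cosT (trunc r a) xi - p xi)%R +
                       sqint (fun xi => sinT (trunc r a) xi - q xi)%R)%E].

Lemma mule2D (c : R) (x y : \bar R) : (0 <= x)%E -> (0 <= y)%E ->
  ((2 * c)%:E * (x + y) = 2%:E * (c%:E * x) + 2%:E * (c%:E * y))%E.
Proof. by move=> x0 y0; rewrite ge0_muleDr// EFinM !muleA. Qed.

(** The index [k] is absent from [F] and the error is uniform in [r]: fix [k] with a small error,
    then let [r] grow. *)
Lemma vanish_of_approx (F G : R -> \bar R) (B : R) : vanish G ->
  (forall k r, (F r <= G r + (B / 4 ^+ k)%:E)%E) -> vanish F.
Proof.
move=> vG FG e e0; have e2 : 0 < e / 2 by rewrite divr_gt0.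
have [N NG] := vG _ e2; exists N => r Nr.
pose k := (Num.truncn (`|B| / (e / 2))).+1.
apply: le_trans (FG k r) _; rewrite [in leRHS](splitr e) EFinD.
apply: leeD; first exact: NG.
rewrite lee_fin; apply: le_trans (ler_norm _) _.
rewrite normrM (@ger0_norm _ (_^-1)) ?invr_ge0 ?exprn_ge0//.
rewrite ler_pdivrMr ?exprn_gt0// mulrC -ler_pdivrMr//.
have : `|B| / (e / 2) < k%:R by exact: truncnS_gt.
move=> /ltW /le_trans; apply.
by rewrite -natrX ler_nat ltnW// ltn_expl.
Qed.

(* [T] stands for either of [cosT] and [sinT]. *)
Let transform_half (T : (R -> R) -> R -> R) a :
  (forall b, measurable_fun setT b -> measurable_fun setT (T b)) ->
  (forall b c xi, L1 b -> L1 c -> T (fun t => b t - c t) xi = T b xi - T c xi) ->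
  (forall b, L1 b -> L2 b -> (sqint (T b) <= K%:E * sqint b)%E) ->
  L2 a -> exists2 p, L2 p & vanish (fun r => sqint (fun xi => T (trunc r a) xi - p xi)%R).
Proof.
move=> mT TB Tb a2; have ma := a2.1; have K0 := @bessel_const_ge0 R.
have p16 k : 0 < 16 ^+ k :> R by rewrite exprn_gt0.
(* Truncation radii with tails of the rate that [riesz_fischer] asks for. *)
have /choice[rr rrP] : forall k, exists N, (tail a N <= ((16 ^+ k)^-1)%:E)%E.
  move=> k; have [|N NP] := vanish_tail a2 (e := (16 ^+ k)^-1).
    by rewrite invr_gt0.
  by exists N; exact: NP.
have diff r s : (sqint (fun xi => T (trunc r a) xi - T (trunc s a) xi)%R <=
    K%:E * (2%:E * tail a r + 2%:E * tail a s))%E.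
  have r1 := L2_trunc_L1 r a2; have s1 := L2_trunc_L1 s a2.
  have r2 := L2_trunc r a2; have s2 := L2_trunc s a2.
  rewrite (@eq_sqint _ _ (T (fun t => trunc r a t - trunc s a t))); last first.
    by move=> xi; rewrite TB.
  apply: le_trans (Tb _ (L1B r1 s1) (L2B r2 s2)) _.
  apply: lee_wpmul2l; first by rewrite lee_fin.
  apply: sqint_le2D.
  - by case: (L2_tail r a2).
  - by case: (L2_tail s a2).
  - by case: (L2B r2 s2).
  move=> t; have -> : trunc r a t - trunc s a t = (a t - trunc s a t) - (a t - trunc r a t) by ring.
  by rewrite [leRHS]addrC; exact: ler_normB.
have TL2 b : L1 b -> L2 b -> L2 (T b).
  move=> b1 b2; split; first by apply: mT; case: b2.
  apply: le_lt_trans (Tb _ b1 b2) _.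
  by rewrite lte_mul_pinfty// ?lee_fin//; case: b2.
pose h k := T (trunc (rr k) a).
have h2 k : L2 (h k) by apply: TL2; [exact: L2_trunc_L1|exact: L2_trunc].
(* Two consecutive tails give [K * (2 / 16 + 2) / 16 ^+ k], rounded up to [4 * K / 16 ^+ k]. *)
have [|p [p2 hp]] := riesz_fischer h2 (A := 4 * K).
  move=> k; apply: le_trans (diff _ _) _.
  apply: (@le_trans _ _ (K%:E * (2%:E * ((16 ^+ k.+1)^-1)%:E + 2%:E * ((16 ^+ k)^-1)%:E))%E).
    by apply: lee_wpmul2l; [rewrite lee_fin|apply: leeD; apply: lee_wpmul2l].
  rewrite -!EFinM -?EFinD -?EFinM lee_fin exprS invfM.
  have : 0 <= (16 ^+ k)^-1 :> R by rewrite invr_ge0 ltW.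
  set y := (16 ^+ k)^-1 => y0.
  by rewrite [leRHS](_ : _ = K * (4 * y)); [rewrite ler_wpM2l//; lra|ring].
exists p => //; have mp := p2.1.
(* The constant 68 is [4 + 64]: the tail at [rr k] contributes [4 * K / 16 ^+ k], and the distance
   from [h k] to the limit contributes [2 * (8 * (4 * K)) / 4 ^+ k]. *)
apply: (@vanish_of_approx _ (fun r => (4 * K)%:E * tail a r)%E (68 * K)).
  by apply: vanishZ; [rewrite mulr_ge0|exact: vanish_tail].
move=> k r; have r1 := L2_trunc_L1 r a2; have r2 := L2_trunc r a2.
have Tr := TL2 _ r1 r2.
apply: (@le_trans _ _ (2%:E * sqint (fun xi => T (trunc r a) xi - h k xi)%R +
    2%:E * sqint (fun xi => h k xi - p xi)%R)%E).
  apply: sqint_le2D.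
  - by case: (L2B Tr (h2 k)).
  - by case: (L2B (h2 k) p2).
  - by case: (L2B Tr p2).
  move=> xi; have -> : T (trunc r a) xi - p xi = (T (trunc r a) xi - h k xi) + (h k xi - p xi) by ring.
  exact: ler_normD.
have tfin := sqint_fin (L2_tail r a2); rewrite -/(tail a r) in tfin.
apply: (@le_trans _ _ (2%:E * (K%:E * (2%:E * tail a r + 2%:E * ((16 ^+ k)^-1)%:E)) +
    2%:E * (8 * (4 * K) / 4 ^+ k)%:E)%E).
  apply: leeD; apply: lee_wpmul2l => //.
  apply: le_trans (diff _ _) _; apply: lee_wpmul2l; first by rewrite lee_fin.
  by apply: leeD => //; apply: lee_wpmul2l.
rewrite -(fineK tfin) -?EFinM -?EFinD -?EFinM -?EFinD lee_fin.
have -> : 16 ^+ k = 4 ^+ k * 4 ^+ k :> R by rewrite -exprMn -natrM.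
rewrite invfM.
have y0 : 0 <= (4 ^+ k)^-1 :> R by rewrite invr_ge0 exprn_ge0.
have y1 : (4 ^+ k)^-1 <= 1 :> R by rewrite invf_le1 ?exprn_gt0// exprn_ege1// ler1n.
set y := (4 ^+ k)^-1 in y0 y1 *; set t := fine _.
have : K * (y * y) <= K * y by rewrite ler_wpM2l// ler_piMl.
set u := K * (y * y); set v := K * y => uv.
rewrite [leLHS](_ : _ = 4 * K * t + 4 * u + 64 * v); last by rewrite /u /v; ring.
rewrite [leRHS](_ : _ = 4 * K * t + 68 * v); last by rewrite /v; ring.
by rewrite -addrA lerD2l; lra.
Qed.

Lemma transform_exists a : L2 a -> exists p q, is_transform a p q.
Proof.
move=> a2.
have [p p2 vp] := transform_half (@measurable_cosT R) cosTB bessel_cos a2.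
have [q q2 vq] := transform_half (@measurable_sinT R) sinTB bessel_sin a2.
by exists p, q; split=> //; exact: vanishD.
Qed.

(** * Convolution becomes multiplication on the transform side *)

Section convolution_multiplier.
Variable k : R -> R.
Hypothesis k0 : forall x, 0 <= k x.
Hypothesis k1 : L1 k.
Hypothesis m0 : 0 < \int[mu]_x k x.
Local Notation m := (\int[mu]_x k x).

Let bounded_multiplier (A f : R -> R) : measurable_fun setT A -> (forall xi, `|A xi| <= m) ->
  L2 f -> (sqint (fun xi => A xi * f xi)%R <= (m ^+ 2)%:E * sqint f)%E.
Proof.
move=> mA Am [mf f2]; rewrite -sqintZ//; apply: sqint_le.
- exact: measurable_funM.
- exact: measurable_funM.
by move=> xi; rewrite !normrM ler_wpM2r// (gtr0_norm m0).
Qed.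

Let L2_multiplier (A f : R -> R) : measurable_fun setT A -> (forall xi, `|A xi| <= m) ->
  L2 f -> L2 (fun xi => A xi * f xi).
Proof.
move=> mA Am f2; have [mf fo] := f2; split; first exact: measurable_funM.
apply: le_lt_trans (bounded_multiplier mA Am f2) _.
by apply: lte_mul_pinfty => //; rewrite lee_fin sqr_ge0.
Qed.

Let km xi : `|cosT k xi| <= m.
Proof.
apply: le_trans (cosT_le xi k1) _; rewrite le_eqVlt; apply/orP; left; apply/eqP.
by apply: eq_Rintegral => t _; rewrite ger0_norm.
Qed.

Let kn xi : `|sinT k xi| <= m.
Proof.
apply: le_trans (sinT_le xi k1) _; rewrite le_eqVlt; apply/orP; left; apply/eqP.
by apply: eq_Rintegral => t _; rewrite ger0_norm.
Qed.

Let mA : measurable_fun setT (cosT k). Proof. by apply: measurable_cosT; exact: L1_measurable k1. Qed.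
Let mB : measurable_fun setT (sinT k). Proof. by apply: measurable_sinT; exact: L1_measurable k1. Qed.

(** The product rule is exact for [conv k (trunc r a)], whereas the limit concerns
    [trunc r (conv k a)]. Their difference [W r] is controlled by the tails of [conv k a] and of
    [a], hence so are its transforms by Bessel; what remains is multiplication by functions bounded
    by the mass [m]. *)
Lemma transform_conv a p q : is_transform a p q ->
  is_transform (conv k a) (fun xi => cosT k xi * p xi - sinT k xi * q xi)
    (fun xi => cosT k xi * q xi + sinT k xi * p xi).
Proof.
move=> [a2 p2 q2 va]; have U2 := L2_conv k0 k1 m0 a2; have mp := p2.1; have mq := q2.1.
have LM A f := @L2_multiplier A f.
split=> //.
- by apply: L2B; exact: LM.
- by apply: L2D; exact: LM.
pose W r t := trunc r (conv k a) t - conv k (trunc r a) t.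
have a1r r := L2_trunc_L1 r a2; have a2r r := L2_trunc r a2.
have U1r r := L2_trunc_L1 r U2; have U2r r := L2_trunc r U2.
have c1r r := L1_conv k0 k1 m0 (a1r r); have c2r r := L2_conv k0 k1 m0 (a2r r).
have W1 r : L1 (W r) := L1B (U1r r) (c1r r).
have W2 r : L2 (W r) := L2B (U2r r) (c2r r).
have WE r : (sqint (W r) <= 2%:E * tail (conv k a) r + 2%:E * ((m ^+ 2)%:E * tail a r))%E.
  apply: (@le_trans _ _ (2%:E * tail (conv k a) r +
      2%:E * sqint (fun t => conv k a t - conv k (trunc r a) t)%R)%E).
    apply: sqint_le2D.
    - by case: (L2_tail r U2).
    - by case: (L2B U2 (c2r r)).
    - by case: (W2 r).
    move=> t; rewrite /W.
    have -> : trunc r (conv k a) t - conv k (trunc r a) t =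
      (conv k a t - conv k (trunc r a) t) - (conv k a t - trunc r (conv k a) t) by ring.
    by rewrite [leRHS]addrC; exact: ler_normB.
  apply: leeD => //; apply: lee_wpmul2l => //.
  rewrite (@sqint_aeeq _ _ (conv k (fun t => a t - trunc r a t))).
  - exact: (sqint_conv k0 k1 m0 (L2_tail r a2)).
  - by case: (L2B U2 (c2r r)).
  - by case: (L2_conv k0 k1 m0 (L2_tail r a2)).
  by apply: ae_imp (convB k0 k1 m0 a2 (a2r r)) => t ->.
pose Dp r xi := cosT (trunc r a) xi - p xi.
pose Dq r xi := sinT (trunc r a) xi - q xi.
have Dp2 r : L2 (Dp r) := L2B (L2_cosT (a1r r) (a2r r)) p2.
have Dq2 r : L2 (Dq r) := L2B (L2_sinT (a1r r) (a2r r)) q2.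
pose V r := (sqint (Dp r) + sqint (Dq r))%E.
have bound (Z T : R -> R) r (X Y : R -> R) : measurable_fun setT Z -> L2 T ->
    measurable_fun setT X -> (forall xi, `|X xi| <= m) ->
    measurable_fun setT Y -> (forall xi, `|Y xi| <= m) ->
    (sqint T <= K%:E * sqint (W r))%E ->
    (forall xi, Z xi = T xi + (X xi * Dp r xi + Y xi * Dq r xi)) ->
    (sqint Z <= 2%:E * (K%:E * sqint (W r)) + (4 * m ^+ 2)%:E * V r)%E.
  move=> mZ T2 mX Xm mY Ym TW ZE.
  have XD := LM _ _ mX Xm (Dp2 r); have YD := LM _ _ mY Ym (Dq2 r).
  have mT := T2.1.
  rewrite (eq_sqint ZE); apply: le_trans (sqintD mT (L2D XD YD).1) _.
  apply: leeD; first by apply: lee_wpmul2l.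
  rewrite [((4 * _)%:E * _)%E](_ : _ = 2%:E * ((2 * m ^+ 2)%:E * V r))%E; last first.
    by rewrite muleA -EFinM; congr (_%:E * _)%E; ring.
  apply: lee_wpmul2l => //.
  apply: le_trans (sqintD XD.1 YD.1) _.
  rewrite mule2D ?sqint_ge0//.
  by apply: leeD; apply: lee_wpmul2l => //; exact: bounded_multiplier.
apply: (@vanish_le _ (fun r => (4 * K)%:E * sqint (W r) + (8 * m ^+ 2)%:E * V r)%E).
  apply: vanishD; last by apply: vanishZ => //; rewrite mulr_ge0// sqr_ge0.
  apply: vanishZ; first by rewrite mulr_ge0// bessel_const_ge0.
  apply: (vanish_le _ WE); apply: vanishD; apply: vanishZ => //; first exact: vanish_tail.
  by apply: vanishZ; [exact: sqr_ge0|exact: vanish_tail].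
move=> r; have ka := cosT_conv k0 k1 m0 _ (a1r r); have ks := sinT_conv k0 k1 m0 _ (a1r r).
have CW := L2_cosT (W1 r) (W2 r); have SW := L2_sinT (W1 r) (W2 r).
have kmN xi : `|- sinT k xi| <= m by rewrite normrN.
have mBN : measurable_fun setT (fun xi => - sinT k xi) by exact: measurableT_comp.
apply: (@le_trans _ _ ((2%:E * (K%:E * sqint (W r)) + (4 * m ^+ 2)%:E * V r) +
   (2%:E * (K%:E * sqint (W r)) + (4 * m ^+ 2)%:E * V r))%E).
  apply: leeD.
    apply: (bound _ (cosT (W r)) r (cosT k) (fun xi => - sinT k xi)) => //.
    - by case: (L2B (L2_cosT (U1r r) (U2r r)) (L2B (LM _ _ mA km p2) (LM _ _ mB kn q2))).
    - exact: bessel_cos.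
    by move=> xi; rewrite cosTB// ka /Dp /Dq; ring.
  apply: (bound _ (sinT (W r)) r (sinT k) (cosT k)) => //.
  - by case: (L2B (L2_sinT (U1r r) (U2r r)) (L2D (LM _ _ mA km q2) (LM _ _ mB kn p2))).
  - exact: bessel_sin.
  by move=> xi; rewrite sinTB// ks /Dp /Dq; ring.
have Wf := sqint_fin (W2 r).
have Vf : V r \is a fin_num by rewrite /V fin_numD !sqint_fin.
rewrite -(fineK Wf) -(fineK Vf) -!EFinM -!EFinD lee_fin le_eqVlt; apply/orP; left; apply/eqP.
by ring.
Qed.

End convolution_multiplier.

Lemma cosTN a xi : cosT a (- xi) = cosT a xi.
Proof. by apply: eq_Rintegral => t _; rewrite mulNr cosN. Qed.

Lemma sinTN a xi : L1 a -> sinT a (- xi) = - sinT a xi.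
Proof.
move=> a1; rewrite -[RHS]mulN1r /sinT -(RintegralZl (-1) measurableT (L1_sinM xi a1)).
by apply: eq_Rintegral => t _; rewrite mulNr sinN mulNr mulN1r.
Qed.

(* The substitution [xi -> - xi] separates the even functions [cosT] from the odd
   functions [sinT]. *)
Lemma sqint_cosBsin_cosDsin a b : L1 a -> L1 b ->
  sqint (fun xi => cosT a xi - sinT b xi) = sqint (fun xi => cosT a xi + sinT b xi).
Proof.
move=> a1 b1; have ma := L1_measurable a1; have mb := L1_measurable b1.
have mC := measurable_cosT ma; have mS := measurable_sinT mb.
rewrite /sqint [LHS](@ge0_integral_affine _ (-1) 0).
- rewrite normrN1 mul1e; apply: eq_integral => xi _; congr ((_ ^+ 2)%:E).
  by rewrite addr0 mulN1r cosTN sinTN// opprK.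
- by rewrite oppr_eq0 oner_eq0.
- by apply: measurable_sqr; exact: measurable_funB.
- by move=> xi; rewrite lee_fin sqr_ge0.
Qed.

(** Averaging the two equal quantities of [sqint_cosBsin_cosDsin] cancels the cross term. *)
Lemma sqint_cosDsin a b : L1 a -> L1 b ->
  sqint (fun xi => cosT a xi + sinT b xi) = (sqint (cosT a) + sqint (sinT b))%E.
Proof.
move=> a1 b1; have ma := L1_measurable a1; have mb := L1_measurable b1.
have mC := measurable_cosT ma; have mS := measurable_sinT mb.
have half (x : \bar R) : x = ((2^-1)%:E * (x + x))%E.
  by rewrite -mule2n -mule_natl muleA -EFinM mulVf// mul1e.
rewrite [LHS]half -{1}sqint_cosBsin_cosDsin// -ge0_integralD//; last 4 first.
- by move=> x _; rewrite lee_fin sqr_ge0.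
- by apply: measurable_sqr; exact: measurable_funB.
- by move=> x _; rewrite lee_fin sqr_ge0.
- by apply: measurable_sqr; exact: measurable_funD.
have -> : (\int[mu]_xi (((cosT a xi - sinT b xi) ^+ 2)%:E + ((cosT a xi + sinT b xi) ^+ 2)%:E) =
   \int[mu]_xi (2%:E * ((cosT a xi ^+ 2)%:E + (sinT b xi ^+ 2)%:E)))%E.
  by apply: eq_integral => xi _; rewrite -!EFinD -EFinM; congr (_%:E); ring.
rewrite ge0_integralZl_EFin//; last 2 first.
- by move=> x _; rewrite -EFinD lee_fin addr_ge0// sqr_ge0.
- by apply: emeasurable_funD; exact: measurable_sqr.
rewrite muleA -EFinM mulVf// mul1e ge0_integralD//.
- by move=> x _; rewrite lee_fin sqr_ge0.
- exact: measurable_sqr.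
- by move=> x _; rewrite lee_fin sqr_ge0.
- exact: measurable_sqr.
Qed.

(** The transform of [a + i b] has real part [cosT a + sinT b] and imaginary part [cosT b - sinT a].
    Parity splits their norms into four separate ones, and [transform_inj] then applies to [a] and
    to [b]. *)
Lemma complex_transform_inj a b : L2 a -> L2 b ->
  vanish (fun r => sqint (fun xi => cosT (trunc r a) xi + sinT (trunc r b) xi)%R +
                   sqint (fun xi => cosT (trunc r b) xi - sinT (trunc r a) xi)%R)%E ->
  {ae mu, forall t, a t = 0} /\ {ae mu, forall t, b t = 0}.
Proof.
move=> a2 b2 vab; have a1 r := L2_trunc_L1 r a2; have b1 r := L2_trunc_L1 r b2.
split; apply: transform_inj => //; apply: (vanish_le vab) => r;
  rewrite (sqint_cosBsin_cosDsin (b1 r) (a1 r)) (sqint_cosDsin (a1 r) (b1 r))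
    (sqint_cosDsin (b1 r) (a1 r)).
  by apply: leeD; [apply: leeDl|apply: leeDr]; exact: sqint_ge0.
by rewrite [leLHS]addeC; apply: leeD; [apply: leeDr|apply: leeDl]; exact: sqint_ge0.
Qed.

End transform.

(** * The gamma kernel *)

Section gamma_kernel.
Context {R : realType}.
Local Notation mu := (@lebesgue_measure R).
Local Notation RR := (measurableTypeR R).

(** The integrand of the Gamma integral. The indicator is explicit because [powR] need not vanish at
    nonpositive arguments. *)
Definition gker (b r t : R) : R := \1_`]0%R, +oo[%classic t * t `^ (b - 1) * expR (- (r * t)).

Lemma gker_pos b r t : 0 < t -> gker b r t = t `^ (b - 1) * expR (- (r * t)).
Proof. by move=> t0; rewrite /gker indicE mem_set ?mul1r//= in_itv/= t0. Qed.

Lemma gker_neg b r t : t <= 0 -> gker b r t = 0.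
Proof.
move=> t0; rewrite /gker indicE memNset ?mul0r//=.
by rewrite in_itv/= andbT; apply/negP; rewrite -leNgt.
Qed.

Lemma gker_ge0 b r t : 0 <= gker b r t.
Proof. by rewrite /gker !mulr_ge0 ?expR_ge0 ?powR_ge0. Qed.

Lemma measurable_gker b r : measurable_fun setT (gker b r).
Proof.
apply: measurable_funM.
  by apply: measurable_funM; [exact: measurable_indic|exact: measurable_powR].
by apply: measurableT_comp => //; apply: measurableT_comp => //.
Qed.

Lemma expRN_le (x : R) : 0 <= x -> expR (- x) <= ((1 + x / 2) ^+ 2)^-1.
Proof.
move=> x0; have x2 : 0 < 1 + x / 2 by rewrite ltr_pwDl// divr_ge0.
rewrite expRN lef_pV2 ?posrE ?expR_gt0 ?exprn_gt0//.
have -> : expR x = expR (x / 2) ^+ 2 by rewrite expr2 -expRD; congr expR; field.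
by rewrite lerXn2r ?nnegrE ?expR_ge0 ?(ltW x2)// expR_ge1Dx.
Qed.

(** Exhaust []0, 1]] by [[1 / (n + 2), 1]], where the antiderivative [t^b / b] is regular; the shift
    by 2 keeps the left end below 1. *)
Lemma powR_int01_le (b : R) : 0 < b ->
  (\int[mu]_(t in `]0%R, 1%R]) (t `^ (b - 1))%:E <= (b^-1)%:E)%E.
Proof.
move=> b0.
pose J n : set RR := `[n.+2%:R^-1, 1%R]%classic.
have p n : 0 < n.+2%:R^-1 :> R by rewrite invr_gt0.
have mJ n : measurable (J n) by exact: measurable_itv.
have mp (D : set R) : measurable_fun D (fun t : R => (t `^ (b - 1))%:E).
  by apply/measurable_EFinP; apply: measurable_funTS; exact: measurable_powR.
have -> : `]0%R, 1%R]%classic = \bigcup_n J n.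
  apply/seteqP; split => x /=.
    rewrite in_itv/= => /andP[x0 x1]; exists (Num.truncn x^-1) => //=.
    rewrite /J/= in_itv/= x1 andbT -[leRHS]invrK lef_pV2 ?posrE ?invr_gt0//.
    by apply: le_trans (ltW (truncnS_gt _)) _; rewrite ler_nat.
  by move=> [n _]; rewrite /J/= !in_itv/= => /andP[nx ->]; rewrite andbT (lt_le_trans _ nx).
have nd : {homo J : n m / (n <= m)%N >-> (n <= m)%O}.
  move=> n m nm; apply/subsetPset => x; rewrite /J/= !in_itv/= => /andP[nx ->].
  by rewrite andbT (le_trans _ nx)// lef_pV2 ?posrE// ler_nat.
have := @ge0_nondecreasing_set_cvg_integral _ _ _ J (fun t => (t `^ (b - 1))%:E) mu nd.
move=> /(_ _ _ _)/cvge_to_le; apply => //.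
- by move=> n; exact: mp.
- by move=> n t _; rewrite lee_fin powR_ge0.
apply: nearW => n.
have n1 : n.+2%:R^-1 < 1 :> R by rewrite invf_lt1// ltr1n.
have cpow c : {in `]0, +oo[, continuous (fun t : R => t `^ c)}.
  move=> t; rewrite in_itv/= andbT => t0.
  apply/differentiable_continuous/derivable1_diffP.
  by apply: derivable_powR; rewrite in_itv/= andbT.
have dpow (t : R) : 0 < t -> is_derive t 1 (fun t : R => b^-1 * t `^ b) (t `^ (b - 1)).
  move=> t0; have := is_deriveZ b^-1 (is_derive1_powR b t0).
  by rewrite /GRing.scale/= mulrA mulVf ?mul1r// gt_eqF.
have sub0 t : t \in `[n.+2%:R^-1, 1] -> 0 < t.
  by rewrite in_itv/= => /andP[nt _]; exact: lt_le_trans nt.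
have cF t : 0 < t -> {for t, continuous (fun t : R => b^-1 * t `^ b)}.
  move=> t0; apply/differentiable_continuous/derivable1_diffP.
  by case: (dpow t t0).
rewrite (@continuous_FTC2 _ _ (fun t => b^-1 * t `^ b))//.
- rewrite -EFinB lee_fin powR1 mulr1 gerBl mulr_ge0 ?powR_ge0// invr_ge0 ltW//.
- apply: continuous_in_subspaceT => t; rewrite inE => /sub0 t0.
  by apply: cpow; rewrite in_itv/= t0.
- split.
  + move=> t /subset_itv_oo_cc /sub0 t0; by case: (dpow t t0).
  + by apply: cvg_at_right_filter; exact: cF.
  + by apply: cvg_at_left_filter; exact: cF.
move=> t /subset_itv_oo_cc /sub0 t0.
by rewrite derive1E; case: (dpow t t0).
Qed.

(** The range reaches [b = 2] because differentiation raises an exponent [b <= 1] to [b + 1]. On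
    []0, 1]] the power dominates. Beyond 1 the power is at most [t]; half of the exponential absorbs
    this [t] and the other half decays quadratically. *)
Lemma L1_gker b r : 0 < b -> b <= 2 -> 0 < r -> L1 (gker b r).
Proof.
move=> b0 b2 r0.
have L01 : L1 ((fun t => t `^ (b - 1)) \_ `]0%R, 1%R]).
  apply/integrableP; split.
    apply/measurable_EFinP; apply/(measurable_restrictT (fun t : R => t `^ (b - 1))) => //.
    by apply: measurable_funTS; exact: measurable_powR.
  apply: le_lt_trans (ltry b^-1); apply: le_trans (powR_int01_le b0).
  rewrite [leRHS]integral_mkcond le_eqVlt; apply/orP; left; apply/eqP.
  apply: eq_integral => t _ /=; rewrite !patchE; case: ifPn => _.
    by rewrite ger0_norm ?powR_ge0.
  by rewrite normr0.
(* The factor [2 / r] comes from [t <= 2 / r * expR (r * t / 2)]; the other is what makes [(1 + 16 /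
   r ^+ 2) * (1 + r ^+ 2 * t ^+ 2 / 16)] at least [1 + t ^+ 2]. *)
have L2' := L1Z (2 / r) (L1Z (1 + (16 / r ^+ 2)) (@L1_oneDsqrV R)).
apply: (L1_le (measurable_gker b r) (L1D L01 L2')) => t.
have q0 (x : R) : 0 <= (1 + x ^+ 2)^-1 by rewrite invr_ge0 addr_ge0// sqr_ge0.
have D0 : 0 <= 2 / r * ((1 + 16 / r ^+ 2) * (1 + t ^+ 2)^-1).
  rewrite mulr_ge0//; first by rewrite divr_ge0// ltW.
  by rewrite mulr_ge0// addr_ge0// divr_ge0// sqr_ge0.
rewrite ger0_norm ?gker_ge0// patchE; have [t0|t0] := leP t 0.
  by rewrite gker_neg// addr_ge0//; case: ifP => // _; rewrite powR_ge0.
rewrite gker_pos//; have [t1|t1] := leP t 1.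
  rewrite mem_set/= ?in_itv/= ?t0//.
  rewrite -[leLHS]addr0 lerD// ler_piMr ?powR_ge0//.
  by rewrite -expR0 ler_expR oppr_le0 mulr_ge0// ltW.
rewrite memNset/= ?in_itv/=; last by apply/negP; rewrite t0/= -ltNge.
rewrite add0r.
have h1 : t `^ (b - 1) <= t.
  by rewrite -[leRHS]powRr1 ?(ltW t0)// ler_powR ?(ltW t1)//; lra.
have h2 : t <= 2 / r * expR (r * t / 2).
  have := expR_ge1Dx (r * t / 2) => h.
  have : 2 / r * (r * t / 2) <= 2 / r * expR (r * t / 2).
    by rewrite ler_wpM2l ?divr_ge0 ?(ltW r0)// (le_trans _ h)// lerDr.
  by apply: le_trans; rewrite le_eqVlt; apply/orP; left; apply/eqP; field; rewrite gt_eqF.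
have h3 : t * expR (- (r * t)) <= 2 / r * expR (- (r * t / 2)).
  have -> : - (r * t / 2) = r * t / 2 + - (r * t) by field.
  by rewrite expRD mulrA ler_wpM2r ?expR_ge0.
apply: (@le_trans _ _ (t * expR (- (r * t)))); first by rewrite ler_wpM2r ?expR_ge0.
apply: le_trans h3 _; apply: ler_wpM2l; first by rewrite divr_ge0// ltW.
have rt : 0 <= r * t / 2 by rewrite divr_ge0// mulr_ge0// ltW.
apply: le_trans (expRN_le rt) _.
have t2 : 0 < 1 + t ^+ 2 by rewrite ltr_pwDl// sqr_ge0.
have r2 : 0 < 1 + r * t / 2 / 2 by rewrite ltr_pwDl// divr_ge0.
rewrite ler_pdivlMr// mulrC ler_pdivrMr ?exprn_gt0//.
have : 1 + r ^+ 2 * t ^+ 2 / 16 <= (1 + r * t / 2 / 2) ^+ 2.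
  have -> : (1 + r * t / 2 / 2) ^+ 2 = 1 + r ^+ 2 * t ^+ 2 / 16 + r * t / 2 by field.
  by rewrite lerDl.
have c0 : 0 <= 1 + 16 / r ^+ 2 by rewrite addr_ge0// divr_ge0// sqr_ge0.
move=> /(ler_wpM2l c0); apply: le_trans.
have -> : (1 + 16 / r ^+ 2) * (1 + r ^+ 2 * t ^+ 2 / 16) =
   1 + t ^+ 2 + (16 / r ^+ 2 + r ^+ 2 * t ^+ 2 / 16) by field; rewrite gt_eqF.
rewrite lerDl; apply: addr_ge0; apply: divr_ge0 => //; first exact: sqr_ge0.
by apply: mulr_ge0; exact: sqr_ge0.
Qed.

(** Differentiation in [r] or [xi] brings down a factor [t], which is absorbed here into the
    exponent. *)
Lemma gker_mulr b r t : 0 < b -> t * gker b r t = gker (b + 1) r t.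
Proof.
move=> b0; have [t0|t0] := leP t 0; first by rewrite !gker_neg// mulr0.
by rewrite !gker_pos// addrK mulrA mulr_powRB1// ltW.
Qed.

Lemma gker_scale b r t l : 0 < l ->
  gker b (l * r) t = l `^ (1 - b) * gker b r (l * t + 0).
Proof.
move=> l0; rewrite addr0; have [t0|t0] := leP t 0.
  by rewrite !gker_neg// ?mulr0// pmulr_rle0.
rewrite !gker_pos ?mulr_gt0// powRM ?(ltW l0) ?(ltW t0)// !mulrA -powRD; last first.
  by apply/implyP => _; rewrite gt_eqF.
have -> : 1 - b + (b - 1) = 0 by ring.
by rewrite powRr0 mul1r (mulrC l r).
Qed.

Definition gcos b r xi : R := \int[mu]_t (cos (xi * t) * gker b r t).
Definition gsin b r xi : R := \int[mu]_t (sin (xi * t) * gker b r t).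

Lemma gcos_scale b r xi l : 0 < b -> b <= 2 -> 0 < r -> 0 < l ->
  gcos b (l * r) (l * xi) = l `^ (- b) * gcos b r xi.
Proof.
move=> b0 b2 r0 l0; have g1 := L1_gker b0 b2 r0.
have l0' : l != 0 by rewrite gt_eqF.
rewrite [in RHS]/gcos (Rintegral_affine 0 l0' (L1_cosM xi g1)).
rewrite /gcos; under eq_Rintegral => t _.
  rewrite (_ : _ * _ = l `^ (1 - b) * (cos (xi * (l * t + 0)) * gker b r (l * t + 0))); last first.
    by rewrite gker_scale// mulrCA; congr (_ * (cos _ * _)); ring.
  over.
rewrite RintegralZl//; last exact: (L1_affine 0 l0' (L1_cosM xi g1)).
rewrite mulrA gtr0_norm// powRD; last by rewrite l0' implybT.
by rewrite powRr1 ?(ltW l0)// (mulrC l).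
Qed.

Lemma gsin_scale b r xi l : 0 < b -> b <= 2 -> 0 < r -> 0 < l ->
  gsin b (l * r) (l * xi) = l `^ (- b) * gsin b r xi.
Proof.
move=> b0 b2 r0 l0; have g1 := L1_gker b0 b2 r0.
have l0' : l != 0 by rewrite gt_eqF.
rewrite [in RHS]/gsin (Rintegral_affine 0 l0' (L1_sinM xi g1)).
rewrite /gsin; under eq_Rintegral => t _.
  rewrite (_ : _ * _ = l `^ (1 - b) * (sin (xi * (l * t + 0)) * gker b r (l * t + 0))); last first.
    by rewrite gker_scale// mulrCA; congr (_ * (sin _ * _)); ring.
  over.
rewrite RintegralZl//; last exact: (L1_affine 0 l0' (L1_sinM xi g1)).
rewrite mulrA gtr0_norm// powRD; last by rewrite l0' implybT.
by rewrite powRr1 ?(ltW l0)// (mulrC l).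
Qed.

(** * Derivative of the transform along a line in the plane of [(r, xi)] *)

Section directional_derivative.
Variables b r xi r' xi' : R.
Hypotheses (b0 : 0 < b) (b1 : b <= 1) (r0 : 0 < r).

Let b_le2 : b <= 2. Proof. by rewrite (le_trans b1)// ler1n. Qed.
Let b1_gt0 : 0 < b + 1. Proof. by rewrite addr_gt0. Qed.
Let b1_le2 : b + 1 <= 2. Proof. by rewrite -[leRHS]/(1 + 1) lerD2r. Qed.

(* [e] keeps [r + x * r'] above [r / 2]. *)
Let e := r / (2 * (`|r'| + 1)).

Let e0 : 0 < e.
Proof. by rewrite divr_gt0// mulr_gt0// ltr_wpDl. Qed.

Let rx x : x \in `]- e, e[ -> r / 2 <= r + x * r'.
Proof.
rewrite in_itv/= -ltr_norml => xe.
have : `|x * r'| <= r / 2.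
  rewrite normrM; apply: (@le_trans _ _ (e * (`|r'| + 1))).
    by apply: ler_pM => //; [exact: ltW|rewrite lerDl].
  rewrite le_eqVlt; apply/orP; left; apply/eqP.
  by rewrite /e; field; rewrite gt_eqF// ltr_wpDl.
by rewrite ler_norml; set y := x * r'; lra.
Qed.

Let dcos x t : is_derive x (1 : R)
  (fun x => cos ((xi + x * xi') * t) * gker b (r + x * r') t)
  (- (xi' * sin ((xi + x * xi') * t) + r' * cos ((xi + x * xi') * t)) * (t * gker b (r + x * r') t)).
Proof.
rewrite /gker; set w := \1_ _ t * _.
by apply: is_derive_eq; rewrite /GRing.scale/=; ring.
Qed.

Let dsin x t : is_derive x (1 : R)
  (fun x => sin ((xi + x * xi') * t) * gker b (r + x * r') t)
  ((xi' * cos ((xi + x * xi') * t) - r' * sin ((xi + x * xi') * t)) * (t * gker b (r + x * r') t)).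
Proof.
rewrite /gker; set w := \1_ _ t * _.
by apply: is_derive_eq; rewrite /GRing.scale/=; ring.
Qed.

Let gker_mono c r1 r2 t : r1 <= r2 -> gker c r2 t <= gker c r1 t.
Proof.
move=> r12; have [t0|t0] := leP t 0; first by rewrite !gker_neg.
by rewrite !gker_pos// ler_wpM2l ?powR_ge0// ler_expR lerN2 ler_wpM2r// ltW.
Qed.

(** Majorant of the differentiated integrand for all [x] in []- e, e[]: there [r + x * r'] is at
    least [r / 2], and [gker] decreases in its rate. *)
Let G t := (`|xi'| + `|r'|) * gker (b + 1) (r / 2) t.

Let G1 : L1 G.
Proof.
have h3 : 0 < r / 2 by rewrite divr_gt0.
exact: L1Z (L1_gker b1_gt0 b1_le2 h3).
Qed.

Let G0 t : 0 <= G t.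
Proof. by rewrite /G mulr_ge0 ?addr_ge0// gker_ge0. Qed.

(* [T] stands for either of [cos] and [sin]. *)
Let derive_under (T D : R -> R -> R) :
  (forall x, L1 (fun t => gker b (r + x * r') t) -> L1 (T x)) ->
  (forall x t, is_derive x (1 : R) (T ^~ t) (D x t * (t * gker b (r + x * r') t))) ->
  (forall x t, `|D x t| <= `|xi'| + `|r'|) ->
  is_derive (0 : R) (1 : R) (fun x => \int[mu]_t T x t)
    (\int[mu]_t (D 0 t * (t * gker b (r + 0 * r') t))).
Proof.
move=> T1 dT DG.
have int x : `]- e, e[%classic x -> mu.-integrable setT (EFin \o T x).
  move=> /rx rxx; apply: T1; apply: L1_gker => //.
  by apply: lt_le_trans rxx; rewrite divr_gt0.
have der x t : `]- e, e[%classic x -> [set: R] t -> derivable (T ^~ t) x 1.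
  by move=> _ _; case: (dT x t).
have dE x t : partial1of2 T x t = D x t * (t * gker b (r + x * r') t).
  by rewrite partial1of2E; case: (dT x t).
have ub x t : `]- e, e[%classic x -> [set: R] t -> `|partial1of2 T x t| <= G t.
  move=> /rx rxx _; rewrite dE normrM gker_mulr// (ger0_norm (gker_ge0 _ _ _)).
  by apply: ler_pM => //; [exact: gker_ge0|exact: gker_mono].
have I0 : `]- e, e[%classic (0 : R) by rewrite /= in_itv/= oppr_lt0 e0.
have d := derivable_under_integral measurableT I0 int der G0 G1 ub.
have v := differentiation_under_integral measurableT I0 int der G0 G1 ub.
apply: DeriveDef => //; rewrite -derive1E v; apply: eq_Rintegral => t _.
by rewrite dE.
Qed.

(** Two directions [(r', xi')] matter: [(r, xi)], along which homogeneity gives the derivative a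
    second time, and [(0, 1)], the plain derivative in [xi]. *)
Lemma gcos_dir : is_derive (0 : R) (1 : R) (fun x => gcos b (r + x * r') (xi + x * xi'))
  (- (xi' * gsin (b + 1) r xi + r' * gcos (b + 1) r xi)).
Proof.
have g1 : L1 (gker (b + 1) r) by apply: L1_gker.
have s1 := L1_sinM xi g1; have c1 := L1_cosM xi g1.
have := @derive_under (fun x t => cos ((xi + x * xi') * t) * gker b (r + x * r') t) _ _ dcos.
have -> : \int[mu]_t (- (xi' * sin ((xi + 0 * xi') * t) + r' * cos ((xi + 0 * xi') * t)) *
     (t * gker b (r + 0 * r') t)) = - (xi' * gsin (b + 1) r xi + r' * gcos (b + 1) r xi).
  rewrite /gsin /gcos -!RintegralZl// -RintegralD//; [|exact: L1Z|exact: L1Z].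
  rewrite -[RHS]mulN1r -RintegralZl//; last by apply: L1D; exact: L1Z.
  by apply: eq_Rintegral => t _; rewrite gker_mulr// !mul0r !addr0; ring.
apply; first by move=> x; exact: L1_cosM.
move=> x t; rewrite normrN; apply: le_trans (ler_normD _ _) _.
by apply: lerD; rewrite normrM ler_piMr// ?sin_max ?cos_max.
Qed.

Lemma gsin_dir : is_derive (0 : R) (1 : R) (fun x => gsin b (r + x * r') (xi + x * xi'))
  (xi' * gcos (b + 1) r xi - r' * gsin (b + 1) r xi).
Proof.
have g1 : L1 (gker (b + 1) r) by apply: L1_gker.
have s1 := L1_sinM xi g1; have c1 := L1_cosM xi g1.
have := @derive_under (fun x t => sin ((xi + x * xi') * t) * gker b (r + x * r') t) _ _ dsin.
have -> : \int[mu]_t ((xi' * cos ((xi + 0 * xi') * t) - r' * sin ((xi + 0 * xi') * t)) *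
     (t * gker b (r + 0 * r') t)) = xi' * gcos (b + 1) r xi - r' * gsin (b + 1) r xi.
  rewrite /gsin /gcos -!RintegralZl// -RintegralB//; [|exact: L1Z|exact: L1Z].
  by apply: eq_Rintegral => t _; rewrite gker_mulr// !mul0r !addr0; ring.
apply; first by move=> x; exact: L1_sinM.
move=> x t; apply: le_trans (ler_normB _ _) _.
by apply: lerD; rewrite normrM ler_piMr// ?sin_max ?cos_max.
Qed.

End directional_derivative.

Section gamma_transform.
Variables b r : R.
Hypotheses (b0 : 0 < b) (b1 : b <= 1) (r0 : 0 < r).

Let b_le2 : b <= 2. Proof. by rewrite (le_trans b1)// ler1n. Qed.

Let scale_derive (F : R -> R) c d : (forall x, -1 < x -> F x = (1 + x) `^ (- b) * c) ->
  is_derive (0 : R) (1 : R) F d -> d = - b * c.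
Proof.
move=> FE [dF <-].
have p : 0 < 1 + 0 :> R by rewrite addr0.
have dp : is_derive (0 : R) (1 : R) (fun x => (1 + x) `^ (- b) * c) (- b * c).
  have h : is_derive (0 : R) (1 : R) (fun x => (1 + x)) 1.
    by apply: is_derive_eq; rewrite add0r mulr1.
  have h2 : is_derive (0 : R) (1 : R) (fun x => (1 + x) `^ (- b)) (- b * (1 + 0) `^ (- b - 1)).
    have := @is_derive1_comp _ _ (fun x => 1 + x) 0 _ _ (is_derive1_powR (- b) p) h.
    by rewrite /GRing.scale/= mulr1.
  by apply: is_derive_eq; rewrite /GRing.scale/= addr0 powR1; ring.
rewrite (@near_eq_derive _ _ _ F (fun x : R => (1 + x) `^ (- b) * c)).
- by case: dp.
near=> x; apply: FE; near: x; apply: lt_nbhsr; by rewrite oppr_lt0.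
Unshelve. all: by end_near. Qed.

(** With [g_b = gcos b - i gsin b], this and [gsin_euler] are the two parts of
    [b g_b = (r + i xi) g_(b + 1)]. *)
Lemma gcos_euler xi : b * gcos b r xi = xi * gsin (b + 1) r xi + r * gcos (b + 1) r xi.
Proof.
have := scale_derive _ (gcos_dir xi r xi b0 b1 r0) => /(_ (gcos b r xi)) h.
apply: oppr_inj; rewrite h ?mulNr// => x x1.
have x1' : 0 < 1 + x by rewrite -subr_gt0 opprK addrC in x1.
rewrite -(gcos_scale xi b0 b_le2 r0 x1').
have -> : (1 + x) * r = r + x * r by ring.
by have -> : (1 + x) * xi = xi + x * xi by ring.
Qed.

Lemma gsin_euler xi : b * gsin b r xi = r * gsin (b + 1) r xi - xi * gcos (b + 1) r xi.
Proof.
have := scale_derive _ (gsin_dir xi r xi b0 b1 r0) => /(_ (gsin b r xi)) h.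
apply: oppr_inj; rewrite opprB h ?mulNr// => x x1.
have x1' : 0 < 1 + x by rewrite -subr_gt0 opprK addrC in x1.
rewrite -(gsin_scale xi b0 b_le2 r0 x1').
have -> : (1 + x) * r = r + x * r by ring.
by have -> : (1 + x) * xi = xi + x * xi by ring.
Qed.

End gamma_transform.

End gamma_kernel.

(** * The transform of the kernel in closed form *)

Section gamma_transform_formula.
Context {R : realType}.
Local Notation mu := (@lebesgue_measure R).
Variables b r : R.
Hypotheses (b0 : 0 < b) (b1 : b <= 1) (r0 : 0 < r).

Let is_derive_shift (f : R -> R) (x d : R) :
  is_derive (0 : R) (1 : R) (fun y => f (x + y)) d -> is_derive x (1 : R) f d.
Proof.
move=> fd.
have h : is_derive x (1 : R) (fun y => y - x) 1 by apply: is_derive_eq; rewrite subr0.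
have fd' : is_derive (x - x) (1 : R) (fun y => f (x + y)) d by rewrite subrr.
have := @is_derive1_comp _ _ (fun y => y - x) x _ _ fd' h.
rewrite /GRing.scale/= mulr1; congr (is_derive _ _ _ _).
by apply/funext => y /=; rewrite addrC subrK.
Qed.

Let dA x : is_derive x (1 : R) (gcos b r) (- gsin (b + 1) r x).
Proof.
apply: is_derive_shift; have := gcos_dir x 0 1 b0 b1 r0.
have -> : (fun y => gcos b (r + y * 0) (x + y * 1)) = (fun y => gcos b r (x + y)).
  by apply/funext => y; rewrite mulr0 addr0 mulr1.
by rewrite mul1r mul0r addr0.
Qed.

Let dB x : is_derive x (1 : R) (gsin b r) (gcos (b + 1) r x).
Proof.
apply: is_derive_shift; have := gsin_dir x 0 1 b0 b1 r0.
have -> : (fun y => gsin b (r + y * 0) (x + y * 1)) = (fun y => gsin b r (x + y)).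
  by apply/funext => y; rewrite mulr0 addr0 mulr1.
by rewrite mul1r mul0r subr0.
Qed.

Let D x := x ^+ 2 + r ^+ 2.
Let D0 x : 0 < D x. Proof. by rewrite ltr_wpDl ?sqr_ge0 ?exprn_gt0. Qed.
Let m x := D x `^ (b / 2).
Let th x := b * atan (x / r).

Let dm x : is_derive x (1 : R) m (b * x * D x `^ (b / 2 - 1)).
Proof.
have dD : is_derive x (1 : R) D (2 * x).
  by apply: is_derive_eq; rewrite /GRing.scale/=; ring.
have := @is_derive1_comp _ _ D x _ _ (is_derive1_powR (b / 2) (D0 x)) dD.
by rewrite /GRing.scale/=; congr (is_derive _ _ _ _); field.
Qed.

Let mE x : m x = D x * D x `^ (b / 2 - 1).
Proof. by rewrite mulr_powRB1 ?(ltW (D0 x))// divr_gt0. Qed.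

Let dth x : is_derive x (1 : R) th (b * r / D x).
Proof.
have h : is_derive x (1 : R) (fun y => y / r) r^-1.
  by apply: is_derive_eq; rewrite /GRing.scale/=; ring.
have := is_deriveZ b (@is_derive1_comp _ _ (fun y => y / r) x _ _ (is_derive1_atan (x / r)) h).
rewrite /GRing.scale/=; congr (is_derive _ _ _ _).
by rewrite /D; field; rewrite (gt_eqF r0) andbT gt_eqF //; exact: D0.
Qed.

(** [X + i Y] is [(r + i x)^b * (gcos b r x - i gsin b r x)], the power having modulus [m] and
    argument [th]. *)
Let X x := m x * (cos (th x) * gcos b r x + sin (th x) * gsin b r x).
Let Y x := m x * (sin (th x) * gcos b r x - cos (th x) * gsin b r x).

(** With [z = r + i x], the derivative of [z^b g_b] is [i z^(b - 1) (b g_b - z g_(b + 1))], which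
    vanishes by the Euler relations. *)
Let dX x : is_derive x (1 : R) X 0.
Proof.
have := dA x; have := dB x; have := dm x; have := dth x => ? ? ? ?.
have dc : is_derive x (1 : R) (fun x => cos (th x)) (- sin (th x) * (b * r / D x)).
  exact: is_derive1_comp.
have ds : is_derive x (1 : R) (fun x => sin (th x)) (cos (th x) * (b * r / D x)).
  exact: is_derive1_comp.
apply: is_derive_eq; rewrite /GRing.scale/= mE.
have E1 := gcos_euler b0 b1 r0 x; have E2 := gsin_euler b0 b1 r0 x.
set w := D x `^ _; set c := cos _; set s := sin _.
set A1 := gcos (b + 1) r x in E1 E2 *; set B1 := gsin (b + 1) r x in E1 E2 *.
transitivity (w * (c * (x * (b * gcos b r x) + r * (b * gsin b r x) - D x * B1) +
  s * (x * (b * gsin b r x) - r * (b * gcos b r x) + D x * A1))).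
  by field; rewrite gt_eqF.
by rewrite E1 E2 /D; ring.
Qed.

Let dY x : is_derive x (1 : R) Y 0.
Proof.
have := dA x; have := dB x; have := dm x; have := dth x => ? ? ? ?.
have dc : is_derive x (1 : R) (fun x => cos (th x)) (- sin (th x) * (b * r / D x)).
  exact: is_derive1_comp.
have ds : is_derive x (1 : R) (fun x => sin (th x)) (cos (th x) * (b * r / D x)).
  exact: is_derive1_comp.
apply: is_derive_eq; rewrite /GRing.scale/= mE.
have E1 := gcos_euler b0 b1 r0 x; have E2 := gsin_euler b0 b1 r0 x.
set w := D x `^ _; set c := cos _; set s := sin _.
set A1 := gcos (b + 1) r x in E1 E2 *; set B1 := gsin (b + 1) r x in E1 E2 *.
transitivity (w * (s * (x * (b * gcos b r x) + r * (b * gsin b r x) - D x * B1) -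
  c * (x * (b * gsin b r x) - r * (b * gcos b r x) + D x * A1))).
  by field; rewrite gt_eqF.
by rewrite E1 E2 /D; ring.
Qed.

Let m0E : m 0 = r `^ b.
Proof.
rewrite /m /D expr0n/= add0r -powR_mulrn ?(ltW r0)// -powRrM; congr (_ `^ _).
by field.
Qed.

Lemma gsin0 : gsin b r 0 = 0.
Proof.
rewrite /gsin; under eq_Rintegral do rewrite mul0r sin0 mul0r.
by rewrite Rintegral_cst// mul0r.
Qed.

Lemma gcos0 : gcos b r 0 = \int[mu]_t gker b r t.
Proof. by apply: eq_Rintegral => t _; rewrite mul0r cos0 mul1r. Qed.

(** On []0, 1]] the power is at least 1, as [b <= 1], and the exponential is at least
    [expR (- r)]. *)
Lemma gcos0_gt0 : 0 < gcos b r 0.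
Proof.
rewrite gcos0.
have m01 : mu `]0%R, 1%R]%classic = 1%E by rewrite lebesgue_measure_itv/= lte_fin ltr01 oppr0 adde0.
have i01 : L1 (\1_`]0%R, 1%R]%classic : R -> R).
  exact: (integrable_indic_itv 0 1 false false).
apply: (@lt_le_trans _ _ (\int[mu]_x (expR (- r) * \1_`]0%R, 1%R]%classic x))).
  rewrite RintegralZl// mulr_gt0 ?expR_gt0//.
  rewrite /Rintegral integral_indic// setIT.
  by rewrite [X in fine X]m01.
apply: le_Rintegral => //.
- exact: L1Z.
- by apply: L1_gker => //; rewrite (le_trans b1)// ler1n.
move=> x _; rewrite indicE; have [x01|_] := boolP (x \in _); last by rewrite mulr0 gker_ge0.
move: x01; rewrite inE/= in_itv/= mulr1 => /andP[x0 x1].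
rewrite gker_pos// -[leLHS]mul1r; apply: ler_pM => //.
  by rewrite -[leLHS](powRr0 x) ger_powR ?x0//= subr_le0.
by rewrite ler_expR lerN2 ler_piMr// ltW.
Qed.

Definition gamma_norm : R := r `^ b * gcos b r 0.

Lemma gamma_norm_gt0 : 0 < gamma_norm.
Proof. by rewrite mulr_gt0 ?powR_gt0// gcos0_gt0. Qed.

(* [gcos - i gsin = gamma_norm * (r + i x)^(- b)], with the principal power in polar form. *)
Lemma gamma_transform x :
  (x ^+ 2 + r ^+ 2) `^ (b / 2) * gcos b r x = gamma_norm * cos (b * atan (x / r)) /\
  (x ^+ 2 + r ^+ 2) `^ (b / 2) * gsin b r x = gamma_norm * sin (b * atan (x / r)).
Proof.
have th0 : th 0 = 0 by rewrite /th mul0r atan0 mulr0.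
have XE : X x = gamma_norm.
  rewrite (is_derive_0_is_cst x 0 dX) /X m0E th0 cos0 sin0.
  by rewrite /gamma_norm; ring.
have YE : Y x = 0.
  by rewrite (is_derive_0_is_cst x 0 dY) /Y th0 cos0 sin0 gsin0; ring.
have cs := cos2Dsin2 (th x).
rewrite -/(D x) -/(m x) -/(th x).
split.
  transitivity (cos (th x) * X x + sin (th x) * Y x); last by rewrite XE YE; ring.
  rewrite /X /Y -[LHS]mulr1 -cs; ring.
transitivity (sin (th x) * X x - cos (th x) * Y x); last by rewrite XE YE; ring.
rewrite /X /Y -[LHS]mulr1 -cs; ring.
Qed.

(* [gamma_norm] is [Gamma(b)], so this is [e^(- r t) t^(b - 1) / Gamma(b)] for [t > 0]. *)
Definition frac_kernel (t : R) : R := gamma_norm^-1 * gker b r t.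

Lemma frac_kernel_ge0 t : 0 <= frac_kernel t.
Proof. by rewrite mulr_ge0 ?gker_ge0// invr_ge0 ltW// gamma_norm_gt0. Qed.

Lemma frac_kernel_neg t : t <= 0 -> frac_kernel t = 0.
Proof. by move=> t0; rewrite /frac_kernel gker_neg// mulr0. Qed.

Let g1 : L1 (gker b r).
Proof. by apply: L1_gker => //; rewrite (le_trans b1)// ler1n. Qed.

Lemma L1_frac_kernel : L1 frac_kernel. Proof. exact: L1Z. Qed.

Lemma int_frac_kernel : \int[mu]_t frac_kernel t = (r `^ b)^-1.
Proof.
rewrite RintegralZl// -gcos0 /gamma_norm invfM -mulrA mulVf ?mulr1//.
by rewrite gt_eqF// gcos0_gt0.
Qed.

Lemma cosT_frac_kernel x :
  cosT frac_kernel x = cos (b * atan (x / r)) / (x ^+ 2 + r ^+ 2) `^ (b / 2).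
Proof.
have [h _] := gamma_transform x; have N0 := gamma_norm_gt0.
have p : 0 < (x ^+ 2 + r ^+ 2) `^ (b / 2) by apply: powR_gt0; exact: (D0 x).
apply: (mulfI (lt0r_neq0 p)); rewrite [RHS]mulrC divfK ?gt_eqF//.
apply: (mulfI (lt0r_neq0 N0)); rewrite -h.
rewrite /cosT; under eq_Rintegral do rewrite mulrCA.
rewrite RintegralZl//; last exact: L1_cosM.
by rewrite mulrCA (mulrA gamma_norm) mulfV ?mul1r// gt_eqF.
Qed.

Lemma sinT_frac_kernel x :
  sinT frac_kernel x = sin (b * atan (x / r)) / (x ^+ 2 + r ^+ 2) `^ (b / 2).
Proof.
have [_ h] := gamma_transform x; have N0 := gamma_norm_gt0.
have p : 0 < (x ^+ 2 + r ^+ 2) `^ (b / 2) by apply: powR_gt0; exact: (D0 x).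
apply: (mulfI (lt0r_neq0 p)); rewrite [RHS]mulrC divfK ?gt_eqF//.
apply: (mulfI (lt0r_neq0 N0)); rewrite -h.
rewrite /sinT; under eq_Rintegral do rewrite mulrCA.
rewrite RintegralZl//; last exact: L1_sinM.
by rewrite mulrCA (mulrA gamma_norm) mulfV ?mul1r// gt_eqF.
Qed.

End gamma_transform_formula.

(** * Superposition operators *)

Section superposition.
Context {R : realType}.
Local Notation C := (complex R).
Variable n : nat.
Implicit Types y z w : 'I_n -> C.

Lemma ReB (a b : C) : complex.Re (a - b) = complex.Re a - complex.Re b.
Proof. by case: a; case: b. Qed.

Lemma ImB (a b : C) : complex.Im (a - b) = complex.Im a - complex.Im b.
Proof. by case: a; case: b. Qed.

Lemma cvnorm2_ge0 z : 0 <= cvnorm2 z.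
Proof. by apply: sumr_ge0 => i _; rewrite addr_ge0 ?sqr_ge0. Qed.

Lemma cvnorm_sqr z : cvnorm z ^+ 2 = cvnorm2 z.
Proof. by rewrite sqr_sqrtr// cvnorm2_ge0. Qed.

Lemma cvnorm2_subC y z : cvnorm2 (cvsub y z) = cvnorm2 (cvsub z y).
Proof.
by apply: eq_bigr => i _; rewrite /cvsub !ReB !ImB -sqrrN opprB -[X in _ + X]sqrrN opprB.
Qed.

Lemma normRe_le y z i : `|complex.Re (y i) - complex.Re (z i)| <= cvnorm (cvsub y z).
Proof.
rewrite -sqrtr_sqr ler_wsqrtr// /cvnorm2 (bigD1 i)//= ReB -addrA lerDl.
by rewrite addr_ge0 ?sqr_ge0// sumr_ge0// => j _; rewrite addr_ge0 ?sqr_ge0.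
Qed.

Lemma normIm_le y z i : `|complex.Im (y i) - complex.Im (z i)| <= cvnorm (cvsub y z).
Proof.
rewrite -sqrtr_sqr ler_wsqrtr// /cvnorm2 (bigD1 i)//= ImB.
rewrite [X in _ <= X + _]addrC -addrA lerDl.
by rewrite addr_ge0 ?sqr_ge0// sumr_ge0// => j _; rewrite addr_ge0 ?sqr_ge0.
Qed.

Let ratv := {ffun 'I_n -> rat * rat}.
Let toC (q : ratv) : 'I_n -> C := fun i => Complex (ratr (q i).1) (ratr (q i).2).

Let ratv_dense y (e : R) : 0 < e -> exists q, cvnorm (cvsub y (toC q)) < e.
Proof.
move=> e0; have n0 : 0 < (2 * n.+1)%:R :> R by rewrite ltr0n.
(* The [2 * n] real coordinates are each approximated within [d], and [2 * n * d ^+ 2] is below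
   [e ^+ 2]; the successor covers [n = 0]. *)
pose d := e / (2 * n.+1)%:R.
have d0 : 0 < d by rewrite divr_gt0.
have eE : e = d * (2 * n.+1)%:R by rewrite /d divfK// gt_eqF.
clearbody d.
have ap (x : R) : exists q : rat, (x - ratr q) ^+ 2 <= d ^+ 2.
  have [q] : exists q, ratr q \in `]x - d, x + d[ by apply: rat_in_itvoo; lra.
  rewrite in_itv/= => /andP[q1 q2]; exists q.
  rewrite -(real_normK (num_real (x - _))) lerXn2r ?nnegrE ?(ltW d0)//.
  by rewrite ler_norml; lra.
have [q1 q1P] := choice (fun i => ap (complex.Re (y i))).
have [q2 q2P] := choice (fun i => ap (complex.Im (y i))).
exists [ffun i => (q1 i, q2 i)].
have h : cvnorm2 (cvsub y (toC [ffun i => (q1 i, q2 i)])) <= \sum_(i < n) (d ^+ 2 + d ^+ 2).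
  by apply: ler_sum => i _; rewrite /cvsub ReB ImB /toC ffunE/= lerD.
apply: (@le_lt_trans _ _ (Num.sqrt (\sum_(i < n) (d ^+ 2 + d ^+ 2)))).
  exact: ler_wsqrtr.
rewrite -[ltRHS]ger0_norm ?(ltW e0)// -sqrtr_sqr ltr_sqrt ?exprn_gt0//.
rewrite sumr_const card_ord -mulr2n -mulrnA -mulr_natr.
rewrite eE exprMn ltr_pM2l ?exprn_gt0// -natrX ltr_nat expnMn.
by rewrite (@leq_ltn_trans (2 * n.+1))// ?leq_mul2l ?leqnSn// -mulnn; nia.
Qed.

Lemma measurable_cvnorm_sub d (T : measurableType d) (D : set T) (u v : T -> 'I_n -> C) :
  (forall i, measurable_fun D (fun t => complex.Re (u t i))) ->
  (forall i, measurable_fun D (fun t => complex.Im (u t i))) ->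
  (forall i, measurable_fun D (fun t => complex.Re (v t i))) ->
  (forall i, measurable_fun D (fun t => complex.Im (v t i))) ->
  measurable_fun D (fun t => cvnorm (cvsub (u t) (v t))).
Proof.
move=> ur ui vr vi.
apply: (measurableT_comp (continuous_measurable_fun (@sqrt_continuous R))).
rewrite /cvnorm2; apply: measurable_sum => i.
under eq_fun do rewrite /cvsub ReB ImB.
by apply: measurable_funD; apply: measurable_funX; apply: measurable_funB.
Qed.

(** By the Lipschitz bound, [phi t (y t)] is the infimum over rational vectors [q] of [phi t q] plus
    [c] times the distance from [y t] to [q]. Each strict sublevel set is then a countable union of
    measurable sets. *)
Lemma measurable_superposition d (T : measurableType d) (D : set T)
    (phi : T -> ('I_n -> C) -> R) (c : R) (y : T -> 'I_n -> C) : 0 <= c ->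
  (forall z, measurable_fun D (phi ^~ z)) ->
  (forall t z w, D t -> `|phi t z - phi t w| <= c * cvnorm (cvsub z w)) ->
  (forall i, measurable_fun D (fun t => complex.Re (y t i))) ->
  (forall i, measurable_fun D (fun t => complex.Im (y t i))) ->
  measurable_fun D (fun t => phi t (y t)).
Proof.
move=> c0 mphi Lphi yr yi mD; move: (mD).
apply: (measurability _ (RGenInftyO.measurableE R)) => _ [_ [x ->] <-].
pose F (q : ratv) := D `&` (fun t => phi t (toC q) + c * cvnorm (cvsub (y t) (toC q))) @^-1` `]-oo, x[.
rewrite (_ : _ `&` _ = \bigcup_(q in setT) F q).
  apply: countable_bigcupT_measurable; first exact: countableP.
  move=> q; have mg : measurable_fun D (fun t => phi t (toC q) + c * cvnorm (cvsub (y t) (toC q))).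
    apply: measurable_funD; first exact: mphi.
    by apply: measurable_funM => //; apply: measurable_cvnorm_sub.
  by apply: mg => //; exact: measurable_itv.
apply/seteqP; split=> t /=; rewrite in_itv/=.
  move=> [Dt px]; pose g := x - phi t (y t).
  have g0 : 0 < g by rewrite subr_gt0.
  (* The distance to [q] costs the factor [c] twice, in [phi] and in the added term; the extra 1
     covers [c = 0]. *)
  have c1 : 0 < 2 * c + 1 by rewrite ltr_wpDl// mulr_ge0.
  have [q qy] := ratv_dense (y t) (divr_gt0 g0 c1).
  exists q => //; rewrite /F/= in_itv/=; split=> //.
  have := Lphi t (toC q) (y t) Dt; rewrite ler_norml => /andP[_].
  have -> : cvnorm (cvsub (toC q) (y t)) = cvnorm (cvsub (y t) (toC q)).
    by rewrite /cvnorm cvnorm2_subC.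
  set N := cvnorm _ in qy *.
  have N0 : 0 <= N by exact: sqrtr_ge0.
  have : N * (2 * c + 1) < g by rewrite -ltr_pdivlMr.
  rewrite /g mulrDr mulrCA; set cN := c * N => h1 h2.
  have : N * c = cN by rewrite mulrC.
  by move=> h3; rewrite h3 in h1; lra.
move=> [q _]; rewrite /F/= in_itv/= => -[Dt qx]; split => //.
have := Lphi t (y t) (toC q) Dt; rewrite ler_norml => /andP[_].
by move: qx; set a := c * _; lra.
Qed.

End superposition.

(** * Vector-valued functions and the fractional integral *)

Section fourier_laplace.
Context {R : realType}.
Local Notation C := (complex R).
Local Notation mu := (@lebesgue_measure R).
Variable n : nat.
Implicit Types (u v g : R -> 'I_n -> C) (rho : R).

(** Multiplication by [expR (- (rho * t))] maps the weighted space isometrically to [L^2]; with real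
    and imaginary parts separated, the real transforms apply. *)
Definition wre rho u i (t : R) : R := expR (- (rho * t)) * complex.Re (u t i).
Definition wim rho u i (t : R) : R := expR (- (rho * t)) * complex.Im (u t i).

Lemma measurable_expRN rho : measurable_fun setT (fun t : R => expR (- (rho * t))).
Proof. by apply: measurableT_comp => //; apply: measurableT_comp => //. Qed.

Lemma cmeasurableP rho u : cmeasurable setT u <->
  forall i, measurable_fun setT (wre rho u i) /\ measurable_fun setT (wim rho u i).
Proof.
split=> mu_ i; have [mr mi] := mu_ i.
  by split; apply: measurable_funM => //; exact: measurable_expRN.
have E (h : R -> R) : (fun t => h t) = (fun t => expR (- (- rho * t)) * (expR (- (rho * t)) * h t)).
  by apply/funext => t; rewrite mulrA -expRD mulNr opprK subrr expR0 mul1r.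
split; rewrite E; apply: measurable_funM => //; exact: measurable_expRN.
Qed.

Definition nrm rho u : \bar R :=
  (\int[mu]_t (cvnorm2 (u t) * expR (- (2 * rho * t)))%:E)%E.

Lemma nrm_ge0 rho u : (0 <= nrm rho u)%E.
Proof.
by apply: integral_ge0 => t _; rewrite lee_fin mulr_ge0 ?expR_ge0// cvnorm2_ge0.
Qed.

Lemma weighted_cvnorm2 rho u t : cvnorm2 (u t) * expR (- (2 * rho * t)) =
  \sum_(i < n) (wre rho u i t ^+ 2 + wim rho u i t ^+ 2).
Proof.
rewrite mulr_suml; apply: eq_bigr => i _; rewrite /wre /wim !exprMn.
have -> : expR (- (2 * rho * t)) = expR (- (rho * t)) ^+ 2.
  by rewrite expr2 -expRD; congr expR; ring.
by ring.
Qed.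

Lemma nrmE rho u : cmeasurable setT u ->
  nrm rho u = (\sum_(i < n) (sqint (wre rho u i) + sqint (wim rho u i)))%E.
Proof.
move=> /(cmeasurableP rho) mu_; rewrite /nrm.
under eq_integral do rewrite weighted_cvnorm2 -sumEFin.
rewrite ge0_integral_sum//; last 2 first.
- move=> i; have [mr mi] := mu_ i; apply/measurable_EFinP.
  by apply: measurable_funD; exact: measurable_funX.
- by move=> i t _; rewrite lee_fin addr_ge0// sqr_ge0.
apply: eq_bigr => i _; have [mr mi] := mu_ i.
under eq_integral do rewrite EFinD.
rewrite ge0_integralD//.
- by move=> t _; rewrite lee_fin sqr_ge0.
- exact: measurable_sqr.
- by move=> t _; rewrite lee_fin sqr_ge0.
- exact: measurable_sqr.
Qed.

Lemma L2rhoP rho u : L2rho rho u <-> forall i, L2 (wre rho u i) /\ L2 (wim rho u i).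
Proof.
split=> [[mu_ uoo] i|u2].
  have [mr mi] := (cmeasurableP rho u).1 mu_ i.
  have : (sqint (wre rho u i) + sqint (wim rho u i) < +oo)%E.
    apply: le_lt_trans uoo; rewrite -/(nrm rho u) nrmE// (bigD1 i)//= leeDl//.
    by apply: sume_ge0 => j _; apply: adde_ge0; exact: sqint_ge0.
  by move=> h; split; split=> //; apply: le_lt_trans h;
    [apply: leeDl|apply: leeDr]; exact: sqint_ge0.
have mu_ : cmeasurable setT u.
  by apply/(cmeasurableP rho) => i; have [[? _] [? _]] := u2 i.
split=> //; rewrite -/(nrm rho u) nrmE//; apply: lte_sum_pinfty => i _.
by have [[_ ?] [_ ?]] := u2 i; exact: lte_add_pinfty.
Qed.

Lemma nrm_lty rho u : L2rho rho u -> (nrm rho u < +oo)%E. Proof. by case. Qed.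

Lemma wre0 u i : wre 0 u i = fun t => complex.Re (u t i).
Proof. by apply/funext => t; rewrite /wre mul0r oppr0 expR0 mul1r. Qed.

Lemma wim0 u i : wim 0 u i = fun t => complex.Im (u t i).
Proof. by apply/funext => t; rewrite /wim mul0r oppr0 expR0 mul1r. Qed.

Lemma wreB rho u v i t :
  wre rho (fun t => cvsub (u t) (v t)) i t = wre rho u i t - wre rho v i t.
Proof. by rewrite /wre /cvsub ReB mulrBr. Qed.

Lemma wimB rho u v i t :
  wim rho (fun t => cvsub (u t) (v t)) i t = wim rho u i t - wim rho v i t.
Proof. by rewrite /wim /cvsub ImB mulrBr. Qed.

Lemma L2rhoB rho u v : L2rho rho u -> L2rho rho v -> L2rho rho (fun t => cvsub (u t) (v t)).
Proof.
move=> /L2rhoP u2 /L2rhoP v2; apply/L2rhoP => i; have [ur ui] := u2 i; have [vr vi] := v2 i.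
by rewrite (funext (wreB rho u v i)) (funext (wimB rho u v i)); split; exact: L2B.
Qed.

Lemma nrm_subC rho u v :
  nrm rho (fun t => cvsub (u t) (v t)) = nrm rho (fun t => cvsub (v t) (u t)).
Proof. by apply: eq_integral => t _; rewrite cvnorm2_subC. Qed.

Let lee2D (a1 a2 b1 b2 c1 c2 : \bar R) : (0 <= b1)%E -> (0 <= b2)%E ->
  (0 <= c1)%E -> (0 <= c2)%E ->
  (a1 <= 2%:E * b1 + 2%:E * c1)%E -> (a2 <= 2%:E * b2 + 2%:E * c2)%E ->
  (a1 + a2 <= 2%:E * (b1 + b2) + 2%:E * (c1 + c2))%E.
Proof.
by move=> ? ? ? ? h1 h2; rewrite !ge0_muleDr// addeACA; exact: leeD.
Qed.

Let combine4 (c : R) (a1 a2 a3 a4 : \bar R) : (0 <= a1)%E -> (0 <= a2)%E ->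
  (0 <= a3)%E -> (0 <= a4)%E ->
  (c%:E * (2%:E * a1 + 2%:E * a2) + c%:E * (2%:E * a3 + 2%:E * a4) =
   (2 * c)%:E * ((a1 + a4) + (a3 + a2)))%E.
Proof.
move=> p1 p2 p3 p4.
rewrite -[(2%:E * a1 + _)%E]ge0_muleDr// -[(2%:E * a3 + _)%E]ge0_muleDr//.
rewrite -ge0_muleDr ?mule_ge0 ?adde_ge0// -ge0_muleDr ?adde_ge0//.
by rewrite muleA -EFinM mulrC (addeC a3 a4) addeACA (addeC a2 a3).
Qed.

Lemma nrm_triangle rho u v w : L2rho rho u -> L2rho rho v -> L2rho rho w ->
  (nrm rho (fun t => cvsub (u t) (w t)) <=
   2%:E * nrm rho (fun t => cvsub (u t) (v t)) + 2%:E * nrm rho (fun t => cvsub (v t) (w t)))%E.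
Proof.
move=> u2 v2 w2.
have uw := L2rhoB u2 w2; have uv := L2rhoB u2 v2; have vw := L2rhoB v2 w2.
have [muw _] := uw; have [muv _] := uv; have [mvw _] := vw.
rewrite !nrmE//.
rewrite !ge0_sume_distrr; try by move=> i _; apply: adde_ge0; exact: sqint_ge0.
rewrite -big_split/=; apply: lee_sum => i _.
move/L2rhoP : uw => /(_ i)[[a1 _] [a2 _]]; move/L2rhoP : uv => /(_ i)[[b1 _] [b2 _]].
move/L2rhoP : vw => /(_ i)[[c1 _] [c2 _]].
apply: lee2D; rewrite ?sqint_ge0//; apply: sqint_le2D => // t.
  have -> : wre rho (fun t => cvsub (u t) (w t)) i t =
    wre rho (fun t => cvsub (u t) (v t)) i t + wre rho (fun t => cvsub (v t) (w t)) i t.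
    by rewrite !wreB; ring.
  exact: ler_normD.
have -> : wim rho (fun t => cvsub (u t) (w t)) i t =
  wim rho (fun t => cvsub (u t) (v t)) i t + wim rho (fun t => cvsub (v t) (w t)) i t.
  by rewrite !wimB; ring.
exact: ler_normD.
Qed.

Lemma nrm_eq0 rho u v : L2rho rho u -> L2rho rho v ->
  nrm rho (fun t => cvsub (u t) (v t)) = 0%E -> {ae mu, forall t, u t = v t}.
Proof.
move=> u2 v2 uv0; have uv := L2rhoB u2 v2; have [/(cmeasurableP rho) muv _] := uv.
have muvt : measurable_fun setT (fun t =>
    (cvnorm2 (cvsub (u t) (v t)) * expR (- (2 * rho * t)))%:E).
  under eq_fun do rewrite (weighted_cvnorm2 rho (fun t => cvsub (u t) (v t))).
  apply/measurable_EFinP; apply: measurable_sum => i; have [mr mi] := muv i.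
  by apply: measurable_funD; exact: measurable_funX.
have /(ae_eq_integral_abs mu measurableT muvt) :
    (\int[mu]_t `|(cvnorm2 (cvsub (u t) (v t)) * expR (- (2 * rho * t)))%:E| = 0)%E.
  rewrite -uv0; apply: eq_integral => t _.
  by rewrite gee0_abs// lee_fin mulr_ge0 ?expR_ge0// cvnorm2_ge0.
apply: ae_imp => t /(_ I) /= [] /eqP; rewrite mulf_eq0 (gt_eqF (expR_gt0 _)) orbF.
rewrite psumr_eq0; last by move=> i _; rewrite addr_ge0 ?sqr_ge0.
move=> /allP uvt; apply/funext => i.
have := uvt i (mem_index_enum i); rewrite /= paddr_eq0 ?sqr_ge0// !sqrf_eq0 /cvsub ReB ImB.
rewrite !subr_eq0 => /andP[/eqP hr /eqP hi].
by move: hr hi; case: (u t i) => a b; case: (v t i) => a' b' /= -> ->.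
Qed.

Lemma L2rho_aeeq rho u v i : {ae mu, forall t, u t = v t} ->
  {ae mu, forall t, wre rho u i t = wre rho v i t} /\
  {ae mu, forall t, wim rho u i t = wim rho v i t}.
Proof. by move=> uv; split; move: uv; apply: ae_imp => t; rewrite /wre /wim => ->. Qed.

Lemma nrm_of_aeeq rho u v : cmeasurable setT u -> cmeasurable setT v ->
  {ae mu, forall t, u t = v t} -> nrm rho u = nrm rho v.
Proof.
move=> mu_ mv uv; rewrite !nrmE//; apply: eq_bigr => i _.
move/(cmeasurableP rho) : mu_ => /(_ i)[a b]; move/(cmeasurableP rho) : mv => /(_ i)[c d].
by have [h1 h2] := L2rho_aeeq rho i uv; congr (_ + _)%E; exact: sqint_aeeq.
Qed.

Let N : R := (Num.sqrt (2 * pi))^-1.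

Let N0 : N != 0.
Proof. by rewrite invr_eq0 sqrtr_eq0 -ltNge mulr_gt0// pi_gt0. Qed.

(** [e^(- i xi t) (a + i b)] has real part [cos * a + sin * b] and imaginary part
    [cos * b - sin * a], evaluated at [xi * t]. *)
Definition FLre rho u r i xi : R :=
  N * (cosT (trunc r (wre rho u i)) xi + sinT (trunc r (wim rho u i)) xi).
Definition FLim rho u r i xi : R :=
  N * (cosT (trunc r (wim rho u i)) xi - sinT (trunc r (wre rho u i)) xi).

Lemma FLtruncE rho u r xi i : L2rho rho u ->
  FLtrunc rho u r xi i = Complex (FLre rho u r i xi) (FLim rho u r i xi).
Proof.
move=> /L2rhoP/(_ i)[a2 b2]; rewrite /FLtrunc /cint.
set a := wre rho u i in a2; set b := wim rho u i in b2.
have a1 := L2_trunc_L1 r a2; have b1 := L2_trunc_L1 r b2.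
have -> : \int[mu]_(t in `[- r, r]) complex.Re (cexpFL rho xi t * u t i) =
    cosT (trunc r a) xi + sinT (trunc r b) xi.
  rewrite /cosT /sinT -RintegralD//; [|exact: L1_cosM|exact: L1_sinM].
  rewrite Rintegral_mkcond; apply: eq_Rintegral => t _.
  rewrite /trunc !patchE; case: ifP => _; last by rewrite !mulr0 addr0.
  by rewrite /a /b /wre /wim /cexpFL; case: (u t i) => x y /=; ring.
have -> : \int[mu]_(t in `[- r, r]) complex.Im (cexpFL rho xi t * u t i) =
    cosT (trunc r b) xi - sinT (trunc r a) xi.
  rewrite /cosT /sinT -RintegralB//; [|exact: L1_cosM|exact: L1_sinM].
  rewrite Rintegral_mkcond; apply: eq_Rintegral => t _.
  rewrite /trunc !patchE; case: ifP => _; last by rewrite !mulr0 subr0.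
  by rewrite /a /b /wre /wim /cexpFL; case: (u t i) => x y /=; ring.
by rewrite /FLre /FLim -/a -/b -/N; apply/eqP; rewrite eq_complex /= !mul0r subr0 addr0 !eqxx.
Qed.

Definition FLerr rho u g r : \bar R :=
  (\sum_(i < n) (sqint (fun xi => FLre rho u r i xi - complex.Re (g xi i))%R +
                 sqint (fun xi => FLim rho u r i xi - complex.Im (g xi i))%R))%E.

Lemma measurable_FLre rho u r i : L2rho rho u -> measurable_fun setT (FLre rho u r i).
Proof.
move=> /L2rhoP/(_ i)[a2 b2]; apply: measurable_funM => //; apply: measurable_funD.
  by apply: measurable_cosT; case: (L2_trunc r a2).
by apply: measurable_sinT; case: (L2_trunc r b2).
Qed.

Lemma measurable_FLim rho u r i : L2rho rho u -> measurable_fun setT (FLim rho u r i).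
Proof.
move=> /L2rhoP/(_ i)[a2 b2]; apply: measurable_funM => //; apply: measurable_funB.
  by apply: measurable_cosT; case: (L2_trunc r b2).
by apply: measurable_sinT; case: (L2_trunc r a2).
Qed.

Lemma FLerrE rho u g r : L2rho rho u -> cmeasurable setT g ->
  (\int[mu]_xi (cvnorm2 (cvsub (FLtrunc rho u r xi) (g xi)))%:E)%E = FLerr rho u g r.
Proof.
move=> u2 mg; pose d xi := cvsub (FLtrunc rho u r xi) (g xi).
have dr i : wre 0 d i = fun xi => FLre rho u r i xi - complex.Re (g xi i).
  by rewrite wre0; apply/funext => xi; rewrite /d /cvsub ReB FLtruncE.
have di i : wim 0 d i = fun xi => FLim rho u r i xi - complex.Im (g xi i).
  by rewrite wim0; apply/funext => xi; rewrite /d /cvsub ImB FLtruncE.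
transitivity (nrm 0 d).
  by apply: eq_integral => xi _; rewrite mulr0 mul0r oppr0 expR0 mulr1.
rewrite nrmE; first by apply: eq_bigr => i _; rewrite dr di.
apply/(cmeasurableP 0) => i; have [mgr mgi] := mg i; rewrite dr di.
split; apply: measurable_funB => //; [exact: measurable_FLre|exact: measurable_FLim].
Qed.

Lemma FLerr_ge0 rho u g r : (0 <= FLerr rho u g r)%E.
Proof. by apply: sume_ge0 => i _; apply: adde_ge0; exact: sqint_ge0. Qed.

Lemma is_FLP rho u g : is_FL rho u g <->
  [/\ L2rho rho u, L2rho 0 g & vanish (FLerr rho u g)].
Proof.
have E (u2 : L2rho rho u) (g2 : L2rho 0 g) := funext (fun r => @FLerrE rho u g r u2 g2.1).
split=> [[u2 [g2 ug]]|[u2 g2 ug]].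
  by split=> //; apply/vanish_cvg; [exact: FLerr_ge0|rewrite -(E u2 g2)].
split=> //; split=> //; rewrite (E u2 g2).
by apply/vanish_cvg => //; exact: FLerr_ge0.
Qed.

Lemma is_FL_aeeq rho u g h : is_FL rho u g -> L2rho 0 h ->
  (forall i, {ae mu, forall xi, complex.Re (g xi i) = complex.Re (h xi i)}) ->
  (forall i, {ae mu, forall xi, complex.Im (g xi i) = complex.Im (h xi i)}) ->
  is_FL rho u h.
Proof.
move=> /is_FLP[u2 g2 ug] h2 ghr ghi; apply/is_FLP; split=> //.
apply: (vanish_le ug) => r; apply: lee_sum => i _.
have [mgr mgi] := g2.1 i; have [mhr mhi] := h2.1 i.
have mr := measurable_FLre r i u2; have mi := measurable_FLim r i u2.
rewrite le_eqVlt; apply/orP; left; apply/eqP; congr (_ + _)%E; apply: sqint_aeeq;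
  try exact: measurable_funB.
- by move: (ghr i); apply: ae_imp => xi ->.
- by move: (ghi i); apply: ae_imp => xi ->.
Qed.

Lemma vanish_sum (F : 'I_n -> R -> \bar R) : (forall i, vanish (F i)) ->
  vanish (fun r => \sum_(i < n) F i r)%E.
Proof.
move=> vF; elim: (index_enum _) => [|i s IH].
  by move=> e e0; exists 0 => r _; rewrite big_nil lee_fin ltW.
by under eq_fun do rewrite big_cons; exact: vanishD.
Qed.

Lemma is_FL_of_transform rho u (p q p' q' : 'I_n -> R -> R) :
  (forall i, is_transform (wre rho u i) (p i) (q i)) ->
  (forall i, is_transform (wim rho u i) (p' i) (q' i)) ->
  is_FL rho u (fun xi i => Complex (N * (p i xi + q' i xi)) (N * (p' i xi - q i xi))).
Proof.
move=> ta tb; apply/is_FLP.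
have u2 : L2rho rho u by apply/L2rhoP => i; case: (ta i); case: (tb i).
split; first exact: u2.
  apply/L2rhoP => i; rewrite wre0 wim0 /=; have [_ p2 q2 _] := ta i.
  by have [_ p'2 q'2 _] := tb i; split; apply: L2Z; [exact: L2D|exact: L2B].
apply: vanish_sum => i; have [a2 p2 q2 va] := ta i; have [b2 p'2 q'2 vb] := tb i.
apply: (@vanish_le _ (fun r => (2 * N ^+ 2)%:E *
  ((sqint (fun xi => cosT (trunc r (wre rho u i)) xi - p i xi)%R +
    sqint (fun xi => sinT (trunc r (wre rho u i)) xi - q i xi)%R) +
   (sqint (fun xi => cosT (trunc r (wim rho u i)) xi - p' i xi)%R +
    sqint (fun xi => sinT (trunc r (wim rho u i)) xi - q' i xi)%R)))%E).
  by apply: vanishZ; [rewrite mulr_ge0 ?sqr_ge0|exact: vanishD].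
move=> r.
have a1r := L2_trunc_L1 r a2; have a2r := L2_trunc r a2.
have b1r := L2_trunc_L1 r b2; have b2r := L2_trunc r b2.
have Ca := (L2B (L2_cosT a1r a2r) p2).1; have Sa := (L2B (L2_sinT a1r a2r) q2).1.
have Cb := (L2B (L2_cosT b1r b2r) p'2).1; have Sb := (L2B (L2_sinT b1r b2r) q'2).1.
set ca := sqint (fun xi => cosT (trunc r (wre rho u i)) xi - p i xi).
set sa := sqint (fun xi => sinT (trunc r (wre rho u i)) xi - q i xi).
set cb := sqint (fun xi => cosT (trunc r (wim rho u i)) xi - p' i xi).
set sb := sqint (fun xi => sinT (trunc r (wim rho u i)) xi - q' i xi).
have N20 : (0 <= (N ^+ 2)%:E)%E by rewrite lee_fin sqr_ge0.
apply: (@le_trans _ _ ((N ^+ 2)%:E * (2%:E * ca + 2%:E * sb) +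
                       (N ^+ 2)%:E * (2%:E * cb + 2%:E * sa))%E).
  apply: leeD.
    rewrite (@eq_sqint _ _ (fun xi => N * ((cosT (trunc r (wre rho u i)) xi - p i xi) +
      (sinT (trunc r (wim rho u i)) xi - q' i xi)))); last by move=> xi; rewrite /FLre /=; ring.
    rewrite sqintZ; last exact: measurable_funD.
    by apply: lee_wpmul2l => //; exact: sqintD.
  rewrite (@eq_sqint _ _ (fun xi => N * ((cosT (trunc r (wim rho u i)) xi - p' i xi) -
    (sinT (trunc r (wre rho u i)) xi - q i xi)))); last by move=> xi; rewrite /FLim /=; ring.
  rewrite sqintZ; last exact: measurable_funB.
  by apply: lee_wpmul2l => //; exact: sqintB.
have ca0 : (0 <= ca)%E := sqint_ge0 _; have sa0 : (0 <= sa)%E := sqint_ge0 _.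
have cb0 : (0 <= cb)%E := sqint_ge0 _; have sb0 : (0 <= sb)%E := sqint_ge0 _.
by rewrite combine4.
Qed.

Lemma sqint_ae0 (h : R -> R) : measurable_fun setT h -> {ae mu, forall t, h t = 0} ->
  sqint h = 0%E.
Proof.
move=> mh h0; rewrite (sqint_aeeq mh (measurable_cst (0 : R)) h0) /sqint.
under eq_integral do rewrite expr0n/=.
exact: integral0.
Qed.

(** The truncated transforms of [u] and [v] approach the same [g], so those of [u - v] vanish;
    dividing by [N] leaves the hypothesis of [complex_transform_inj] in each coordinate. *)
Lemma is_FL_inj rho u v g : is_FL rho u g -> is_FL rho v g -> {ae mu, forall t, u t = v t}.
Proof.
move=> /is_FLP[u2 g2 ug] /is_FLP[v2 _ vg].
have uv := L2rhoB u2 v2; have [muv _] := uv.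
apply: (nrm_eq0 u2 v2); rewrite nrmE//; apply: big1 => i _.
have mur r := measurable_FLre r i u2; have mui r := measurable_FLim r i u2.
have mvr r := measurable_FLre r i v2; have mvi r := measurable_FLim r i v2.
have [mgr mgi] := g2.1 i.
move/L2rhoP : uv => /(_ i)[]; rewrite (funext (wreB rho u v i)) (funext (wimB rho u v i)).
move=> a2 b2.
move/L2rhoP : u2 => /(_ i)[ur ui]; move/L2rhoP : v2 => /(_ i)[vr vi].
have [|ha hb] := complex_transform_inj a2 b2; last first.
  have [ma _] := a2; have [mb _] := b2.
  by rewrite (sqint_ae0 ma ha) (sqint_ae0 mb hb) adde0.
apply: (@vanish_le _ (fun r => ((N^-1) ^+ 2)%:E * (2%:E * FLerr rho u g r + 2%:E * FLerr rho v g r))%E).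
  by apply: vanishZ; [exact: sqr_ge0|apply: vanishD; exact: vanishZ].
move=> r.
have tB (a b : R -> R) : trunc r (fun t => a t - b t) = (fun t => trunc r a t - trunc r b t).
  by apply/funext => t; rewrite !truncE; case: ifP => // _; rewrite subrr.
have L1t (a : R -> R) (h : L2 a) : L1 (trunc r a) := L2_trunc_L1 r h.
have Er xi : cosT (trunc r (fun t => wre rho u i t - wre rho v i t)) xi +
    sinT (trunc r (fun t => wim rho u i t - wim rho v i t)) xi =
    N^-1 * ((FLre rho u r i xi - complex.Re (g xi i)) - (FLre rho v r i xi - complex.Re (g xi i))).
  rewrite !tB cosTB ?sinTB; try exact: L1t.
  by rewrite /FLre; field.
have Ei xi : cosT (trunc r (fun t => wim rho u i t - wim rho v i t)) xi -
    sinT (trunc r (fun t => wre rho u i t - wre rho v i t)) xi =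
    N^-1 * ((FLim rho u r i xi - complex.Im (g xi i)) - (FLim rho v r i xi - complex.Im (g xi i))).
  rewrite !tB cosTB ?sinTB; try exact: L1t.
  by rewrite /FLim; field.
rewrite (eq_sqint Er) (eq_sqint Ei).
rewrite !sqintZ; try by apply: measurable_funB; apply: measurable_funB.
have err w : (sqint (fun xi => FLre rho w r i xi - complex.Re (g xi i))%R +
   sqint (fun xi => FLim rho w r i xi - complex.Im (g xi i))%R <= FLerr rho w g r)%E.
  rewrite /FLerr (bigD1 i)//= leeDl//.
  by apply: sume_ge0 => j _; apply: adde_ge0; exact: sqint_ge0.
have N20 : (0 <= (N^-1 ^+ 2)%:E)%E by rewrite lee_fin sqr_ge0.
rewrite -ge0_muleDr ?sqint_ge0//; apply: lee_wpmul2l => //.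
have two0 : (0 <= 2%:E :> \bar R)%E by [].
apply: le_trans (leeD (lee_wpmul2l two0 (err u)) (lee_wpmul2l two0 (err v))).
by apply: lee2D; rewrite ?sqint_ge0//; apply: sqintB; exact: measurable_funB.
Qed.

End fourier_laplace.

(** * The fractional integral as inverse of the fractional derivative *)

Section fractional_integral.
Context {R : realType}.
Local Notation C := (complex R).
Local Notation mu := (@lebesgue_measure R).
Variable n : nat.
Implicit Types (u v w g h : R -> 'I_n -> C).

Lemma vanish_cst_eq0 (x : \bar R) : (0 <= x)%E -> vanish (fun=> x) -> x = 0%E.
Proof.
move=> x0 vx; apply/eqP; rewrite eq_le x0 andbT.
by apply/lee_addgt0Pr => e e0; rewrite add0e; have [N] := vx e e0; apply.
Qed.

Lemma L2_aeeq (f k : R -> R) : measurable_fun setT f -> L2 k ->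
  {ae mu, forall t, f t = k t} -> L2 f.
Proof. by move=> mf [mk k2] fk; split=> //; rewrite (sqint_aeeq mf mk fk). Qed.

Lemma is_FL_unique rho u g h i : is_FL rho u g -> is_FL rho u h ->
  {ae mu, forall xi, complex.Re (g xi i) = complex.Re (h xi i)} /\
  {ae mu, forall xi, complex.Im (g xi i) = complex.Im (h xi i)}.
Proof.
move=> /is_FLP[u2 g2 ug] /is_FLP[_ h2 uh].
have [mgr mgi] := g2.1 i; have [mhr mhi] := h2.1 i.
have mr r := measurable_FLre r i u2; have mi r := measurable_FLim r i u2.
have err w r : (sqint (fun xi => FLre rho u r i xi - complex.Re (w xi i))%R <= FLerr rho u w r)%E /\
   (sqint (fun xi => FLim rho u r i xi - complex.Im (w xi i))%R <= FLerr rho u w r)%E.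
  rewrite /FLerr (bigD1 i)//=.
  have s0 : (0 <= \sum_(j < n | j != i) (sqint (fun xi => FLre rho u r j xi - complex.Re (w xi j))%R +
     sqint (fun xi => FLim rho u r j xi - complex.Im (w xi j))%R))%E.
    by apply: sume_ge0 => j _; apply: adde_ge0; exact: sqint_ge0.
  split; apply: le_trans (leeDl _ s0); [apply: leeDl|apply: leeDr]; exact: sqint_ge0.
have key (p q : R -> R) (X : R -> R -> R) : measurable_fun setT p -> measurable_fun setT q ->
    (forall r, measurable_fun setT (X r)) ->
    (forall r, sqint (fun xi => X r xi - p xi)%R <= FLerr rho u g r)%E ->
    (forall r, sqint (fun xi => X r xi - q xi)%R <= FLerr rho u h r)%E ->
    {ae mu, forall xi, p xi = q xi}.
  move=> mp mq mX Xp Xq.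
  have : {ae mu, forall xi, p xi - q xi = 0}.
    apply: sqint_ae_eq0; first exact: measurable_funB.
    apply: vanish_cst_eq0; first exact: sqint_ge0.
    apply: (vanish_le (vanishD (vanishZ (ler0n R 2) ug) (vanishZ (ler0n R 2) uh))) => r.
    apply: (@le_trans _ _ (2%:E * sqint (fun xi => X r xi - p xi)%R +
                           2%:E * sqint (fun xi => X r xi - q xi)%R)%E).
      apply: sqint_le2D; try exact: measurable_funB.
      move=> xi; have -> : p xi - q xi = (X r xi - q xi) - (X r xi - p xi) by ring.
      by rewrite [leRHS]addrC; exact: ler_normB.
    by apply: leeD; apply: lee_wpmul2l.
  by apply: ae_imp => xi /eqP; rewrite subr_eq0 => /eqP.
split.
  by apply: (key _ _ (fun r => FLre rho u r i)) => // r; case: (err g r); case: (err h r).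
by apply: (key _ _ (fun r => FLim rho u r i)) => // r; case: (err g r); case: (err h r).
Qed.

Variables alpha rho : R.
Hypotheses (alpha0 : 0 < alpha) (alpha1 : alpha <= 1) (rho0 : 0 < rho).
Local Notation k := (frac_kernel alpha rho).

Let k0 x : 0 <= k x. Proof. exact: frac_kernel_ge0. Qed.
Let k1 : L1 k. Proof. exact: L1_frac_kernel. Qed.
Let kmass : \int[mu]_x k x = (rho `^ alpha)^-1. Proof. exact: int_frac_kernel. Qed.
Let m0 : 0 < \int[mu]_x k x. Proof. by rewrite kmass invr_gt0 powR_gt0. Qed.

(** The weights cancel: this is the Riemann-Liouville integral, convolution of [v] with
    [t^(alpha - 1) / Gamma(alpha)] on [t > 0]. The weighted form makes the kernel integrable. *)
Definition fracint v : R -> 'I_n -> C := fun t i =>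
  Complex (expR (rho * t) * conv k (wre rho v i) t) (expR (rho * t) * conv k (wim rho v i) t).

Lemma wre_fracint v i : wre rho (fracint v) i = conv k (wre rho v i).
Proof. by apply/funext => t; rewrite /wre /= mulrA -expRD addNr expR0 mul1r. Qed.

Lemma wim_fracint v i : wim rho (fracint v) i = conv k (wim rho v i).
Proof. by apply/funext => t; rewrite /wim /= mulrA -expRD addNr expR0 mul1r. Qed.

Lemma L2rho_fracint v : L2rho rho v -> L2rho rho (fracint v).
Proof.
move=> /L2rhoP v2; apply/L2rhoP => i; have [vr vi] := v2 i.
by rewrite wre_fracint wim_fracint; split; exact: L2_conv.
Qed.

Lemma nrm_fracint v w : L2rho rho v -> L2rho rho w ->
  (nrm rho (fun t => cvsub (fracint v t) (fracint w t)) <=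
   (((rho `^ alpha)^-1) ^+ 2)%:E * nrm rho (fun t => cvsub (v t) (w t)))%E.
Proof.
move=> v2 w2; have vw := L2rhoB v2 w2; have Jvw := L2rhoB (L2rho_fracint v2) (L2rho_fracint w2).
rewrite (nrmE _ vw.1) (nrmE _ Jvw.1) ge0_sume_distrr; last first.
  by move=> i _; apply: adde_ge0; exact: sqint_ge0.
apply: lee_sum => i _; rewrite ge0_muleDr ?sqint_ge0// -kmass.
move/L2rhoP : Jvw => /(_ i); move/L2rhoP : vw => /(_ i).
move/L2rhoP : v2 => /(_ i)[vr vi]; move/L2rhoP : w2 => /(_ i)[wr wi].
rewrite !(funext (wreB _ _ _ _)) !(funext (wimB _ _ _ _)) !wre_fracint !wim_fracint.
move=> [[a2 _] [b2 _]] [[c2 _] [d2 _]].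
apply: leeD.
  rewrite (sqint_aeeq c2 (measurable_conv k1 a2)); last first.
    by apply: ae_imp (convB k0 k1 m0 vr wr) => t ->.
  exact: (sqint_conv k0 k1 m0 (L2B vr wr)).
rewrite (sqint_aeeq d2 (measurable_conv k1 b2)); last first.
  by apply: ae_imp (convB k0 k1 m0 vi wi) => t ->.
exact: (sqint_conv k0 k1 m0 (L2B vi wi)).
Qed.

Lemma fracint_aeeq v w : cmeasurable setT v -> cmeasurable setT w ->
  {ae mu, forall t, v t = w t} -> fracint v = fracint w.
Proof.
move=> /(cmeasurableP rho) mv /(cmeasurableP rho) mw vw; apply/funext => t; apply/funext => i.
have [mvr mvi] := mv i; have [mwr mwi] := mw i; have [hr hi] := L2rho_aeeq rho i vw.
by rewrite /fracint (conv_aeeq k1 mvr mwr hr) (conv_aeeq k1 mvi mwi hi).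
Qed.

Lemma fracint_causal v t i : (forall s, s <= 0 -> v s i = 0) -> t <= 0 -> fracint v t i = 0.
Proof.
move=> v0 t0; rewrite /fracint.
have z (a : R -> R) : (forall s, s <= 0 -> a s = 0) -> conv k a t = 0.
  move=> a0; rewrite /conv (@eq_Rintegral _ _ _ mu setT (fun=> 0)).
    by rewrite Rintegral_cst// mul0r.
  move=> s _; have [s0|s0] := leP s 0; first by rewrite a0// mulr0.
  by rewrite frac_kernel_neg ?mul0r// subr_le0 (le_trans t0)// ltW.
by rewrite !z ?mulr0// => s s0; rewrite /wre /wim v0// mulr0.
Qed.

(* [(i xi + rho)^(- alpha)] *)
Let symbol (xi : R) : C := Complex (cosT k xi) (- sinT k xi).

(** The two factors have reciprocal moduli and opposite angles, so the product comes down to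
    [cos ^+ 2 + sin ^+ 2 = 1]. *)
Let powFL_symbol xi : powFL rho alpha xi * symbol xi = 1.
Proof.
rewrite /powFL /symbol cosT_frac_kernel// sinT_frac_kernel//.
have p : (xi ^+ 2 + rho ^+ 2) `^ (alpha / 2) != 0.
  by rewrite gt_eqF// powR_gt0// ltr_wpDl ?sqr_ge0 ?exprn_gt0.
set m := powR _ _ in p *; set c := cos _; set s := sin _.
have cs : c ^+ 2 + s ^+ 2 = 1 by exact: cos2Dsin2.
apply/eqP; rewrite eq_complex/=; apply/andP; split; apply/eqP; last by field.
by rewrite -cs; field.
Qed.

Lemma is_FL_exists v : L2rho rho v -> exists h, is_FL rho v h.
Proof.
move=> /L2rhoP v2.
have /choice[pq pqP] : forall i, exists pq : (R -> R) * (R -> R),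
    is_transform (wre rho v i) pq.1 pq.2.
  by move=> i; have [p [q pq]] := transform_exists (v2 i).1; exists (p, q).
have /choice[pq' pqP'] : forall i, exists pq : (R -> R) * (R -> R),
    is_transform (wim rho v i) pq.1 pq.2.
  by move=> i; have [p [q pq']] := transform_exists (v2 i).2; exists (p, q).
eexists; exact: is_FL_of_transform pqP pqP'.
Qed.

(** The multiplier rule is known for the transform [G] assembled from [is_transform]; uniqueness up
    to null sets carries it to the given [h]. *)
Lemma is_FL_fracint v h : is_FL rho v h ->
  is_FL rho (fracint v) (fun xi i => symbol xi * h xi i).
Proof.
move=> vh; have /is_FLP[/L2rhoP v2 h2 _] := vh.
have /choice[pq pqP] : forall i, exists pq : (R -> R) * (R -> R),
    is_transform (wre rho v i) pq.1 pq.2.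
  by move=> i; have [p [q pq]] := transform_exists (v2 i).1; exists (p, q).
have /choice[pq' pqP'] : forall i, exists pq : (R -> R) * (R -> R),
    is_transform (wim rho v i) pq.1 pq.2.
  by move=> i; have [p [q pq']] := transform_exists (v2 i).2; exists (p, q).
have vG := is_FL_of_transform pqP pqP'; set G := (fun xi i => _) in vG.
have JG : is_FL rho (fracint v) (fun xi i => symbol xi * G xi i).
  have T i := transform_conv k0 k1 m0 (pqP i); have T' i := transform_conv k0 k1 m0 (pqP' i).
  have := @is_FL_of_transform _ _ rho (fracint v) _ _ _ _
    (fun i => eq_ind_r (fun f => is_transform f _ _) (T i) (wre_fracint v i))
    (fun i => eq_ind_r (fun f => is_transform f _ _) (T' i) (wim_fracint v i)).
  congr (is_FL _ _ _); apply/funext => xi; apply/funext => i; rewrite /G /symbol.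
  by apply/eqP; rewrite eq_complex/=; apply/andP; split; apply/eqP; ring.
have GH i := is_FL_unique i vG vh.
have mA : measurable_fun setT (cosT k) by apply: measurable_cosT; exact: L1_measurable k1.
have mB : measurable_fun setT (sinT k) by apply: measurable_sinT; exact: L1_measurable k1.
have er i : {ae mu, forall xi, complex.Re (symbol xi * G xi i) = complex.Re (symbol xi * h xi i)}.
  have [hr hi] := GH i; move: hr hi; apply: ae_imp2 => xi.
  by case: (G xi i) => a b; case: (h xi i) => c d /= -> ->.
have ei i : {ae mu, forall xi, complex.Im (symbol xi * G xi i) = complex.Im (symbol xi * h xi i)}.
  have [hr hi] := GH i; move: hr hi; apply: ae_imp2 => xi.
  by case: (G xi i) => a b; case: (h xi i) => c d /= -> ->.
apply: (is_FL_aeeq JG) => //.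
have /is_FLP[_ /L2rhoP JG2 _] := JG.
apply/L2rhoP => i; have := JG2 i; rewrite !wre0 !wim0 => -[Gr Gi].
have [mhr mhi] := h2.1 i.
split.
  apply: (L2_aeeq _ Gr); last by move: (er i); apply: ae_imp => xi ->.
  rewrite (_ : (fun _ => _) = fun xi => cosT k xi * complex.Re (h xi i) + sinT k xi * complex.Im (h xi i)).
    by apply: measurable_funD; exact: measurable_funM.
  by apply/funext => xi; rewrite /symbol; case: (h xi i) => a b /=; ring.
apply: (L2_aeeq _ Gi); last by move: (ei i); apply: ae_imp => xi ->.
rewrite (_ : (fun _ => _) = fun xi => cosT k xi * complex.Im (h xi i) - sinT k xi * complex.Re (h xi i)).
  by apply: measurable_funB; exact: measurable_funM.
by apply/funext => xi; rewrite /symbol; case: (h xi i) => a b /=; ring.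
Qed.

Lemma frac_deriv_fracint v : L2rho rho v ->
  Hrho rho alpha (fracint v) /\ frac_deriv_eq rho alpha (fracint v) v.
Proof.
move=> v2; have [h vh] := is_FL_exists v2; have [_ [h2 _]] := vh.
have E : (fun xi i => powFL rho alpha xi * (symbol xi * h xi i)) = h.
  by apply/funext => xi; apply/funext => i; rewrite mulrA powFL_symbol mul1r.
have Jh := is_FL_fracint vh.
by split; exists (fun xi i => symbol xi * h xi i); rewrite E; split;
  [exact: Jh|exact: h2|exact: Jh|exact: vh].
Qed.

(** Multiplying the transform of [v] by the symbol shows that [fracint v] has the same transform [g]
    as [u]; injectivity concludes. *)
Lemma frac_deriv_eq_fracint u v : frac_deriv_eq rho alpha u v ->
  {ae mu, forall t, u t = fracint v t}.
Proof.
move=> [g [ug vg]]; apply: is_FL_inj ug _.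
have := is_FL_fracint vg; congr (is_FL _ _ _).
apply/funext => xi; apply/funext => i.
by rewrite mulrA [symbol xi * _]mulrC powFL_symbol mul1r.
Qed.

End fractional_integral.

(** * Well-posedness *)

Section fixed_point.
Context {R : realType}.
Local Notation C := (complex R).
Local Notation mu := (@lebesgue_measure R).
Variable n : nat.
Implicit Types (u v w y z : R -> 'I_n -> C).
Variable rho : R.
Variable Phi : (R -> 'I_n -> C) -> (R -> 'I_n -> C).
Hypothesis PhiL2 : forall y, L2rho rho y -> L2rho rho (Phi y).
(* [nrm] is a squared norm; the factor makes the increments of the iterates decay as fast
   as [riesz_fischer] requires. *)
Hypothesis PhiC : forall y z, L2rho rho y -> L2rho rho z ->
  (nrm rho (fun t => cvsub (Phi y t) (Phi z t)) <=
   (16^-1)%:E * nrm rho (fun t => cvsub (y t) (z t)))%E.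

Lemma L2rho0 : L2rho rho (fun _ => @cvzero R n).
Proof.
apply/L2rhoP => i.
have z : L2 (fun _ : R => 0 : R).
  split; first exact: measurable_cst.
  by rewrite /sqint; under eq_integral do rewrite expr0n/=; rewrite integral0.
have -> : wre rho (fun _ => @cvzero R n) i = fun=> 0 by apply/funext => t; rewrite /wre mulr0.
by have -> : wim rho (fun _ => @cvzero R n) i = fun=> 0 by apply/funext => t; rewrite /wim mulr0.
Qed.

Lemma nrm_fin u : L2rho rho u -> nrm rho u \is a fin_num.
Proof. by move=> u2; rewrite ge0_fin_numE ?nrm_ge0// nrm_lty. Qed.

Let Y k := iter k Phi (fun _ => @cvzero R n).

Let Y2 k : L2rho rho (Y k).
Proof. by elim: k => [|k IH]; [exact: L2rho0|exact: PhiL2]. Qed.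

Let A := fine (nrm rho (fun t => cvsub (Y 1 t) (Y 0 t))).

Let YA k : (nrm rho (fun t => cvsub (Y k.+1 t) (Y k t)) <= (A / 16 ^+ k)%:E)%E.
Proof.
elim: k => [|k IH].
  by rewrite expr0 divr1 fineK//; apply: nrm_fin; exact: L2rhoB.
apply: le_trans (PhiC (Y2 k.+1) (Y2 k)) _.
apply: le_trans (lee_wpmul2l _ IH) _; first by rewrite lee_fin.
by rewrite -EFinM lee_fin exprS invfM mulrCA.
Qed.

Let sqint_le_nrm u i : L2rho rho u ->
  (sqint (wre rho u i) <= nrm rho u)%E /\ (sqint (wim rho u i) <= nrm rho u)%E.
Proof.
move=> u2; rewrite (nrmE _ u2.1) (bigD1 i)//=.
have s0 : (0 <= \sum_(j < n | j != i) (sqint (wre rho u j) + sqint (wim rho u j)))%E.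
  by apply: sume_ge0 => j _; apply: adde_ge0; exact: sqint_ge0.
by split; apply: le_trans (leeDl _ s0); [apply: leeDl|apply: leeDr]; exact: sqint_ge0.
Qed.

Let limit_coord : exists y, L2rho rho y /\
  forall k, (nrm rho (fun t => cvsub (Y k t) (y t)) <= ((n%:R * (16 * A)) / 4 ^+ k)%:E)%E.
Proof.
have /choice[p pP] : forall i, exists p, L2 p /\
    forall k, (sqint (fun t => wre rho (Y k) i t - p t)%R <= (8 * A / 4 ^+ k)%:E)%E.
  move=> i; apply: riesz_fischer => k.
    by have /L2rhoP/(_ i)[] := Y2 k.
  apply: le_trans (YA k); rewrite -(funext (wreB rho (Y k.+1) (Y k) i)).
  by have [] := sqint_le_nrm i (L2rhoB (Y2 k.+1) (Y2 k)).
have /choice[q qP] : forall i, exists q, L2 q /\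
    forall k, (sqint (fun t => wim rho (Y k) i t - q t)%R <= (8 * A / 4 ^+ k)%:E)%E.
  move=> i; apply: riesz_fischer => k.
    by have /L2rhoP/(_ i)[] := Y2 k.
  apply: le_trans (YA k); rewrite -(funext (wimB rho (Y k.+1) (Y k) i)).
  by have [] := sqint_le_nrm i (L2rhoB (Y2 k.+1) (Y2 k)).
pose y t i : C := Complex (expR (rho * t) * p i t) (expR (rho * t) * q i t).
have yr i : wre rho y i = p i.
  by apply/funext => t; rewrite /wre /= mulrA -expRD addNr expR0 mul1r.
have yi i : wim rho y i = q i.
  by apply/funext => t; rewrite /wim /= mulrA -expRD addNr expR0 mul1r.
have y2 : L2rho rho y.
  by apply/L2rhoP => i; rewrite yr yi; split; [case: (pP i)|case: (qP i)].
exists y; split=> // k; rewrite (nrmE _ (L2rhoB (Y2 k) y2).1).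
(* Real and imaginary parts of [n] coordinates, each contributing [8 * A / 4 ^+ k]. *)
apply: (@le_trans _ _ (\sum_(i < n) (8 * A / 4 ^+ k + 8 * A / 4 ^+ k)%:E)%E).
  apply: lee_sum => i _; rewrite (funext (wreB _ _ _ _)) (funext (wimB _ _ _ _)) yr yi EFinD.
  by apply: leeD; [case: (pP i)|case: (qP i)].
rewrite sumEFin lee_fin sumr_const card_ord -mulr_natl le_eqVlt; apply/orP; left; apply/eqP.
by ring.
Qed.

(** [Phi y] and [y] are compared through the iterate [Y k.+1]: it is near [Phi y] by contraction and
    near [y] by convergence. *)
Lemma contraction_fixed_point : exists y, L2rho rho y /\ {ae mu, forall t, Phi y t = y t}.
Proof.
have [y [y2 Yy]] := limit_coord; exists y; split=> //.
apply: (nrm_eq0 (PhiL2 y2) y2); apply: vanish_cst_eq0; first exact: nrm_ge0.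
apply: (@vanish_of_approx _ _ (fun=> 0%E) (n%:R * (16 * A))).
  by move=> e e0; exists 0 => r _; rewrite lee_fin ltW.
move=> k r; rewrite add0e.
apply: le_trans (nrm_triangle (PhiL2 y2) (Y2 k.+1) y2) _.
have h1 := PhiC y2 (Y2 k); rewrite (nrm_subC rho y) in h1.
have h1' := le_trans h1 (lee_wpmul2l _ (Yy k)).
apply: le_trans (leeD (lee_wpmul2l _ (h1' _)) (lee_wpmul2l _ (Yy k.+1))) _ => //.
set B := n%:R * (16 * A).
have B0 : 0 <= B / 4 ^+ k by rewrite -lee_fin; apply: le_trans (Yy k); exact: nrm_ge0.
have -> : B / 4 ^+ k.+1 = B / 4 ^+ k / 4 by rewrite exprS invfM mulrCA mulrC.
by move: B0; rewrite -!EFinM -EFinD lee_fin; move: (B / 4 ^+ k) => x x0; lra.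
Qed.

End fixed_point.

(** * Solving the integrated equation *)

Section well_posedness.
Context {R : realType}.
Local Notation C := (complex R).
Local Notation mu := (@lebesgue_measure R).
Variables (n : nat) (f : R -> ('I_n -> C) -> ('I_n -> C)) (y0 : 'I_n -> C) (c r0 : R).
Hypothesis cf : forall (t : R) (y : 'I_n -> C) (eps : R), 0 < t -> 0 < eps ->
  exists2 delta : R, 0 < delta &
    forall (s : R) (z : 'I_n -> C), 0 < s -> `|s - t| < delta ->
      cvnorm (cvsub z y) < delta -> cvnorm (cvsub (f s z) (f t y)) < eps.
Hypothesis c0 : 0 <= c.
Hypothesis lipf : forall (t : R) (y1 y2 : 'I_n -> C), 0 < t ->
  cvnorm (cvsub (f t y1) (f t y2)) <= c * cvnorm (cvsub y1 y2).
Hypothesis f0 : L2rho_on r0 `]0, +oo[ (fun t => f t (@cvzero R n)).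

Implicit Types u v y : R -> 'I_n -> C.
Local Notation F y := (fun t => ftilde f t (y t)).

Let cvsubxx (z : 'I_n -> C) : cvnorm (cvsub z z) = 0.
Proof.
rewrite /cvnorm /cvnorm2 big1 ?sqrtr0// => i _.
by rewrite /cvsub ReB ImB !subrr expr0n addr0.
Qed.

Let continuous_coord (h : C -> R) (z : 'I_n -> C) (i : 'I_n) :
  (forall v w : 'I_n -> C, `|h (v i) - h (w i)| <= cvnorm (cvsub v w)) ->
  measurable_fun (`]0, +oo[ : set R) (fun t : R => h (f t z i)).
Proof.
move=> hl; apply: open_continuous_measurable_fun; first exact: interval_open.
move=> t; rewrite inE/= in_itv/= andbT => t0.
apply/cvgrPdist_lt => e e0; have [d d0 H] := cf z t0 e0.
near=> s; rewrite distrC; apply: le_lt_trans (hl _ _) _; apply: H.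
- by near: s; exact: lt_nbhsr.
- rewrite distrC; near: s; apply/nbhs_ballP; exists d => //=.
by rewrite cvsubxx.
Unshelve. all: by end_near. Qed.

Lemma cmeasurable_superposition y : cmeasurable setT y -> cmeasurable setT (F y).
Proof.
move=> my i.
have myr j : measurable_fun (`]0, +oo[ : set R) (fun t : R => complex.Re (y t j)).
  by apply: measurable_funTS; case: (my j).
have myi j : measurable_fun (`]0, +oo[ : set R) (fun t : R => complex.Im (y t j)).
  by apply: measurable_funTS; case: (my j).
have D (t : R) : `]0%R, +oo[%classic t -> 0 < t by rewrite /= in_itv/= andbT.
split.
  rewrite (_ : (fun t => _) = (fun t => complex.Re (f t (y t) i)) \_ `]0%R, +oo[); last first.
    apply/funext => t; rewrite /ftilde patchE; case: ifPn => t0.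
      by rewrite mem_set//= in_itv/= t0.
    by rewrite memNset//= in_itv/= andbT; exact/negP.
  apply: (proj1 (measurable_restrictT _ _)) => //.
  apply: (@measurable_superposition R n _ R _ (fun t z => complex.Re (f t z i)) c y c0) => //.
    by move=> z; apply: (@continuous_coord (@complex.Re R) z i) => v w; exact: normRe_le.
  by move=> t z w /D t0; apply: le_trans (normRe_le _ _ _) _; exact: lipf.
rewrite (_ : (fun t => _) = (fun t => complex.Im (f t (y t) i)) \_ `]0%R, +oo[); last first.
  apply/funext => t; rewrite /ftilde patchE; case: ifPn => t0.
    by rewrite mem_set//= in_itv/= t0.
  by rewrite memNset//= in_itv/= andbT; exact/negP.
apply: (proj1 (measurable_restrictT _ _)) => //.
apply: (@measurable_superposition R n _ R _ (fun t z => complex.Im (f t z i)) c y c0) => //.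
  by move=> z; apply: (@continuous_coord (@complex.Im R) z i) => v w; exact: normIm_le.
by move=> t z w /D t0; apply: le_trans (normIm_le _ _ _) _; exact: lipf.
Qed.

Section weight.
Variable rho : R.
Hypothesis r0rho : r0 <= rho.

Let cvnorm2_lip t (v w : 'I_n -> C) :
  cvnorm2 (cvsub (ftilde f t v) (ftilde f t w)) <= c ^+ 2 * cvnorm2 (cvsub v w).
Proof.
rewrite /ftilde; case: ifPn => t0; last first.
  by rewrite -cvnorm_sqr cvsubxx expr0n mulr_ge0 ?sqr_ge0// cvnorm2_ge0.
rewrite -!cvnorm_sqr -exprMn lerXn2r ?nnegrE ?mulr_ge0 ?sqrtr_ge0//.
exact: lipf.
Qed.

Let measurable_density u : cmeasurable setT u ->
  measurable_fun setT (fun t => cvnorm2 (u t) * expR (- (2 * rho * t))).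
Proof.
move=> /(cmeasurableP rho) mu_; rewrite (funext (weighted_cvnorm2 rho u)).
apply: measurable_sum => i; have [mr mi] := mu_ i.
by apply: measurable_funD; exact: measurable_funX.
Qed.

Let cmeasurableB u v : cmeasurable setT u -> cmeasurable setT v ->
  cmeasurable setT (fun t => cvsub (u t) (v t) : 'I_n -> C).
Proof.
move=> mu_ mv i; have [a b] := mu_ i; have [a' b'] := mv i.
rewrite /cvsub; under eq_fun do rewrite ReB.
by under [X in _ /\ measurable_fun _ X]eq_fun do rewrite ImB; split; exact: measurable_funB.
Qed.

Lemma nrm_superposition y (z : R -> 'I_n -> C) : cmeasurable setT y -> cmeasurable setT z ->
  (nrm rho (fun t => cvsub (F y t) (F z t)) <=
   (c ^+ 2)%:E * nrm rho (fun t => cvsub (y t) (z t)))%E.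
Proof.
move=> my mz; have mFy := cmeasurable_superposition my; have mFz := cmeasurable_superposition mz.
have mF := measurable_density (cmeasurableB mFy mFz).
have myz := measurable_density (cmeasurableB my mz).
rewrite /nrm -ge0_integralZl_EFin//; last 3 first.
- by move=> t _; rewrite lee_fin mulr_ge0 ?expR_ge0// cvnorm2_ge0.
- exact/measurable_EFinP.
- exact: sqr_ge0.
under [leRHS]eq_integral do rewrite -EFinM.
apply: le_ge0_integral => //.
- exact: measurable_funM.
- by move=> t; rewrite mulr_ge0 ?expR_ge0// cvnorm2_ge0.
by move=> t; rewrite mulrA ler_wpM2r ?expR_ge0.
Qed.

(** For [t > 0] the weight decreases as [rho] grows, so integrability at [r0] suffices; for [t <= 0]
    the extension by zero contributes nothing. *)
Lemma L2rho_superposition0 : L2rho rho (F (fun=> @cvzero R n)).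
Proof.
have m0 : cmeasurable setT (fun _ : R => @cvzero R n) by move=> i; split; exact: measurable_cst.
have mF := cmeasurable_superposition m0.
split=> //; apply: le_lt_trans f0.2.
rewrite [leRHS]integral_mkcond; apply: ge0_le_integral => //.
- by move=> t _; rewrite lee_fin mulr_ge0 ?expR_ge0// cvnorm2_ge0.
- by apply/measurable_EFinP; exact: measurable_density.
- apply: (proj1 (measurable_restrictT _ _)) => //; apply/measurable_EFinP.
  apply: measurable_funM.
    apply: measurable_sum => i; have [a b] := f0.1 i.
    by apply: measurable_funD; exact: measurable_funX.
  by apply: measurable_funTS; apply: measurableT_comp => //; apply: measurableT_comp.
move=> t _; rewrite patchE /ftilde; case: ifPn => t0.
  rewrite mem_set/= ?in_itv/= ?t0// lee_fin ler_wpM2l ?cvnorm2_ge0//.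
  by rewrite ler_expR lerN2 ler_wpM2r ?(ltW t0)// ler_wpM2l.
rewrite memNset/= ?in_itv/= ?andbT; last exact/negP.
rewrite /cvnorm2 big1 ?mul0r// => i _.
by rewrite expr0n addr0.
Qed.

Lemma L2rho_superposition y : L2rho rho y -> L2rho rho (F y).
Proof.
move=> y2; have F02 := L2rho_superposition0.
have m0 : cmeasurable setT (fun _ : R => @cvzero R n) by move=> i; split; exact: measurable_cst.
have mF := cmeasurable_superposition y2.1.
have d2 : L2rho rho (fun t => cvsub (F y t) (F (fun=> @cvzero R n) t)).
  split; first exact: cmeasurableB mF F02.1.
  apply: le_lt_trans (nrm_superposition y2.1 m0) _.
  apply: lte_mul_pinfty => //; first by rewrite lee_fin sqr_ge0.
  exact: nrm_lty (L2rhoB y2 (L2rho0 n rho)).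
apply/L2rhoP => i; move/L2rhoP : d2 => /(_ i); move/L2rhoP : F02 => /(_ i).
rewrite (funext (wreB _ _ _ _)) (funext (wimB _ _ _ _)) => -[a b] [d e].
split; [have := L2D d a|have := L2D e b]; congr L2; apply/funext => t; exact: subrK.
Qed.

Hypothesis rho_gt0 : 0 < rho.

(** The weighted indicator of [t > 0] is [gker 1 rho], and its square is [gker 1 (2 * rho)]. *)
Lemma L2rho_y0chi : L2rho rho (y0chi y0).
Proof.
have g2 : L2 (gker 1 rho).
  split; first exact: measurable_gker.
  have r2 : 0 < 2 * rho by rewrite mulr_gt0.
  have := L1_int_lty (@L1_gker R 1 (2 * rho) ltr01 _ r2) => /(_ (ler1n _ _)).
  apply: le_lt_trans; rewrite le_eqVlt; apply/orP; left; apply/eqP.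
  apply: eq_integral => t _; congr EFin; have [t0|t0] := leP t 0.
    by rewrite !gker_neg// normr0 expr0n.
  rewrite !gker_pos// subrr !powRr0 !mul1r ger0_norm ?expR_ge0// expr2 -expRD.
  by congr expR; ring.
have E (x t : R) : expR (- (rho * t)) * (if 0 < t then x else 0) = x * gker 1 rho t.
  have [t0|t0] := ltP 0 t; last by rewrite gker_neg// !mulr0.
  by rewrite gker_pos// subrr powRr0 mul1r mulrC.
apply/L2rhoP => i; split.
  have -> : wre rho (y0chi y0) i = fun t => complex.Re (y0 i) * gker 1 rho t.
    by apply/funext => t; rewrite -E /wre /y0chi; case: ifP.
  exact: L2Z.
have -> : wim rho (y0chi y0) i = fun t => complex.Im (y0 i) * gker 1 rho t.
  by apply/funext => t; rewrite -E /wim /y0chi; case: ifP.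
exact: L2Z.
Qed.

Variable alpha : R.
Hypotheses (alpha0 : 0 < alpha) (alpha1 : alpha <= 1).
Hypothesis rho_large : 4 * c <= rho `^ alpha.

Local Notation J := (fracint alpha rho).

(* The integrated equation is [y = Phi y]. *)
Let Phi (y : R -> 'I_n -> C) : R -> 'I_n -> C := fun t i => y0chi y0 t i + J (F y) t i.

Let Phi_sub y t : cvsub (Phi y t) (y0chi y0 t) = J (F y) t.
Proof. by apply/funext => i; rewrite /cvsub /Phi addrC addKr. Qed.

Let L2rho_Phi y : L2rho rho y -> L2rho rho (Phi y).
Proof.
move=> y2; have J2 := L2rho_fracint alpha0 alpha1 rho_gt0 (L2rho_superposition y2).
have h2 := L2rho_y0chi.
apply/L2rhoP => i; move/L2rhoP : J2 => /(_ i)[a b]; move/L2rhoP : h2 => /(_ i)[d e].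
split; [have := L2D d a|have := L2D e b]; congr L2; apply/funext => t.
  by rewrite /wre /Phi -mulrDr; case: (y0chi y0 t i); case: (J _ t i).
by rewrite /wim /Phi -mulrDr; case: (y0chi y0 t i); case: (J _ t i).
Qed.

(** Young's inequality contributes the inverse of [rho] to the power [alpha], the nonlinearity
    contributes [c]. By [rho_large] the product is at most [1 / 4], and it enters squared. *)
Let Phi_contraction y (z : R -> 'I_n -> C) : L2rho rho y -> L2rho rho z ->
  (nrm rho (fun t => cvsub (Phi y t) (Phi z t)) <=
   (16^-1)%:E * nrm rho (fun t => cvsub (y t) (z t)))%E.
Proof.
move=> y2 z2.
have -> : (fun t => cvsub (Phi y t) (Phi z t)) = (fun t => cvsub (J (F y) t) (J (F z) t)).
  by apply/funext => t; apply/funext => i; rewrite /cvsub /Phi opprD addrACA subrr add0r.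
apply: le_trans (nrm_fracint alpha0 alpha1 rho_gt0 (L2rho_superposition y2) (L2rho_superposition z2)) _.
apply: le_trans (lee_wpmul2l _ (nrm_superposition y2.1 z2.1)) _.
  by rewrite lee_fin sqr_ge0.
rewrite muleA -EFinM; apply: lee_wpmul2r; first exact: nrm_ge0.
have p : 0 < rho `^ alpha by rewrite powR_gt0.
rewrite lee_fin -exprMn mulrC.
have -> : 16^-1 = (4^-1) ^+ 2 :> R by rewrite expr2 -invfM -natrM.
rewrite lerXn2r ?nnegrE ?divr_ge0 ?(ltW p) ?invr_ge0//.
by rewrite ler_pdivrMr// mulrC ler_pdivlMr// mulrC.
Qed.

Lemma well_posed : exists y,
  [/\ is_solution rho alpha f y0 y,
      (forall y', is_solution rho alpha f y0 y' -> {ae mu, forall t, y' t = y t}) &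
      {ae mu, forall t, t < 0 -> y t = @cvzero R n}].
Proof.
have [z [z2 zP]] := contraction_fixed_point L2rho_Phi Phi_contraction.
(* [z] is a fixed point only almost everywhere. Since [fracint] ignores null sets, [Phi z] is fixed
   at every point. *)
pose y := Phi z; have y2 : L2rho rho y := L2rho_Phi z2.
have Fy2 := L2rho_superposition y2; have Fz2 := L2rho_superposition z2.
have yP : Phi y = y.
  have JE : J (F y) = J (F z).
    apply: (fracint_aeeq alpha0 alpha1 rho_gt0 Fy2.1 Fz2.1).
    by move: zP; apply: ae_imp => t; rewrite /y => ->.
  by apply/funext => t; apply/funext => i; rewrite {1}/Phi JE.
have yE : (fun t => cvsub (y t) (y0chi y0 t)) = J (F y).
  by apply/funext => t; rewrite -{1}yP Phi_sub.
clearbody y.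
exists y; split.
- have [h1 h2] := frac_deriv_fracint alpha0 alpha1 rho_gt0 Fy2.
  by split; [exact: y2|rewrite yE; split; [exact: h1|exact: h2]].
- move=> y' [y'2 [_ y'D]].
  have Fy'2 := L2rho_superposition y'2.
  have y'P : {ae mu, forall t, y' t = Phi y' t}.
    have := frac_deriv_eq_fracint alpha0 alpha1 rho_gt0 y'D.
    apply: ae_imp => t h; apply/funext => i.
    by rewrite /Phi -h /cvsub addrC subrK.
  apply: (nrm_eq0 y'2 y2).
  have Phi'2 := L2rho_Phi y'2.
  have E : nrm rho (fun t => cvsub (y' t) (y t)) = nrm rho (fun t => cvsub (Phi y' t) (Phi y t)).
    apply: nrm_of_aeeq.
    - by case: (L2rhoB y'2 y2).
    - by rewrite yP; case: (L2rhoB Phi'2 y2).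
    by move: y'P; apply: ae_imp => t h; rewrite yP -h.
  (* A finite squared distance that is at most a sixteenth of itself is zero. *)
  have := Phi_contraction y'2 y2; rewrite -E.
  have Nf := nrm_fin (L2rhoB y'2 y2); have N0 := nrm_ge0 rho (fun t => cvsub (y' t) (y t)).
  rewrite -(fineK Nf) -EFinM lee_fin => h.
  have : 0 <= fine (nrm rho (fun t => cvsub (y' t) (y t))) by rewrite fine_ge0.
  by move: h; set x := fine _ => h x0; congr EFin; lra.
apply: aeW => t t0; rewrite -yP; apply/funext => i; rewrite /Phi /y0chi ltNge (ltW t0)/=.
rewrite add0r fracint_causal ?ltW// => s s0.
by rewrite /ftilde ltNge s0.
Qed.

End weight.
End well_posedness.

Theorem theorem6p2 (R : realType) (alpha : R) (n : nat) (rho0 : R)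
  (f : R -> ('I_n -> complex R) -> ('I_n -> complex R)) (y0 : 'I_n -> complex R) :
  0 < alpha <= 1 ->
  (* continuity of f on (0,oo) x C^n *)
  (forall (t : R) (y : 'I_n -> complex R) (eps : R), 0 < t -> 0 < eps ->
     exists2 delta : R, 0 < delta &
       forall (s : R) (z : 'I_n -> complex R), 0 < s -> `|s - t| < delta ->
         cvnorm (cvsub z y) < delta -> cvnorm (cvsub (f s z) (f t y)) < eps) ->
  (* uniform Lipschitz condition *)
  (exists2 c : R, 0 <= c &
     forall (t : R) (y1 y2 : 'I_n -> complex R), 0 < t ->
       cvnorm (cvsub (f t y1) (f t y2)) <= c * cvnorm (cvsub y1 y2)) ->
  L2rho_on rho0 `]0, +oo[ (fun t => f t (@cvzero R n)) ->
  exists2 rho1 : R, 0 < rho1 &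
    forall rho : R, rho1 <= rho ->
      exists y : R -> 'I_n -> complex R,
        [/\ is_solution rho alpha f y0 y,
            (forall y' : R -> 'I_n -> complex R, is_solution rho alpha f y0 y' ->
               {ae (@lebesgue_measure R), forall t, y' t = y t}) &
            (* spt y is contained in [0,oo) *)
            {ae (@lebesgue_measure R), forall t, t < 0 -> y t = @cvzero R n}].
Proof.
move=> /andP[alpha0 alpha1] cf [c c0 lipf] f0.
have p0 : 0 <= (4 * c) `^ alpha^-1 by exact: powR_ge0.
(* The first two terms ensure [rho > 0] and [rho >= rho0]; the last, raised to the power [alpha],
   gives [rho_large]. *)
exists (1 + `|rho0| + (4 * c) `^ alpha^-1).
  by rewrite -addrA ltr_pwDl// addr_ge0.
move=> rho rho1.
have h1 : rho0 <= rho.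
  by apply: le_trans (ler_norm _) _; have := normr_ge0 rho0; lra.
have h2 : 0 < rho by have := normr_ge0 rho0; lra.
have h3 : (4 * c) `^ alpha^-1 <= rho by have := normr_ge0 rho0; lra.
apply: (well_posed y0 cf c0 lipf f0 h1 h2 alpha0 alpha1).
have : ((4 * c) `^ alpha^-1) `^ alpha <= rho `^ alpha.
  by apply: ge0_ler_powR; rewrite ?nnegrE ?(ltW alpha0) ?(ltW h2).
by rewrite -powRrM mulVf ?gt_eqF// powRr1// mulr_ge0.
Qed.
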